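(* Let $E\subseteq\mathbf R^d$ be a non-degenerate parallelepiped, $s,t>0$ with $s+t\ge1$, $f\in(\mathcal E_s^E)'(\mathbf R^d)$, $\psi\in\mathcal E_s^E(\mathbf R^d)$ and $\phi\in\mathcal S_t^s(\mathbf R^d)\setminus\{0\}$. Then $(x,\xi)\mapsto (V_\phi f)(x,\xi)\overline{(V_\phi\psi)(x,\xi)}$ belongs to $L^1(E\times\mathbf R^d)$ and $$(f,\psi)_E=(\|\phi\|_{L^2}^2|E|)^{-1}\int_E\Big(\int_{\mathbf R^d}(V_\phi f)(x,\xi)\overline{(V_\phi\psi)(x,\xi)}\,d\xi\Big)dx.$$ The same holds with $\mathcal E_{0,s}^E$ and $\Sigma_t^s$ in place of $\mathcal E_s^E$ and $\mathcal S_t^s$.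
   Context: Gelfand–Shilov spaces: for $s,t>0$, $\mathcal S_t^s(\mathbf R^d)$ is the set of $f\in C^\infty(\mathbf R^d)$ with $\sup_{\alpha,\beta,x}\frac{|x^\beta\partial^\alpha f(x)|}{h^{|\alpha+\beta|}\alpha!^s\beta!^t}<\infty$ for some $h>0$; $\Sigma_t^s(\mathbf R^d)$ requires this for every $h>0$; duals $(\mathcal S_t^s)'$, $(\Sigma_t^s)'$ with bilinear pairing $\langle\cdot,\cdot\rangle$. Fourier transform $\widehat f(\xi)=(2\pi)^{-d/2}\int f(x)e^{-i\langle x,\xi\rangle}dx$; short-time Fourier transform $V_\phi f(x,\xi)=\mathscr F(f\,\overline{\phi(\cdot-x)})(\xi)$. $E=\{\sum x_ke_k:0\le x_k\le1\}$ for a basis $e_1,\dots,e_d$; $\Lambda_E=\sum\mathbf Z e_k$; dual basis $\langle e_j,e'_k\rangle=2\pi\delta_{jk}$, $\Lambda'_E=\sum\mathbf Z e'_k$; $|E|$ is the volume of $E$; $E$-periodic means invariant under translations by $\Lambda_E$. Gevrey classes: for $s\ge0$, $\mathcal E_s(\mathbf R^d)$ (resp. $\mathcal E_{0,s}(\mathbf R^d)$) consists of $f\in C^\infty$ such that for every compact $K$, $\sup_\alpha\|\partial^\alpha f\|_{L^\infty(K)}/(h^{|\alpha|}\alpha!^s)<\infty$ for some (resp. every) $h>0$; $\mathcal E_s^E$, $\mathcal E_{0,s}^E$ are their $E$-periodic elements, and $(\mathcal E_s^E)'$, $(\mathcal E_{0,s}^E)'$ their duals. For smooth $E$-periodic $\psi$,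 $c(\psi,\alpha)=|E|^{-1}\int_E\psi(x)e^{-i\langle x,\alpha\rangle}dx$. An element $f$ of $(\mathcal E_s^E)'$ (resp. $(\mathcal E_{0,s}^E)'$) is identified with a formal series $\sum_{\alpha\in\Lambda'_E}c(f,\alpha)e^{i\langle\cdot,\alpha\rangle}$ where $|c(f,\alpha)|\lesssim e^{\varepsilon|\alpha|^{1/s}}$ for every (resp. some) $\varepsilon>0$, acting on $\psi$ by $(f,\psi)_E=\sum_{\alpha\in\Lambda'_E}c(f,\alpha)\overline{c(\psi,\alpha)}$; it is regarded as an element of $(\mathcal S_t^s)'$ (resp. $(\Sigma_t^s)'$) via $\langle f,\phi\rangle=(2\pi)^{d/2}\sum_\alpha c(f,\alpha)\widehat\phi(-\alpha)$, so that $V_\phi f$ is defined. *)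

(* Defs.v *)
From HB Require Import structures.
From mathcomp Require Import all_boot all_order all_algebra.
From mathcomp Require Import all_classical all_reals all_analysis.
From mathcomp Require Import complex.

Set Implicit Arguments.
Unset Strict Implicit.
Unset Printing Implicit Defensive.

Import Order.TTheory GRing.Theory Num.Theory.
Import numFieldNormedType.Exports.
Local Open Scope classical_set_scope.
Local Open Scope ring_scope.
Local Open Scope complex_scope.

Section Lebesgue.
Variables (R : realType) (n : nat).
Local Notation vec := 'rV[R]_n.

Definition dotp (x y : vec) : R := \sum_(i < n) x 0 i * y 0 i.
Definition enorm (x : vec) : R := Num.sqrt (dotp x x).

Definition box (a b : vec) : set vec := [set x | forall i, a 0 i <= x 0 i <= b 0 i].
Definition boxvol (a b : vec) : R := \prod_(i < n) Num.max (b 0 i - a 0 i) 0.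
Definition boxes : set (set vec) := [set A | exists a b, A = box a b].

Definition Rn := g_sigma_algebraType boxes.

Definition leb (A : set Rn) : \bar R :=
  ereal_inf [set v | exists a b : nat -> vec,
    A `<=` \bigcup_k box (a k) (b k) /\
    v = (\sum_(k <oo) (boxvol (a k) (b k))%:E)%E].

Definition cintegrable (D : set Rn) (f : vec -> R[i]) : Prop :=
  leb.-integrable D (fun x => (complex.Re (f x))%:E) /\
  leb.-integrable D (fun x => (complex.Im (f x))%:E).

(* real integral (as MathComp-Analysis' Rintegral, for the set function leb) *)
Definition rint (D : set Rn) (f : vec -> R) : R :=
  fine (\int[leb]_(x in D) (f x)%:E)%E.

Definition cint (D : set Rn) (f : vec -> R[i]) : R[i] :=
  Complex (rint D (fun x => complex.Re (f x)))
          (rint D (fun x => complex.Im (f x))).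

End Lebesgue.

Section Analysis.
Variables (R : realType) (d : nat).
Local Notation vec := 'rV[R]_d.

Definition cnorm (z : R[i]) : R :=
  Num.sqrt (complex.Re z ^+ 2 + complex.Im z ^+ 2).

Definition expi (t : R) : R[i] := Complex (cos t) (sin t).

Definition FT (g : vec -> R[i]) (xi : vec) : R[i] :=
  ((2 * pi) `^ (- (d%:R / 2)))%:C *
  cint setT (fun y => g y * expi (- dotp y xi)).

Definition stft (phi g : vec -> R[i]) (x xi : vec) : R[i] :=
  FT (fun y => g y * conjc (phi (y - x))) xi.

Definition L2norm2 (phi : vec -> R[i]) : R :=
  @rint R d setT (fun x => cnorm (phi x) ^+ 2).

Definition ei (i : 'I_d) : vec := delta_mx 0 i.
Definition pd (s : seq 'I_d) (g : vec -> R) : vec -> R :=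
  foldr (fun i h => fun x => 'D_(ei i) h x) g s.
Definition mseq (alpha : 'I_d -> nat) : seq 'I_d :=
  flatten [seq nseq (alpha i) i | i <- enum 'I_d].
Definition mabs (alpha : 'I_d -> nat) : nat := (\sum_(i < d) alpha i)%N.
Definition mfact (alpha : 'I_d -> nat) : nat := (\prod_(i < d) (alpha i)`!)%N.
Definition mpow (x : vec) (beta : 'I_d -> nat) : R := \prod_(i < d) x 0 i ^+ beta i.

Definition smoothR (g : vec -> R) : Prop :=
  forall s : seq 'I_d, continuous (pd s g) /\
    forall (i : 'I_d) (x : vec), derivable (pd s g) x (ei i).
Definition smooth (g : vec -> R[i]) : Prop :=
  smoothR (fun x => complex.Re (g x)) /\ smoothR (fun x => complex.Im (g x)).
Definition cpd (alpha : 'I_d -> nat) (g : vec -> R[i]) (x : vec) : R[i] :=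
  Complex (pd (mseq alpha) (fun y => complex.Re (g y)) x)
          (pd (mseq alpha) (fun y => complex.Im (g y)) x).

Definition GS_bound (s t h C : R) (phi : vec -> R[i]) : Prop :=
  forall (alpha beta : 'I_d -> nat) (x : vec),
    cnorm ((mpow x beta)%:C * cpd alpha phi x) <=
    C * h ^+ (mabs alpha + mabs beta) *
    ((mfact alpha)%:R `^ s) * ((mfact beta)%:R `^ t).
Definition GS_S (s t : R) (phi : vec -> R[i]) : Prop :=
  smooth phi /\ exists h, 0 < h /\ exists C, GS_bound s t h C phi.
Definition GS_Sigma (s t : R) (phi : vec -> R[i]) : Prop :=
  smooth phi /\ forall h, 0 < h -> exists C, GS_bound s t h C phi.

Definition Gev_bound (s h C : R) (K : set vec) (g : vec -> R[i]) : Prop :=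
  forall (alpha : 'I_d -> nat) (x : vec), K x ->
    cnorm (cpd alpha g x) <= C * h ^+ mabs alpha * ((mfact alpha)%:R `^ s).
Definition Gev (s : R) (g : vec -> R[i]) : Prop :=
  smooth g /\ forall K : set vec, compact K ->
    exists h, 0 < h /\ exists C, Gev_bound s h C K g.
Definition Gev0 (s : R) (g : vec -> R[i]) : Prop :=
  smooth g /\ forall K : set vec, compact K ->
    forall h, 0 < h -> exists C, Gev_bound s h C K g.

Definition intvecs : set vec := [set map_mx (fun z : int => z%:~R) k | k in [set: 'rV[int]_d]].
Definition lattice (B : 'M[R]_d) : set vec := [set k *m B | k in intvecs].
(* dual basis: rows e'_k with <e_j, e'_k> = 2 pi delta_jk *)
Definition dualbasis (B : 'M[R]_d) : 'M[R]_d := (2 * pi) *: (invmx B)^T.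
Definition para (B : 'M[R]_d) : set vec :=
  [set t *m B | t in [set t : vec | forall i, 0 <= t 0 i <= 1]].
Definition paravol (B : 'M[R]_d) : R := `|\det B|.
Definition periodic (B : 'M[R]_d) (g : vec -> R[i]) : Prop :=
  forall x l, lattice B l -> g (x + l) = g x.

Definition Es (s : R) (B : 'M[R]_d) (g : vec -> R[i]) := Gev s g /\ periodic B g.
Definition E0s (s : R) (B : 'M[R]_d) (g : vec -> R[i]) := Gev0 s g /\ periodic B g.

Definition fcoef (B : 'M[R]_d) (psi : vec -> R[i]) (alpha : vec) : R[i] :=
  ((paravol B)^-1)%:C * cint (para B) (fun x => psi x * expi (- dotp x alpha)).

(* Duals, as formal Fourier series given by coefficient functions on Lambda'_E *)
Definition dual_Es (s : R) (B : 'M[R]_d) (c : vec -> R[i]) : Prop :=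
  forall eps, 0 < eps -> exists C, forall a, lattice (dualbasis B) a ->
    cnorm (c a) <= C * expR (eps * (enorm a `^ s^-1)).
Definition dual_E0s (s : R) (B : 'M[R]_d) (c : vec -> R[i]) : Prop :=
  exists eps, 0 < eps /\ exists C, forall a, lattice (dualbasis B) a ->
    cnorm (c a) <= C * expR (eps * (enorm a `^ s^-1)).

Definition rsum (S : set vec) (u : vec -> R) : R :=
  fine (esum S (fun a => (Num.max (u a) 0)%:E)) -
  fine (esum S (fun a => (Num.max (- u a) 0)%:E)).
Definition csum (S : set vec) (u : vec -> R[i]) : R[i] :=
  Complex (rsum S (fun a => complex.Re (u a))) (rsum S (fun a => complex.Im (u a))).

Definition pairE (B : 'M[R]_d) (c : vec -> R[i]) (psi : vec -> R[i]) : R[i] :=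
  csum (lattice (dualbasis B)) (fun a => c a * conjc (fcoef B psi a)).

Definition gpair (B : 'M[R]_d) (c : vec -> R[i]) (phi : vec -> R[i]) : R[i] :=
  ((2 * pi) `^ (d%:R / 2))%:C *
  csum (lattice (dualbasis B)) (fun a => c a * FT phi (- a)).

(* V_phi f (x, xi) = F(f conj(phi(. - x)))(xi)
                   = (2 pi)^{-d/2} < f, conj(phi(. - x)) e^{-i<., xi>} > *)
Definition stft_dist (B : 'M[R]_d) (c : vec -> R[i]) (phi : vec -> R[i])
    (x xi : vec) : R[i] :=
  ((2 * pi) `^ (- (d%:R / 2)))%:C *
  gpair B c (fun y => conjc (phi (y - x)) * expi (- dotp y xi)).

End Analysis.

Definition moyal_conclusion (R : realType) (d : nat) (B : 'M[R]_d)
    (c psi phi : 'rV[R]_d -> R[i]) : Prop :=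
  let F := fun x xi => stft_dist B c phi x xi * conjc (stft phi psi x xi) in
  cintegrable [set z : 'rV[R]_(d + d) | para B (lsubmx z)]
              (fun z => F (lsubmx z) (rsubmx z)) /\
  pairE B c psi =
    ((L2norm2 phi * paravol B)^-1)%:C *
    cint (para B) (fun x => cint setT (fun xi => F x xi)).

(* Main.v *)
(* The derivative bounds make [V_phi psi(x, .)] and the Fourier transform of
    [conj phi] decay like [exp(- r |xi|^(1/s))] with the same rate [r], uniformly
    in [x]; [V_phi f] is the series of the terms
    [c(f, a) exp(- i <x, xi - a>) FT(conj phi)(xi - a)] over the dual lattice.
    The growth of [c(f, a)] being slower than these rates, everything is
    dominated by the product of an integrable function of [xi] and a summable
    one of [a], so Fubini allows to integrate term by term. Integrating first
    in [x] over the period cell, the [a]-th term of [V_phi psi] splits off its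
    Fourier coefficient: unfolding [V_phi psi] and using periodicity,
    [int_E exp(i <x, xi - a>) V_phi psi(x, xi) dx = |E| c(psi, a) FT(conj phi)(xi - a)].
    The remaining integral in [xi] is [|FT(conj phi)|^2], which Plancherel
    evaluates to the squared norm of [phi]. All dominations use the product
    kernel [pois y = prod_i 2 / (1 + y_i^2)], whose Fourier transform is explicit
    and serves as the approximate identity for Fourier inversion. *)
Require Import Defs.
From HB Require Import structures.
From mathcomp Require Import all_boot all_order all_algebra.
From mathcomp Require Import all_classical all_reals all_analysis.
From mathcomp Require Import complex.
From mathcomp Require Import measurable_realfun.
From mathcomp Require Import ring lra.
Set Implicit Arguments.
Unset Strict Implicit.
Unset Printing Implicit Defensive.
Import Order.TTheory GRing.Theory Num.Theory.
Import numFieldNormedType.Exports.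
Local Open Scope classical_set_scope.
Local Open Scope ring_scope.
Local Open Scope complex_scope.
Local Notation re := (@complex.Re _).
Local Notation im := (@complex.Im _).

(** * Lebesgue measure on row vectors *)

Section BorelRn.
Variables (R : realType) (n : nat).
Local Notation vec := 'rV[R]_n.
Local Notation rn := (Rn R n).

(** The two cases of the theorem differ only in quantifiers. Both reduce to one inequality,
    [eps * (2 N)^(1/s) <= r / 4], between the growth exponent [eps] of the coefficients and the rate
    [r] that the derivative constants provide. If the derivative bounds hold for some [h], then [r]
    is given and [eps] is taken small; if they hold for every [h], then [eps] is given and [h] is
    chosen to make [r] large. Decay in [xi] is measured by the sup norm and obtained from repeated
    derivatives in a single coordinate direction, the one in which [xi] is largest; no multi-index
    Leibniz formula occurs. [leb] is an infimum over covers by boxes, so it must first be shown to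
    be a measure on the sigma-algebra of boxes. Its substitution rules come from uniqueness on boxes
    and cover translations, reflections, dilations and products. A linear substitution by [B] is
    avoided: [paravol B] enters only through the normalisation of the Fourier coefficients, where it
    cancels, and all that is used about the measure of the cell is that it is finite and
    positive. *)

Lemma setI_boxes : setI_closed (@boxes R n).
Proof.
move=> _ _ [a [b ->]] [a' [b' ->]].
exists (\row_i Num.max (a 0 i) (a' 0 i)), (\row_i Num.min (b 0 i) (b' 0 i)).
apply/seteqP; split => [x [h h'] i|x h].
  by rewrite !mxE ge_max le_min; case/andP: (h i) => -> ->; case/andP: (h' i) => -> ->.
by split => i; have := h i; rewrite !mxE ge_max le_min => /andP[/andP[? ?] /andP[? ?]]; apply/andP.
Qed.

Definition bigbox (k : nat) : set vec := box (const_mx (- k%:R)) (const_mx k%:R).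

Lemma nat_gt_coords (x : vec) : exists k : nat, forall i : 'I_n, `|x 0 i| <= k%:R.
Proof.
exists (\sum_(i < n) (Num.truncn `|x 0%R i|).+1)%N => i.
apply: (@le_trans _ _ (Num.truncn `|x 0 i|).+1%:R).
  by rewrite ltW// truncnS_gt.
by rewrite ler_nat (bigD1 i)//= leq_addr.
Qed.

Lemma bigcup_bigbox : \bigcup_k bigbox k = setT.
Proof.
apply/seteqP; split => // x _; have [k hk] := nat_gt_coords x.
by exists k => // i; rewrite !mxE -ler_norml.
Qed.

Lemma measurable_box (a b : vec) : measurable (box a b : set rn).
Proof. by apply: sub_sigma_algebra; exists a, b. Qed.

Lemma measurable_halfspace (i : 'I_n) (c : R) :
  measurable ([set x | x 0 i <= c] : set rn).
Proof.
(* The half-space is a union of boxes bounded by [k] in modulus, except that the upper end in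
   direction [i] is [c]. *)
rewrite [X in measurable X](_ : _ = \bigcup_k box (const_mx (- k%:R))
    (\row_j if j == i then c else k%:R)).
  by apply: bigcup_measurable => k _; exact: measurable_box.
apply/seteqP; split => [x /= xc|x [k _ /(_ i)]]; last by rewrite !mxE eqxx => /andP[].
have [k hk] := nat_gt_coords x; exists k => // j; rewrite !mxE.
by have := hk j; rewrite ler_norml => /andP[-> h]; case: eqVneq => // ->.
Qed.

Lemma measurable_coord (i : 'I_n) : measurable_fun setT (fun x : rn => x 0 i).
Proof.
apply: (measurability _ (measurable_realfun.RGenOInfty.measurableE R)) => _ [_ [c ->] <-].
rewrite setTI (_ : _ @^-1` _ = ~` [set x : rn | x 0 i <= c]).
  by apply: measurableC; exact: measurable_halfspace.
apply/seteqP; split => x /=; rewrite in_itv/= andbT.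
  by rewrite ltNge => /negP.
by move=> /negP; rewrite -ltNge.
Qed.

Lemma measurable_vec d (T : measurableType d) (f : T -> rn) :
  (forall i, measurable_fun setT (fun x => f x 0 i)) -> measurable_fun setT f.
Proof.
move=> mf; apply: (@measurability _ _ T rn setT f (@boxes R n)) => // _ [_ [a [b ->]] <-].
rewrite setTI (_ : _ @^-1` _ =
  \bigcap_(i in [set: 'I_n]) ((fun x => f x 0 i) @^-1` `[a 0 i, b 0 i])).
  apply: fin_bigcap_measurable => // i _.
  by rewrite -[X in measurable X]setTI; exact: mf.
apply/seteqP; split => x /= h.
  by move=> i _ /=; rewrite in_itv/=; exact: h.
by move=> i; have := h i I; rewrite /= in_itv.
Qed.

End BorelRn.

(** * A reference measure with the correct volume on boxes *)

Section BoxMeasure.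
Variable R : realType.

Lemma boxvol_ge0 n (a b : 'rV[R]_n) : 0 <= boxvol a b.
Proof. by apply: prodr_ge0 => i _; rewrite le_max lexx orbT. Qed.

Definition row_cons n (z : (R * Rn R n)%type) : Rn R n.+1 :=
  \row_i if unlift ord0 i is Some j then z.2 0 j else z.1.

Lemma measurable_row_cons n : measurable_fun setT (@row_cons n).
Proof.
apply: measurable_vec => i; under eq_fun do rewrite mxE.
case: unliftP => [j _|_]; last exact: measurable_fst.
exact: (measurableT_comp (@measurable_coord R n j) measurable_snd).
Qed.

Lemma preimage_row_cons_box n (a b : 'rV[R]_n.+1) :
  @row_cons n @^-1` box a b = `[a 0 ord0, b 0 ord0]%classic `*`
  box (\row_i a 0 (lift ord0 i)) (\row_i b 0 (lift ord0 i)).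
Proof.
apply/seteqP; split => [[x y] h|[x y] [/= hx hy] i].
  split => [|i] /=; last by have := h (lift ord0 i); rewrite !mxE liftK.
  by have := h ord0; rewrite !mxE unlift_none in_itv.
case: (unliftP ord0 i) => [j ->|->]; last by rewrite !mxE unlift_none; rewrite in_itv in hx.
by rewrite !mxE liftK; have := hy j; rewrite !mxE.
Qed.

Lemma box_measure_sigma_finite n (mu : {measure set (Rn R n) -> \bar R}) :
  (forall a b, mu (box a b) = (boxvol a b)%:E) -> sigma_finite setT mu.
Proof.
move=> mub; exists (fun k => @bigbox R n k); first by rewrite bigcup_bigbox.
by move=> k; split; [exact: measurable_box|rewrite mub ltry].
Qed.

(** The measure built by induction is known only through an existential; a product with it requires
    the sigma-finite structure to be attached to it. *)
Lemma sigma_finite_measureE d (T : measurableType d) (mu : {measure set T -> \bar R}) :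
  sigma_finite setT mu ->
  exists nu : {sigma_finite_measure set T -> \bar R}, nu = mu :> (set T -> \bar R).
Proof.
move=> sf; pose H1 := isSFinite.Build _ _ _ _ (sfinite_measure_sigma_finite sf).
pose H2 := isSigmaFinite.Build _ _ _ _ sf.
by exists (HB.pack_for (SigmaFiniteMeasure.type T R) (Measure.sort mu) H1 H2).
Qed.

(** Provides the lower bound in [leb_box], since the definition by covers directly gives upper
    bounds only. Each new coordinate is a product with Lebesgue measure on the line; in dimension 0
    the only box is the whole point, and its volume is the empty product 1. *)
Lemma exists_box_measure n : exists mu : {measure set (Rn R n) -> \bar R},
  forall a b, mu (box a b) = (boxvol a b)%:E.
Proof.
elim: n => [|n [mu mub]].
  exists (dirac (0 : Rn R 0)) => a b.
  by rewrite /= /dirac indicE /boxvol big_ord0 mem_set// => -[].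
have [mu' mu'E] := sigma_finite_measureE (box_measure_sigma_finite mub).
rewrite -mu'E in mub.
pose m := pushforward (lebesgue_measure \x mu')%E (@row_cons n).
pose m' : {measure set (Rn R n.+1) -> \bar R} := m.
exists (m' (@measurable_row_cons n)) => a b.
rewrite /m' /m /= /pushforward preimage_row_cons_box.
rewrite product_measure1E//; last exact: measurable_box.
rewrite [X in (X * _)%E](_ : _ = lebesgue_measure `[a 0 ord0, b 0 ord0]%classic)//.
rewrite lebesgue_measure_itv/= mub lte_fin /boxvol big_ord_recl/=.
case: ltP => ab; rewrite -?EFinB -EFinM; congr (_ * _)%:E.
- by rewrite (max_idPl _)// subr_ge0 ltW.
- by apply: eq_bigr => i _; rewrite !mxE.
- by rewrite (max_idPr _)// subr_le0.
- by apply: eq_bigr => i _; rewrite !mxE.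
Qed.
End BoxMeasure.

(** * From box covers to a measure *)

Section LebOuter.
Variables (R : realType) (n' : nat).
Local Notation n := n'.+1.
Local Notation vec := 'rV[R]_n.
Local Notation leb := (@leb R n).
Local Open Scope ereal_scope.

Lemma leb_le_cover (A : set (Rn R n)) (a b : nat -> vec) :
  A `<=` \bigcup_k box (a k) (b k) -> leb A <= \sum_(k <oo) (boxvol (a k) (b k))%:E.
Proof. by move=> Aab; apply: ereal_inf_lbound; exists a, b. Qed.

Lemma leb_ge0 A : 0 <= leb A.
Proof.
apply: le_ereal_inf_tmp => _ [a [b [_ ->]]].
by apply: nneseries_ge0 => k _ _; rewrite lee_fin boxvol_ge0.
Qed.

Lemma boxvol0 (x y : vec) : (exists i, (y 0 i <= x 0 i)%R) -> boxvol x y = 0%R.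
Proof.
by move=> [i yx]; rewrite /boxvol (bigD1 i)//= (max_idPr _) ?mul0r// subr_le0.
Qed.

Lemma leb_le_box A (a b : vec) : A `<=` box a b -> leb A <= (boxvol a b)%:E.
Proof.
(* One box is padded by copies of the degenerate box at 0. These have volume 0 only in positive
   dimension; in dimension 0 every box has volume 1 and the covering series diverges. *)
move=> Aab; pose z (x : vec) (k : nat) : vec := if k == 0%N then x else 0%R.
have zab : A `<=` \bigcup_k box (z a k) (z b k) by move=> x /Aab h; exists 0%N.
apply: (le_trans (leb_le_cover zab)).
rewrite (nneseries_split 0 1) => [|k _]; last by rewrite lee_fin boxvol_ge0.
rewrite big_nat1 eseries0 ?adde0// => -[|k]//= _ _.
by rewrite /z/= boxvol0//; exists ord0.
Qed.

Lemma leb0 : leb set0 = 0.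
Proof.
apply/eqP; rewrite eq_le leb_ge0 andbT.
by rewrite (le_trans (@leb_le_box _ 0%R 0%R _))// boxvol0//; exists ord0.
Qed.

Lemma le_leb : {homo leb : A B / A `<=` B >-> A <= B}.
Proof.
move=> A B AB; apply: ereal_inf_le_tmp => _ [a [b [Bab ->]]].
by exists a, b; split => //; exact: subset_trans Bab.
Qed.

Lemma leb_cover (A : set (Rn R n)) (e : R) : (0 < e)%R -> leb A < +oo ->
  exists ab : nat -> vec * vec, A `<=` \bigcup_k box (ab k).1 (ab k).2 /\
  \sum_(k <oo) (boxvol (ab k).1 (ab k).2)%:E <= leb A + e%:E.
Proof.
move=> e0 Aoo.
have Afin : leb A \is a fin_num by rewrite ge0_fin_numE// leb_ge0.
have [_ [a [b [Aab ->]]] /ltW h] := lb_ereal_inf_adherent e0 Afin.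
by exists (fun k => (a k, b k)).
Qed.

Lemma leb_sigma_subadditive : sigma_subadditive leb.
Proof.
move=> F; have [[i Foo]|/forallNP Foo] := pselect (exists i, leb (F i) = +oo).
  by rewrite (eseries_pinfty _ _ Foo) ?leey// => k _; rewrite -ltNye (lt_le_trans _ (leb_ge0 _)).
apply/lee_addgt0Pr => e e0.
apply: le_trans (epsilon_trick xpredT _ (ltW e0)); last by move=> k; exact: leb_ge0.
have en k : (0 < e / (2 ^ k.+1)%:R)%R by rewrite divr_gt0// ltr0n expn_gt0.
have Fk k : leb (F k) < +oo by rewrite ltey; exact/eqP.
have [ab abP] := choice (fun k => leb_cover (en k) (Fk k)).
(* Each [F k] has a cover exceeding its outer measure by at most e/2^(k+1). A bijection between
   naturals and pairs merges these covers into one sequence. *)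
have /card_esym/ppcard_eqP[f] := card_nat2.
pose v (p : nat * nat) := (boxvol (ab p.1 p.2).1 (ab p.1 p.2).2)%:E.
have v0 p : 0 <= v p by rewrite lee_fin boxvol_ge0.
apply: (@le_trans _ _ (\sum_(k <oo) v (f k))).
  apply: leb_le_cover (fun k => (ab (f k).1 (f k).2).1) (fun k => (ab (f k).1 (f k).2).2) _.
  move=> x [i _ Fx]; have [j _ xj] := (abP i).1 _ Fx.
  by exists (f^-1%FUN (i, j)) => //=; rewrite invK ?inE.
rewrite nneseries_esumT; last by move=> ?; exact: v0.
rewrite -(reindex_esum [set: nat] [set: nat * nat] f v)//.
rewrite (_ : [set: nat * nat] = [set: nat] `*`` fun=> [set: nat]); last first.
  by apply/seteqP; split.
rewrite -(@esum_esum _ _ _ setT (fun=> setT) (fun i j => v (i, j)))//.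
rewrite -nneseries_esumT; last by move=> i; apply: esum_ge0.
apply: lee_nneseries => [i _ _|i _]; first exact: esum_ge0.
by rewrite -nneseries_esumT//; exact: (abP i).2.
Qed.

HB.instance Definition _ := isOuterMeasure.Build R (Rn R n) leb
  leb0 leb_ge0 le_leb leb_sigma_subadditive.

(** The [min] and [max] keep the identity true when the hyperplane [x_i = c] misses the box: one of
    the two pieces then has volume 0. *)
Lemma boxvol_cut (a b : vec) (i : 'I_n) (c : R) :
  let b' := (\row_j if j == i then Num.min (b 0 i) c else b 0 j)%R in
  let a' := (\row_j if j == i then Num.max (a 0 i) c else a 0 j)%R in
  (boxvol a b' + boxvol a' b = boxvol a b)%R.
Proof.
move=> b' a'; pose P : R := (\prod_(j | j != i) Num.max (b 0 j - a 0 j) 0)%R.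
have E (x y : vec) : (forall j, j != i -> (x 0 j = a 0 j)%R /\ (y 0 j = b 0 j)%R) ->
    (boxvol x y = Num.max (y 0 i - x 0 i) 0 * P)%R.
  move=> xy; rewrite /boxvol (bigD1 i)//=; congr (_ * _)%R.
  by apply: eq_bigr => j /xy[-> ->].
rewrite !E => [|j ji|j ji|j ji]; rewrite ?mxE ?(negbTE ji) ?eqxx//.
rewrite -mulrDl; congr (_ * _)%R.
rewrite /Num.max /Num.min; do !case: ifP; lra.
Qed.

(** Cutting each box of a cover of [X] along the hyperplane yields covers of the two parts of [X] at
    the same total cost. *)
Lemma caratheodory_halfspace (i : 'I_n) (c : R) :
  leb.-caratheodory ([set x | x 0 i <= c]%R : set (Rn R n)).
Proof.
apply: le_caratheodory_measurable => X.
apply: le_ereal_inf_tmp => _ [a [b [Xab ->]]].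
pose b' k := (\row_j if j == i then Num.min (b k 0 i) c else b k 0 j)%R : vec.
pose a' k := (\row_j if j == i then Num.max (a k 0 i) c else a k 0 j)%R : vec.
under eq_eseriesr => k _ do rewrite -(boxvol_cut (a k) (b k) i c) EFinD.
rewrite nneseriesD; [|by move=> k _; rewrite lee_fin boxvol_ge0..].
apply: leeD; apply: leb_le_cover.
  move=> x [/Xab[k _ xk] /= xc]; exists k => // j; rewrite !mxE.
  case: eqVneq => [->|_]; last exact: xk.
  by rewrite le_min xc; have /andP[-> ->] := xk i.
move=> x [/Xab[k _ xk] /= /negP]; rewrite -ltNge => xc; exists k => // j; rewrite !mxE.
case: eqVneq => [->|_]; last exact: xk.
by rewrite ge_max (ltW xc); have /andP[-> ->] := xk i.
Qed.

Lemma caratheodory_reflected_halfspace (i : 'I_n) (c : R) :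
  leb.-caratheodory ([set x | c <= x 0 i]%R : set (Rn R n)).
Proof.
rewrite [X in caratheodory_measurable _ X](_ : _ =
  ~` \bigcup_k [set x : Rn R n | x 0 i <= c - k.+1%:R^-1]%R).
  apply: caratheodory_measurable_setC; apply: caratheodory_measurable_bigcup => k.
  exact: caratheodory_halfspace.
apply/seteqP; split => x /= cx.
  by move=> [k _ /= /(le_trans cx)]; rewrite leNgt gtrBl invr_gt0 ltr0n.
rewrite leNgt; apply/negP => xc; apply: cx.
have /ltr_add_invr[k hk] : (x 0 i < c)%R := xc.
by exists k => //=; rewrite lerBrDr ltW.
Qed.

Lemma caratheodory_borel (A : set (Rn R n)) : measurable A -> leb.-caratheodory A.
Proof.
apply: smallest_sub.
  split; first exact: caratheodory_measurable_set0.
    by move=> B mB; rewrite setTD; exact: caratheodory_measurable_setC.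
  by move=> F mF; exact: caratheodory_measurable_bigcup.
move=> _ [a [b ->]].
rewrite (_ : box a b = \big[setI/setT]_(i < n)
  ([set x : Rn R n | a 0 i <= x 0 i]%R `&` [set x : Rn R n | x 0 i <= b 0 i]%R)).
  apply: (@big_ind _ (fun B : set (Rn R n) => leb.-caratheodory B)).
  - by rewrite -setC0; apply: caratheodory_measurable_setC; exact: caratheodory_measurable_set0.
  - by move=> B C; exact: caratheodory_measurable_setI.
  - move=> i _; apply: caratheodory_measurable_setI.
      exact: caratheodory_reflected_halfspace.
    exact: caratheodory_halfspace.
apply/seteqP; split => x.
  move=> h; elim/big_ind : _ => // i _; split; by have /andP[] := h i.
move=> h i; move: h; rewrite (bigD1 i)//= => -[[ai bi] _].
by apply/andP.
Qed.

Lemma leb_sigma_additive : semi_sigma_additive (leb : set (Rn R n) -> \bar R).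
Proof.
move=> F mF tF mUF; have mF' k := caratheodory_borel (mF k).
apply: (@caratheodory_measure_sigma_additive R (Rn R n) leb F) => //.
exact: caratheodory_borel.
Qed.

HB.instance Definition _ := isMeasure.Build _ (Rn R n) R leb leb0 leb_ge0 leb_sigma_additive.

Lemma leb_box (a b : vec) : leb (box a b) = (boxvol a b)%:E.
Proof.
apply/eqP; rewrite eq_le leb_le_box//=.
(* A genuine measure with the same volumes is countably subadditive, so no cover of the box can cost
   less than its volume. *)
have [mu mub] := exists_box_measure R n; rewrite -mub.
apply: le_ereal_inf_tmp => _ [a' [b' [Xab ->]]].
under eq_eseriesr do rewrite -mub.
apply: le_trans (generalized_Boole_inequality _ _ _); last 2 first.
- by move=> k; exact: measurable_box.
- by apply: bigcup_measurable => k _; exact: measurable_box.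
apply: le_measure => //; rewrite inE; first exact: measurable_box.
by apply: bigcup_measurable => k _; exact: measurable_box.
Qed.

HB.instance Definition _ := Measure_isSigmaFinite.Build _ (Rn R n) R leb
  (box_measure_sigma_finite leb_box).

Lemma leb_unique (m : {measure set (Rn R n) -> \bar R}) :
  (forall a b, m (box a b) = (boxvol a b)%:E) ->
  forall A, measurable A -> leb A = m A.
Proof.
move=> mb; apply: (@measure_unique _ R (Rn R n) (@boxes R n) (@bigbox R n)) => //.
- exact: setI_boxes.
- by move=> k; exists (const_mx (- k%:R)%R), (const_mx k%:R%R).
- exact: bigcup_bigbox.
- by move=> _ [a [b ->]]; rewrite mb; exact: leb_box.
- by move=> k; apply: (le_lt_trans (leb_le_box _)); first exact: subset_refl; rewrite ltry.
Qed.

(** The source of all substitution rules: by uniqueness it is enough to compute the measure of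
    preimages of boxes. Positive and negative parts are transported separately, so [g] need not be
    integrable, and integrability itself can be transported later. *)
Lemma integral_leb_comp d (T : measurableType d) (mu : {measure set T -> \bar R})
    (f : T -> Rn R n) : measurable_fun setT f ->
  (forall a b, mu (f @^-1` box a b) = (boxvol a b)%:E) ->
  forall g : Rn R n -> \bar R, measurable_fun setT g ->
  \int[leb]_x g x = \int[mu]_t g (f t).
Proof.
move=> mf muf.
have ge0 (g : Rn R n -> \bar R) : measurable_fun setT g -> (forall x, 0 <= g x) ->
    \int[leb]_x g x = \int[mu]_t g (f t).
  move=> mg g0; rewrite -[RHS](@ge0_integral_pushforward _ _ _ _ _ f mf mu setT g)//.
  apply: eq_measure_integral => A mA _.
  exact: (@leb_unique (pushforward mu f)).
move=> g mg; rewrite [LHS]integralE [RHS]integralE.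
rewrite (ge0 _ (measurable_funepos mg)); last by move=> x; exact: funepos_ge0.
rewrite (ge0 _ (measurable_funeneg mg))//.
by rewrite -[RHS]/(\int[mu]_x (g \o f)^\+ x - \int[mu]_x (g \o f)^\- x)
  (funepos_comp g f) (funeneg_comp g f).
Qed.

End LebOuter.

(** * Translations, reflections, dilations and products *)

Section LebInvariance.
Variables (R : realType).
Local Open Scope ereal_scope.

Lemma measurable_vecD n (c : 'rV[R]_n) :
  measurable_fun [set: Rn R n] (fun x : Rn R n => (x + c)%R : Rn R n).
Proof.
apply: measurable_vec => i; under eq_fun do rewrite mxE.
by apply: measurable_funD => //; exact: measurable_coord.
Qed.

Lemma integral_leb_shift n (c : 'rV[R]_n.+1) (g : Rn R n.+1 -> \bar R) :
  measurable_fun setT g -> \int[leb (n:=n.+1)]_x g x = \int[leb (n:=n.+1)]_x g (x + c)%R.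
Proof.
move=> mg.
apply: (@integral_leb_comp R n _ _ (@leb R n.+1) (fun x => x + c)%R _ _ g mg); first exact: measurable_vecD.
move=> a b; rewrite (_ : _ @^-1` _ = box (a - c)%R (b - c)%R); last first.
  by apply/seteqP; split => x h i; have := h i; rewrite !mxE lerBlDr lerBrDr.
rewrite [LHS]leb_box; congr _%:E; apply: eq_bigr => i _; rewrite !mxE.
by congr Num.max; ring.
Qed.

Lemma measurable_vecN n :
  measurable_fun [set: Rn R n] (fun x : Rn R n => (- x)%R : Rn R n).
Proof.
apply: measurable_vec => i; under eq_fun do rewrite mxE.
by apply: measurableT_comp => //; exact: measurable_coord.
Qed.

Lemma integral_leb_opp n (g : Rn R n.+1 -> \bar R) :
  measurable_fun setT g -> \int[leb (n:=n.+1)]_x g x = \int[leb (n:=n.+1)]_x g (- x)%R.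
Proof.
move=> mg.
apply: (@integral_leb_comp R n _ _ (@leb R n.+1) (fun x => - x)%R _ _ g mg); first exact: measurable_vecN.
move=> a b; rewrite (_ : _ @^-1` _ = box (- b)%R (- a)%R); last first.
  by apply/seteqP; split => x h i; have := h i; rewrite !mxE andbC lerNl lerNr.
rewrite [LHS]leb_box; congr _%:E; apply: eq_bigr => i _; rewrite !mxE.
by congr Num.max; ring.
Qed.

Lemma measurable_vecZ n (c : R) :
  measurable_fun [set: Rn R n] (fun x : Rn R n => (c *: x)%R : Rn R n).
Proof.
apply: measurable_vec => i; under eq_fun do rewrite mxE.
by apply: measurable_funM => //; exact: measurable_coord.
Qed.

Lemma integral_leb_scale n (c : R) (g : Rn R n.+1 -> \bar R) : (0 < c)%R ->
  measurable_fun setT g -> (forall x, 0 <= g x) ->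
  \int[leb (n:=n.+1)]_x g x = (c ^+ n.+1)%:E * \int[leb (n:=n.+1)]_x g (c *: x)%R.
Proof.
move=> c0 mg g0.
have cn : (0 <= c ^+ n.+1)%R by rewrite exprn_ge0// ltW.
pose k : {nonneg R} := NngNum cn.
(* The preimage of a box under the dilation has its volume multiplied by c^-(n+1), which the scaled
   measure compensates. *)
rewrite (@integral_leb_comp R n _ _ (mscale k (@leb R n.+1)) (fun x => c *: x)%R)//.
- rewrite ge0_integral_mscale//.
  by apply: measurableT_comp mg _; exact: measurable_vecZ.
- exact: measurable_vecZ.
move=> a b; rewrite (_ : _ @^-1` _ = box (c^-1 *: a)%R (c^-1 *: b)%R); last first.
  apply/seteqP; split => x h i; have := h i; rewrite !mxE.
    by rewrite ler_pdivrMl// ler_pdivlMl.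
  by rewrite ler_pdivrMl// ler_pdivlMl.
rewrite -[LHS]/((c ^+ n.+1)%:E * @leb R n.+1 _) leb_box -EFinM; congr _%:E.
rewrite /boxvol -[in X in (c ^+ X)%R](card_ord n.+1) -prodr_const -big_split/=.
apply: eq_bigr => i _; rewrite !mxE -mulrBr maxr_pMr ?(ltW c0)//.
rewrite mulr0 mulrA mulfV ?mul1r// gt_eqF//.
Qed.

Lemma measurable_row_mx m n : measurable_fun setT
  (fun z : (Rn R m * Rn R n)%type => row_mx z.1 z.2 : Rn R (m + n)).
Proof.
apply: measurable_vec => i; rewrite -(splitK i); case: (fintype.split i) => j /=.
  under eq_fun do rewrite row_mxEl.
  exact: (measurableT_comp (@measurable_coord R m j) measurable_fst).
under eq_fun do rewrite row_mxEr.
exact: (measurableT_comp (@measurable_coord R n j) measurable_snd).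
Qed.

Lemma leb_row_mx_box m n (a b : 'rV[R]_(m.+1 + n.+1)) :
  (@leb R m.+1 \x @leb R n.+1)
    ((fun z : (Rn R m.+1 * Rn R n.+1)%type => row_mx z.1 z.2) @^-1` box a b) =
  (boxvol a b)%:E.
Proof.
rewrite (_ : _ @^-1` _ =
  box (\row_i a ord0 (lshift n.+1 i)) (\row_i b ord0 (lshift n.+1 i)) `*`
  box (\row_i a ord0 (rshift m.+1 i)) (\row_i b ord0 (rshift m.+1 i))); last first.
  apply/seteqP; split => [[x y] h|[x y] [/= hx hy] i].
    split => i /=; rewrite !mxE; first by have := h (lshift n.+1 i); rewrite row_mxEl.
    by have := h (rshift m.+1 i); rewrite row_mxEr.
  rewrite -(splitK i); case: (fintype.split i) => j /=.
    by rewrite row_mxEl; have := hx j; rewrite !mxE.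
  by rewrite row_mxEr; have := hy j; rewrite !mxE.
rewrite product_measure1E; [|exact: measurable_box..].
rewrite [X in X * _]leb_box [X in _ * X]leb_box -EFinM; congr _%:E.
rewrite /boxvol big_split_ord/=.
by congr (_ * _)%R; apply: eq_bigr => i _; rewrite !mxE.
Qed.

Lemma integral_leb_row_mx m n (g : Rn R (m.+1 + n.+1) -> \bar R) :
  measurable_fun setT g ->
  \int[leb (n:=m.+1 + n.+1)]_x g x =
  \int[leb (n:=m.+1) \x leb (n:=n.+1)]_z g (row_mx z.1 z.2).
Proof.
move=> mg.
apply: (@integral_leb_comp R _ _ _ (@leb R m.+1 \x @leb R n.+1) (fun z => row_mx z.1 z.2) _ _ g mg).
  exact: measurable_row_mx.
move=> a b; exact: leb_row_mx_box.
Qed.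

Lemma measurable_const_mx :
  measurable_fun setT (fun t : R => const_mx t : Rn R 1).
Proof.
by apply: measurable_vec => i; under eq_fun do rewrite mxE; exact: measurable_id.
Qed.

Lemma integral_leb1 (g : Rn R 1 -> \bar R) : measurable_fun setT g ->
  \int[leb (n:=1)]_x g x = \int[lebesgue_measure]_t g (const_mx t).
Proof.
move=> mg.
apply: (@integral_leb_comp R _ _ _ lebesgue_measure (fun t : R => const_mx t : Rn R 1) _ _ g mg).
  exact: measurable_const_mx.
move=> a b; rewrite (_ : _ @^-1` _ = `[a ord0 ord0, b ord0 ord0]%classic); last first.
  apply/seteqP; split => t; first by move=> /(_ ord0); rewrite mxE /= in_itv.
  by rewrite /= in_itv/= => h i; rewrite mxE (ord1 i).
rewrite [LHS](lebesgue_measure_itv `[a ord0 ord0, b ord0 ord0])/= lte_fin /boxvol big_ord1.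
case: ltP => ab; first by rewrite (max_idPl _)// subr_ge0 ltW.
by rewrite (max_idPr _)// subr_le0.
Qed.

End LebInvariance.

(** * Complex-valued integrals *)

Section ComplexModulus.
Variable R : realType.
Implicit Types z w : R[i].

Lemma reM z w : re (z * w) = re z * re w - im z * im w.
Proof. by case: z; case: w. Qed.
Lemma imM z w : im (z * w) = re z * im w + im z * re w.
Proof. by case: z => a b; case: w => c e. Qed.
Lemma reD z w : re (z + w) = re z + re w. Proof. by case: z; case: w. Qed.
Lemma imD z w : im (z + w) = im z + im w. Proof. by case: z; case: w. Qed.
Lemma re_conj z : re (conjc z) = re z. Proof. by case: z. Qed.
Lemma im_conj z : im (conjc z) = - im z. Proof. by case: z. Qed.
Lemma complex_ext z w : re z = re w -> im z = im w -> z = w.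
Proof. by case: z; case: w => a b c e /= -> ->. Qed.

Lemma cnormE z : cnorm z = ComplexField.Normc.normc z. Proof. by case: z. Qed.

Lemma cnormM z w : cnorm (z * w) = cnorm z * cnorm w.
Proof. by rewrite !cnormE ComplexField.Normc.normcM. Qed.

Lemma cnorm_ge0 z : 0 <= cnorm z. Proof. exact: sqrtr_ge0. Qed.

Lemma cnorm_conj z : cnorm (conjc z) = cnorm z.
Proof. by rewrite /cnorm re_conj im_conj sqrrN. Qed.

Lemma cnorm_real (a : R) : cnorm a%:C = `|a|.
Proof. by rewrite /cnorm/= expr0n addr0 sqrtr_sqr. Qed.

Lemma cnorm_expi (t : R) : cnorm (expi t) = 1.
Proof. by rewrite /cnorm/= cos2Dsin2 sqrtr1. Qed.

Lemma norm_re_le z : `|re z| <= cnorm z.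
Proof. by rewrite -sqrtr_sqr ler_wsqrtr// lerDl sqr_ge0. Qed.

Lemma norm_im_le z : `|im z| <= cnorm z.
Proof. by rewrite -sqrtr_sqr ler_wsqrtr// lerDr sqr_ge0. Qed.

Lemma cnorm_le z : cnorm z <= `|re z| + `|im z|.
Proof.
rewrite -(@ler_pXn2r _ 2)// ?nnegrE ?cnorm_ge0 ?addr_ge0//.
rewrite sqr_sqrtr ?addr_ge0 ?sqr_ge0// sqrrD !real_normK ?num_real//.
by rewrite addrAC lerDl mulrn_wge0// mulr_ge0.
Qed.

Lemma cnorm_sqr z : cnorm z ^+ 2 = re z ^+ 2 + im z ^+ 2.
Proof. by rewrite sqr_sqrtr// addr_ge0// sqr_ge0. Qed.

Lemma mulc_conj z : z * conjc z = (cnorm z ^+ 2)%:C.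
Proof.
rewrite cnorm_sqr; case: z => a b; apply: complex_ext => /=; ring.
Qed.

Lemma cnorm_eq0 z : cnorm z = 0 -> z = 0.
Proof.
move=> z0; apply: complex_ext => /=; apply/eqP; rewrite -normr_le0 -z0.
  exact: norm_re_le.
exact: norm_im_le.
Qed.

Lemma expiD (s t : R) : expi (s + t) = expi s * expi t.
Proof. by rewrite /expi cosD sinD; apply: complex_ext => //=; rewrite addrC. Qed.

Lemma expi0 : expi (0 : R) = 1.
Proof. by rewrite /expi cos0 sin0. Qed.

Lemma conj_expi (t : R) : conjc (expi t) = expi (- t).
Proof. by rewrite /expi cosN sinN. Qed.

Lemma conjcM z w : conjc (z * w) = conjc z * conjc w.
Proof. exact: rmorphM. Qed.

Lemma conjC_real (a : R) : conjc a%:C = a%:C.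
Proof. by apply: complex_ext => //=; rewrite oppr0. Qed.

End ComplexModulus.

Section ComplexIntegral.
Context d (T : measurableType d) (R : realType).
Implicit Types (f g : T -> R[i]) (mu : {measure set T -> \bar R}).

Definition Cmeas f :=
  measurable_fun setT (fun x => re (f x)) /\ measurable_fun setT (fun x => im (f x)).

(** Integrals run over the whole space; a domain enters as an indicator factor, so that products and
    Fubini need no restricted measures. *)
Definition Cintg mu f :=
  mu.-integrable setT (fun x => (re (f x))%:E) /\
  mu.-integrable setT (fun x => (im (f x))%:E).

Definition Cint mu f : R[i] :=
  Complex (fine (\int[mu]_x (re (f x))%:E)%E) (fine (\int[mu]_x (im (f x))%:E)%E).

Lemma Cmeas_cst (c : R[i]) : Cmeas (fun=> c).
Proof. by split; exact: measurable_cst. Qed.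

Lemma Cmeas_real (h : T -> R) : measurable_fun setT h -> Cmeas (fun x => (h x)%:C).
Proof. by move=> mh; split => //=; exact: measurable_cst. Qed.

Lemma CmeasM f g : Cmeas f -> Cmeas g -> Cmeas (fun x => f x * g x).
Proof.
move=> [rf jf] [rg jg]; split.
  under eq_fun do rewrite reM.
  by apply: measurable_funB; apply: measurable_funM.
under eq_fun do rewrite imM.
by apply: measurable_funD; apply: measurable_funM.
Qed.

Lemma CmeasD f g : Cmeas f -> Cmeas g -> Cmeas (fun x => f x + g x).
Proof.
move=> [rf jf] [rg jg]; split.
  by under eq_fun do rewrite reD; exact: measurable_funD.
by under eq_fun do rewrite imD; exact: measurable_funD.
Qed.

Lemma Cmeas_conj f : Cmeas f -> Cmeas (fun x => conjc (f x)).
Proof.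
move=> [rf jf]; split; first by under eq_fun do rewrite re_conj.
by under eq_fun do rewrite im_conj; exact: measurableT_comp.
Qed.

Lemma Cmeas_expi (h : T -> R) : measurable_fun setT h -> Cmeas (fun x => expi (h x)).
Proof.
move=> mh; split => /=; apply: measurableT_comp mh => //.
  by apply: continuous_measurable_fun; exact: continuous_cos.
by apply: continuous_measurable_fun; exact: continuous_sin.
Qed.

Lemma Cmeas_prod n (F : 'I_n -> T -> R[i]) :
  (forall i, Cmeas (F i)) -> Cmeas (fun x => \prod_i F i x).
Proof.
move=> mF; elim: n F mF => [|n IH] F mF.
  rewrite (_ : (fun x => _) = fun=> 1); first exact: Cmeas_cst.
  by apply/funext => x; rewrite big_ord0.
rewrite (_ : (fun x => _) = fun x => F ord0 x * \prod_i F (lift ord0 i) x).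
  by apply: CmeasM => //; exact: IH.
by apply/funext => x; rewrite big_ord_recl.
Qed.

Lemma measurable_cnorm f : Cmeas f -> measurable_fun setT (fun x => cnorm (f x)).
Proof.
move=> [rf jf]; apply: measurableT_comp.
  by apply: continuous_measurable_fun; exact: sqrt_continuous.
by apply: measurable_funD; apply: measurable_funX.
Qed.

Lemma Cintg_meas mu f : Cintg mu f -> Cmeas f.
Proof.
by move=> [/measurable_int/measurable_EFinP ? /measurable_int/measurable_EFinP ?].
Qed.

Lemma Cintg_dom mu f (h : T -> R) : Cmeas f -> (forall x, cnorm (f x) <= h x) ->
  mu.-integrable setT (EFin \o h) -> Cintg mu f.
Proof.
move=> [rf jf] fh ih; split; apply: le_integrable ih => //.
- exact/measurable_EFinP.
- move=> x _; rewrite lee_fin; apply: (le_trans (norm_re_le _)).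
  exact: le_trans (fh x) (ler_norm _).
- exact/measurable_EFinP.
- move=> x _; rewrite lee_fin; apply: (le_trans (norm_im_le _)).
  exact: le_trans (fh x) (ler_norm _).
Qed.

Lemma Cintg_cnorm mu f : Cintg mu f -> mu.-integrable setT (fun x => (cnorm (f x))%:E).
Proof.
move=> fi; have mf := Cintg_meas fi; case: fi => fi gi.
have := integrableD measurableT (integrable_abse fi) (integrable_abse gi).
apply: le_integrable => //; first exact/measurable_EFinP/measurable_cnorm.
move=> x _ /=; rewrite lee_fin ger0_norm ?cnorm_ge0//.
by rewrite ger0_norm ?addr_ge0//; exact: cnorm_le.
Qed.

Lemma CintgZ mu (c : R[i]) f : Cintg mu f -> Cintg mu (fun x => c * f x).
Proof.
move=> fi; apply: (@Cintg_dom _ _ (fun x => cnorm c * cnorm (f x))).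
- by apply: CmeasM; [exact: Cmeas_cst|exact: Cintg_meas fi].
- by move=> x; rewrite cnormM.
- exact: (integrableZl measurableT (cnorm c) (Cintg_cnorm fi)).
Qed.

Lemma CintgD mu f g : Cintg mu f -> Cintg mu g -> Cintg mu (fun x => f x + g x).
Proof.
move=> [fi gi] [fi' gi']; split.
  by under eq_fun do rewrite reD EFinD; exact: integrableD.
by under eq_fun do rewrite imD EFinD; exact: integrableD.
Qed.

Lemma Cintg_bounded mu f g (M : R) : Cmeas g -> (forall x, cnorm (g x) <= M) ->
  Cintg mu f -> Cintg mu (fun x => f x * g x).
Proof.
move=> mg gM fi; apply: (@Cintg_dom _ _ (fun x => M * cnorm (f x))).
- by apply: CmeasM => //; exact: Cintg_meas fi.
- by move=> x; rewrite cnormM mulrC ler_wpM2r ?cnorm_ge0.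
- exact: (integrableZl measurableT M (Cintg_cnorm fi)).
Qed.

Lemma Cintg_conj mu f : Cintg mu f -> Cintg mu (fun x => conjc (f x)).
Proof.
move=> fi; apply: (@Cintg_dom _ _ (fun x => cnorm (f x))).
- by apply: Cmeas_conj; exact: Cintg_meas fi.
- by move=> x; rewrite cnorm_conj.
- exact: (Cintg_cnorm fi).
Qed.

Lemma CintE mu f : Cintg mu f ->
  ((\int[mu]_x (re (f x))%:E)%E = (re (Cint mu f))%:E) /\
  ((\int[mu]_x (im (f x))%:E)%E = (im (Cint mu f))%:E).
Proof.
by move=> [fi gi]; split; rewrite /= fineK//; exact: integrable_fin_num.
Qed.

Lemma CintZ mu (c : R[i]) f : Cintg mu f -> Cint mu (fun x => c * f x) = c * Cint mu f.
Proof.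
move=> fi; have [E1 E2] := CintE fi; have [fi1 fi2] := fi; apply: complex_ext => /=.
  under eq_integral do rewrite reM EFinB !EFinM.
  rewrite integralB//; [|exact: integrableZl..].
  by rewrite !integralZl// E1 E2 -!EFinM -EFinB reM.
under eq_integral do rewrite imM EFinD !EFinM.
rewrite integralD//; [|exact: integrableZl..].
by rewrite !integralZl// E1 E2 -!EFinM -EFinD imM.
Qed.

Lemma CintD mu f g : Cintg mu f -> Cintg mu g ->
  Cint mu (fun x => f x + g x) = Cint mu f + Cint mu g.
Proof.
move=> fi gi; have [E1 E2] := CintE fi; have [E3 E4] := CintE gi.
case: fi gi => [f1 f2] [g1 g2]; apply: complex_ext.
  rewrite reD -[LHS]/(fine _); under eq_integral do rewrite reD EFinD.
  by rewrite integralD// E1 E3.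
rewrite imD -[LHS]/(fine _); under eq_integral do rewrite imD EFinD.
by rewrite integralD// E2 E4.
Qed.

Lemma Cint_conj mu f : Cintg mu f ->
  Cint mu (fun x => conjc (f x)) = conjc (Cint mu f).
Proof.
move=> fi; have [_ E] := CintE fi; apply: complex_ext => /=.
  by under eq_integral do rewrite re_conj.
under eq_integral do rewrite im_conj EFinN.
by rewrite integralN ?E//; exact: integrable_add_def fi.2.
Qed.

Lemma eq_Cint mu f g : (forall x, f x = g x) -> Cint mu f = Cint mu g.
Proof. by move=> /funext ->. Qed.

(** Real and imaginary parts are estimated separately, whence the factor 2. It is harmless, as the
    bounds serve only for domination. *)
Lemma cnorm_Cint_le mu f (h : T -> R) : Cmeas f -> (forall x, cnorm (f x) <= h x) ->
  mu.-integrable setT (EFin \o h) ->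
  cnorm (Cint mu f) <= 2 * fine (\int[mu]_x (h x)%:E)%E.
Proof.
move=> mf fh ih; have [fi gi] := Cintg_dom mf fh ih.
rewrite mulr_natl mulr2n; apply: (le_trans (cnorm_le _)); apply: lerD => /=.
  apply: (le_trans (le_normr_Rintegral measurableT fi)).
  apply: le_Rintegral => //; first exact: (@integrable_norm _ _ _ mu setT (fun x => re (f x)) fi).
  by move=> x _; exact: le_trans (norm_re_le _) (fh x).
apply: (le_trans (le_normr_Rintegral measurableT gi)).
apply: le_Rintegral => //; first exact: (@integrable_norm _ _ _ mu setT (fun x => im (f x)) gi).
by move=> x _; exact: le_trans (norm_im_le _) (fh x).
Qed.

Lemma Cint_real mu (h : T -> R) :
  Cint mu (fun x => (h x)%:C) = (fine (\int[mu]_x (h x)%:E)%E)%:C.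
Proof. by apply: complex_ext => //=; rewrite integral0. Qed.

Lemma Cint_dominated mu (f_ : nat -> T -> R[i]) f (h : T -> R) :
  (forall n, Cmeas (f_ n)) -> Cmeas f ->
  (forall x, re (f_ n x) @[n --> \oo] --> re (f x)) ->
  (forall x, im (f_ n x) @[n --> \oo] --> im (f x)) ->
  mu.-integrable setT (EFin \o h) -> (forall n x, cnorm (f_ n x) <= h x) ->
  (re (Cint mu (f_ n)) @[n --> \oo] --> re (Cint mu f)) /\
  (im (Cint mu (f_ n)) @[n --> \oo] --> im (Cint mu f)).
Proof.
move=> mf_ mf f_re f_im ih fh.
have aux (g_ : nat -> T -> R) (g : T -> R) : (forall n, measurable_fun setT (g_ n)) ->
    measurable_fun setT g -> (forall x, g_ n x @[n --> \oo] --> g x) ->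
    (forall n x, `|g_ n x| <= h x) ->
    fine (\int[mu]_x (g_ n x)%:E)%E @[n --> \oo] --> fine (\int[mu]_x (g x)%:E)%E.
  move=> mg_ mg g_g gh.
  have [||||| gi _ gc] := @dominated_convergence _ _ _ mu setT measurableT
      (fun n x => (g_ n x)%:E) (fun x => (g x)%:E) (EFin \o h).
  - by move=> n; exact/measurable_EFinP.
  - exact/measurable_EFinP.
  - by apply/aeW => x _; apply/fine_cvgP; split; [exact: nearW|exact: g_g].
  - by [].
  - by apply/aeW => x n _; rewrite lee_fin.
  apply: fine_cvg; rewrite fineK//; exact: integrable_fin_num.
split; apply: aux => //.
- by move=> n; exact: (mf_ n).1.
- exact: mf.1.
- by move=> n x; exact: le_trans (norm_re_le _) (fh n x).
- by move=> n; exact: (mf_ n).2.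
- exact: mf.2.
- by move=> n x; exact: le_trans (norm_im_le _) (fh n x).
Qed.

End ComplexIntegral.

(** * Fubini for complex integrands *)

Section ComplexFubini.
Context d1 d2 (T1 : measurableType d1) (T2 : measurableType d2) (R : realType).
Variable m1 : {sigma_finite_measure set T1 -> \bar R}.
Variable m2 : {sigma_finite_measure set T2 -> \bar R}.

(** For some [x] the inner integral may be infinite. It is nevertheless a difference of two Tonelli
    integrals, hence measurable, and [fine] sends infinite values to 0. *)
Lemma measurable_fine_integral (g : T1 * T2 -> R) : measurable_fun setT g ->
  measurable_fun setT (fun x => fine (\int[m2]_y (g (x, y))%:E)%E).
Proof.
move=> mg; have /measurable_EFinP mG := mg.
apply: measurableT_comp => //.
rewrite (_ : (fun x => _) = (fun x => (\int[m2]_y (EFin \o g)^\+ (x, y))%E -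
    (\int[m2]_y (EFin \o g)^\- (x, y)))%E).
  apply: emeasurable_funB; apply: (@measurable_fun_fubini_tonelli_F _ _ _ _ _ m2).
  - exact: measurable_funepos.
  - by move=> x; exact: funepos_ge0.
  - exact: measurable_funeneg.
  - by move=> x; exact: funeneg_ge0.
apply/funext => x; rewrite integralE; congr (_ - _)%E; apply: eq_integral => y _.
  by rewrite -[RHS]/(((EFin \o g)^\+%E \o pair x) y) -funepos_comp.
by rewrite -[RHS]/(((EFin \o g)^\-%E \o pair x) y) -funeneg_comp.
Qed.

Lemma Cmeas_Cint (f : T1 * T2 -> R[i]) : Cmeas f ->
  Cmeas (fun x => Cint m2 (fun y => f (x, y))).
Proof.
by move=> [mf mg]; split; [exact: (measurable_fine_integral mf)|exact: (measurable_fine_integral mg)].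
Qed.

(** By integrability the inner integral is infinite only on a null set, so replacing it there by the
    default value 0 of [fine] changes nothing. *)
Lemma fine_fubini1 (g : T1 * T2 -> R) : (m1 \x m2)%E.-integrable setT (EFin \o g) ->
  (\int[m1]_x (fine (\int[m2]_y (g (x, y))%:E))%:E = \int[m1 \x m2]_z (g z)%:E)%E.
Proof.
move=> ig; rewrite -(integral12_prod_meas1 ig).
have mF := measurable_fubini_F ig.
apply: ae_eq_integral => //.
  apply/measurable_EFinP/measurable_fine_integral.
  by have /measurable_int/measurable_EFinP := ig.
have := integrable_ae measurableT (integrable_fubini_F ig).
by apply: filterS => x /(_ I) h _; rewrite fineK.
Qed.

Lemma Cint_fubini (f : T1 * T2 -> R[i]) : Cintg (m1 \x m2)%E f ->
  Cint (m1 \x m2)%E f = Cint m1 (fun x => Cint m2 (fun y => f (x, y))).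
Proof.
move=> [fi gi]; apply: complex_ext => /=.
  by rewrite -(fine_fubini1 (g := fun z => re (f z))).
by rewrite -(fine_fubini1 (g := fun z => im (f z))).
Qed.

Lemma integrable_tensor (a : T1 -> R) (b : T2 -> R) :
  (forall x, 0 <= a x) -> (forall y, 0 <= b y) ->
  m1.-integrable setT (EFin \o a) -> m2.-integrable setT (EFin \o b) ->
  (m1 \x m2)%E.-integrable setT (fun z => (a z.1 * b z.2)%:E).
Proof.
move=> a0 b0 ia ib.
have ma : measurable_fun setT a by have /measurable_int/measurable_EFinP := ia.
have mb : measurable_fun setT b by have /measurable_int/measurable_EFinP := ib.
apply/integrable12ltyP.
  apply/measurable_EFinP; apply: measurable_funM.
    exact: (measurableT_comp ma measurable_fst).
  exact: (measurableT_comp mb measurable_snd).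
under eq_integral => x _.
  under eq_integral => y _ do rewrite /= ger0_norm ?mulr_ge0// EFinM.
  rewrite integralZl//; over.
rewrite /= -(fineK (integrable_fin_num measurableT ib)).
rewrite integralZr//.
by rewrite -(fineK (integrable_fin_num measurableT ia)) -EFinM ltry.
Qed.

Lemma Cintg_tensor (f : T1 * T2 -> R[i]) (a : T1 -> R) (b : T2 -> R) : Cmeas f ->
  (forall x, 0 <= a x) -> (forall y, 0 <= b y) ->
  m1.-integrable setT (EFin \o a) -> m2.-integrable setT (EFin \o b) ->
  (forall x y, cnorm (f (x, y)) <= a x * b y) -> Cintg (m1 \x m2)%E f.
Proof.
move=> mf a0 b0 ia ib fab.
apply: (Cintg_dom mf _ (integrable_tensor a0 b0 ia ib)) => -[x y]; exact: fab.
Qed.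

End ComplexFubini.

Section ComplexFubiniSwap.
Context d1 d2 (T1 : measurableType d1) (T2 : measurableType d2) (R : realType).
Variable m1 : {sigma_finite_measure set T1 -> \bar R}.
Variable m2 : {sigma_finite_measure set T2 -> \bar R}.

Lemma Cmeas_swap (f : T1 * T2 -> R[i]) : Cmeas f ->
  Cmeas (fun z : T2 * T1 => f (z.2, z.1)).
Proof.
move=> [mf mg]; have ms : measurable_fun setT (fun z : T2 * T1 => (z.2, z.1)).
  by apply/measurable_fun_pairP; split; [exact: measurable_snd|exact: measurable_fst].
by split; [exact: (measurableT_comp mf ms)|exact: (measurableT_comp mg ms)].
Qed.

Lemma fine_fubini2 (g : T1 * T2 -> R) : (m1 \x m2)%E.-integrable setT (EFin \o g) ->
  (\int[m2]_y (fine (\int[m1]_x (g (x, y))%:E))%:E = \int[m1 \x m2]_z (g z)%:E)%E.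
Proof.
move=> ig; rewrite -(integral21_prod_meas1 ig).
have mG := measurable_fubini_G ig.
have mg : measurable_fun setT g by have /measurable_int/measurable_EFinP := ig.
apply: ae_eq_integral => //.
  apply/measurable_EFinP.
  apply: (@measurable_fine_integral _ _ T2 T1 R m1 (fun z => g (z.2, z.1))).
  apply: measurableT_comp mg _.
  by apply/measurable_fun_pairP; split; [exact: measurable_snd|exact: measurable_fst].
have := ae_integrable2 ig.
by apply: filterS => y iy _; rewrite fineK//; exact: integrable_fin_num.
Qed.

Lemma Cint_fubini_swap (f : T1 * T2 -> R[i]) : Cintg (m1 \x m2)%E f ->
  Cint m1 (fun x => Cint m2 (fun y => f (x, y))) =
  Cint m2 (fun y => Cint m1 (fun x => f (x, y))).
Proof.
move=> fi; rewrite -Cint_fubini//; case: fi => fi gi; apply: complex_ext => /=.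
  by rewrite -(fine_fubini2 (g := fun z => re (f z))).
by rewrite -(fine_fubini2 (g := fun z => im (f z))).
Qed.

End ComplexFubiniSwap.

(** * Transport of complex integrals along a substitution *)

Section Transfer.
Context d1 d2 (T1 : measurableType d1) (T2 : measurableType d2) (R : realType).
Variables (mu : {measure set T1 -> \bar R}) (nu : {measure set T2 -> \bar R}).
Variable h : T2 -> T1.
Hypothesis mh : measurable_fun setT h.
Hypothesis muh : forall g : T1 -> \bar R, measurable_fun setT g ->
  (\int[mu]_x g x = \int[nu]_y g (h y))%E.

Lemma integrable_transfer (g : T1 -> R) : measurable_fun setT g ->
  nu.-integrable setT (fun y => (g (h y))%:E) <-> mu.-integrable setT (EFin \o g).
Proof.
move=> mg; have mgh : measurable_fun setT (fun y => g (h y)) by exact: measurableT_comp.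
have E := muh (measurableT_comp (@abse_measurable R setT) ((measurable_EFinP _ _).2 mg)).
by split => /integrableP[_ h1]; apply/integrableP; split;
  [exact/measurable_EFinP|rewrite E|exact/measurable_EFinP|rewrite -E].
Qed.

Lemma Cmeas_transfer (f : T1 -> R[i]) : Cmeas f -> Cmeas (fun y => f (h y)).
Proof.
move=> [mf mg]; split.
  exact: (measurableT_comp mf mh).
exact: (measurableT_comp mg mh).
Qed.

Lemma Cintg_transfer (f : T1 -> R[i]) : Cmeas f ->
  Cintg nu (fun y => f (h y)) <-> Cintg mu f.
Proof.
move=> [mf mg]; have [F1 F2] := integrable_transfer mf.
have [G1 G2] := integrable_transfer mg.
by split => -[fi gi]; split; [exact: F1|exact: G1|exact: F2|exact: G2].
Qed.

Lemma Cint_transfer (f : T1 -> R[i]) : Cmeas f ->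
  Cint mu f = Cint nu (fun y => f (h y)).
Proof.
move=> [/measurable_EFinP mf /measurable_EFinP mg].
by apply: complex_ext => /=; [rewrite (muh mf)|rewrite (muh mg)].
Qed.

End Transfer.

Section Tensor.
Context d1 d2 (T1 : measurableType d1) (T2 : measurableType d2) (R : realType).
Variable m1 : {sigma_finite_measure set T1 -> \bar R}.
Variable m2 : {sigma_finite_measure set T2 -> \bar R}.

Lemma Cint_tensor (f : T1 -> R[i]) (g : T2 -> R[i]) : Cintg m1 f -> Cintg m2 g ->
  Cintg (m1 \x m2)%E (fun z => f z.1 * g z.2) /\
  Cint (m1 \x m2)%E (fun z => f z.1 * g z.2) = Cint m1 f * Cint m2 g.
Proof.
move=> fi gi; have [mf mf'] := Cintg_meas fi; have [mg mg'] := Cintg_meas gi.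
have fgi : Cintg (m1 \x m2)%E (fun z => f z.1 * g z.2).
  apply: (Cintg_tensor (a := fun x => cnorm (f x)) (b := fun y => cnorm (g y))).
  - apply: CmeasM; split.
    + exact: (measurableT_comp mf measurable_fst).
    + exact: (measurableT_comp mf' measurable_fst).
    + exact: (measurableT_comp mg measurable_snd).
    + exact: (measurableT_comp mg' measurable_snd).
  - by move=> x; exact: cnorm_ge0.
  - by move=> x; exact: cnorm_ge0.
  - exact: Cintg_cnorm.
  - exact: Cintg_cnorm.
  - by move=> x y /=; rewrite cnormM.
split => //; rewrite Cint_fubini//=.
under eq_Cint => x do rewrite CintZ// mulrC.
by rewrite CintZ// mulrC.
Qed.

End Tensor.

Section LebComplex.
Variables (R : realType) (n : nat).
Local Notation lebn := (@leb R n.+1).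
Implicit Types f : 'rV[R]_n.+1 -> R[i].
Local Notation Rn1 := (Rn R n.+1).

Lemma Cintg_shift (c : 'rV[R]_n.+1) f : Cintg lebn f -> Cintg lebn (fun x => f (x + c)).
Proof.
move=> fi; apply/(Cintg_transfer (mu := lebn) (measurable_vecD c)) => //.
  by move=> g mg; exact: integral_leb_shift.
exact: Cintg_meas fi.
Qed.

Lemma Cint_shift (c : 'rV[R]_n.+1) f : @Cmeas _ Rn1 _ f ->
  Cint lebn f = Cint lebn (fun x => f (x + c)).
Proof.
move=> mf; apply: (Cint_transfer (mu := lebn)) mf.
by move=> g mg; exact: integral_leb_shift.
Qed.

Lemma Cmeas_shift (c : 'rV[R]_n.+1) f : @Cmeas _ Rn1 _ f ->
  @Cmeas _ Rn1 _ (fun x => f (x + c)).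
Proof. exact: (Cmeas_transfer (measurable_vecD c)). Qed.

Lemma Cmeas_scale (c : R) f : @Cmeas _ Rn1 _ f -> @Cmeas _ Rn1 _ (fun x => f (c *: x)).
Proof. exact: (Cmeas_transfer (@measurable_vecZ R _ c)). Qed.

Lemma fine_integral_scale (c : R) (g : Rn1 -> R) : 0 < c ->
  lebn.-integrable setT (EFin \o g) ->
  lebn.-integrable setT (fun x => (g (c *: x))%:E) /\
  fine (\int[lebn]_x (g x)%:E)%E = c ^+ n.+1 * fine (\int[lebn]_x (g (c *: x))%:E)%E.
Proof.
move=> c0 ig; have mg : measurable_fun setT g by have /measurable_int/measurable_EFinP := ig.
have cn0 : 0 < c ^+ n.+1 by rewrite exprn_gt0.
have mgc : measurable_fun setT (fun x : Rn1 => g (c *: x)).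
  exact: (measurableT_comp mg (@measurable_vecZ R _ c)).
have igc : lebn.-integrable setT (fun x => (g (c *: x))%:E).
  apply/integrableP; split; first exact/measurable_EFinP.
  have /integrableP[mE] := ig.
  rewrite (integral_leb_scale c0)//; last exact: measurableT_comp.
  move=> h; rewrite ltey; apply/negP => /eqP E; move: h.
  by rewrite -[X in (_ * X)%E]/(\int[lebn]_x `|(g (c *: x))%:E|)%E E gt0_muley// lte_fin.
split => //; rewrite -[X in X * _]/(fine (c ^+ n.+1)%:E) -fineM//; last exact: integrable_fin_num.
congr fine; pose h := ( *:%R c : Rn1 -> Rn1).
have mE : measurable_fun setT (EFin \o g) by exact/measurable_EFinP.
rewrite -[X in (_ * X)%E]/(\int[lebn]_x ((EFin \o g) \o h) x)%E.
rewrite integralE [X in (_ * X)%E]integralE muleBr//; last first.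
  by rewrite fin_num_adde_defl// fin_numN; exact: (integrable_neg_fin_num measurableT igc).
rewrite (funepos_comp (EFin \o g) h) (funeneg_comp (EFin \o g) h); congr (_ - _)%E.
  exact: (integral_leb_scale c0 (measurable_funepos mE) (funepos_ge0 _)).
exact: (integral_leb_scale c0 (measurable_funeneg mE) (funeneg_ge0 _)).
Qed.

Lemma Cint_scale (c : R) f : 0 < c -> Cintg lebn f ->
  Cintg lebn (fun x => f (c *: x)) /\
  Cint lebn f = (c ^+ n.+1)%:C * Cint lebn (fun x => f (c *: x)).
Proof.
move=> c0 [fi gi]; have [fi' fE] := fine_integral_scale (g := fun x => re (f x)) c0 fi.
have [gi' gE] := fine_integral_scale (g := fun x => im (f x)) c0 gi.
split => //; apply: complex_ext; rewrite ?reM ?imM /=.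
  by rewrite mul0r subr0.
by rewrite mul0r addr0.
Qed.

End LebComplex.

Section RowCons.
Variables (R : realType) (n : nat).

Lemma integral_leb_row_cons (g : Rn R n.+2 -> \bar R) : measurable_fun setT g ->
  (\int[@leb R n.+2]_x g x =
  \int[lebesgue_measure \x @leb R n.+1]_z g (row_cons z))%E.
Proof.
move=> mg.
apply: (@integral_leb_comp R _ _ _ (lebesgue_measure \x @leb R n.+1)%E
  (@row_cons R n.+1) _ _ g mg); first exact: measurable_row_cons.
move=> a b; rewrite preimage_row_cons_box.
rewrite [LHS](@product_measure1E _ _ _ _ R lebesgue_measure (@leb R n.+1))//; last exact: measurable_box.
rewrite [X in (X * _)%E](_ : _ = lebesgue_measure `[a 0 ord0, b 0 ord0]%classic)//.
rewrite lebesgue_measure_itv/= [X in (_ * X)%E]leb_box lte_fin /boxvol [in RHS]big_ord_recl/=.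
case: ltP => ab; rewrite -?EFinB -EFinM; congr (_ * _)%:E.
- by rewrite (max_idPl _)// subr_ge0 ltW.
- by apply: eq_bigr => i _; rewrite !mxE.
- by rewrite (max_idPr _)// subr_le0.
- by apply: eq_bigr => i _; rewrite !mxE.
Qed.

Lemma row_cons0 (z : (R * Rn R n)%type) : row_cons z 0 ord0 = z.1.
Proof. by rewrite mxE unlift_none. Qed.

Lemma row_consS (z : (R * Rn R n)%type) i : row_cons z 0 (lift ord0 i) = z.2 0 i.
Proof. by rewrite mxE liftK. Qed.

End RowCons.

Section ProductFunctions.
Variable R : realType.

Lemma Cmeas_coord_prod n (q : 'I_n -> R -> R[i]) : (forall i, Cmeas (q i)) ->
  @Cmeas _ (Rn R n) _ (fun x => \prod_i q i (x 0 i)).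
Proof.
by move=> mq; apply: Cmeas_prod => i; exact: (Cmeas_transfer (@measurable_coord R n i) (mq i)).
Qed.

(** One coordinate is split off at a time through [row_cons]; the induction starts in dimension 1,
    where [leb] is Lebesgue measure on the line. *)
Lemma Cint_coord_prod n (q : 'I_n.+1 -> R -> R[i]) :
  (forall i, Cintg lebesgue_measure (q i)) ->
  Cintg (@leb R n.+1) (fun x => \prod_i q i (x 0 i)) /\
  Cint (@leb R n.+1) (fun x => \prod_i q i (x 0 i)) =
    \prod_i Cint lebesgue_measure (q i).
Proof.
elim: n q => [|n IH] q iq; have mq := Cmeas_coord_prod (fun i => Cintg_meas (iq i)).
  have E : (fun t : R => \prod_(i < 1) q i ((const_mx t : 'rV_1) 0 i)) = q ord0.
    by apply/funext => t; rewrite big_ord1 mxE.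
  split; last first.
    rewrite (Cint_transfer (@integral_leb1 R) mq) big_ord1 /=.
    by rewrite -[in RHS]E.
  have [F _] := Cintg_transfer (nu := lebesgue_measure) (@measurable_const_mx R) (@integral_leb1 R) mq.
  by apply: F; rewrite [X in Cintg _ X]E.
have [IH1 IH2] := IH (fun i => q (lift ord0 i)) (fun i => iq _).
have [T1 T2] := Cint_tensor (iq ord0) IH1.
have E : (fun z : (R * Rn R n.+1)%type => \prod_i q i (row_cons z 0 i)) =
    (fun z => q ord0 z.1 * \prod_i q (lift ord0 i) (z.2 0 i)).
  apply/funext => z; rewrite big_ord_recl row_cons0; congr (_ * _).
  by apply: eq_bigr => i _; rewrite row_consS.
split; last first.
  rewrite (Cint_transfer (@integral_leb_row_cons R n) mq).
  by rewrite [X in Cint _ X]E T2 IH2 [RHS]big_ord_recl.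
have [F _] := Cintg_transfer (nu := (lebesgue_measure \x @leb R n.+1)%E)
  (@measurable_row_cons R n.+1) (@integral_leb_row_cons R n) mq.
by apply: F; rewrite [X in Cintg _ X]E.
Qed.

End ProductFunctions.

(** * Fourier inversion and Plancherel *)

Section Poisson1.
Variable R : realType.
Local Notation mu := (@lebesgue_measure R).
Implicit Types t z : R.

(** The added 1 makes the integrand non-negative, so that its integral over the half-line is given
    by the fundamental theorem for non-negative functions. The cosine transform is recovered by
    subtracting the case of the constant. *)
Definition laplace_wave z t := expR (- t) * (1 + cos (z * t)).

Lemma laplace_wave_ge0 z t : 0 <= laplace_wave z t.
Proof. by rewrite mulr_ge0 ?expR_ge0// -lerBlDl sub0r cos_geN1. Qed.

Lemma continuous_laplace_wave z : continuous (laplace_wave z).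
Proof.
move=> t; apply: cvgM.
  apply: (@continuous_comp _ _ _ -%R expR); first exact: opp_continuous.
  exact: continuous_expR.
apply: cvgD; first exact: cvg_cst.
apply: (@continuous_comp _ _ _ ( *%R z) cos); last exact: continuous_cos.
exact: mulrl_continuous.
Qed.

Lemma integral0y_laplace_wave z :
  (\int[mu]_(t in `[0%R, +oo[) (laplace_wave z t)%:E = (1 + (1 + z ^+ 2)^-1)%:E)%E.
Proof.
have z1 : 1 + z ^+ 2 != 0 by rewrite gt_eqF// ltr_pwDl// sqr_ge0.
(* An antiderivative, as obtained by integrating by parts twice. It vanishes at infinity, and
   [- F 0] is the value claimed. *)
pose F t := expR (- t) * ((z * sin (z * t) - cos (z * t)) / (1 + z ^+ 2) - 1).
have dF t : is_derive t 1 F (laplace_wave z t).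
  rewrite /F; apply: is_derive_eq.
  rewrite /laplace_wave /GRing.scale/=.
  by field.
have cF : continuous F.
  move=> t; apply: differentiable_continuous; apply/derivable1_diffP.
  exact: ex_derive.
rewrite (@ge0_continuous_FTC2y _ _ F 0 0).
- by rewrite /F oppr0 expR0 mulr0 sin0 cos0 mulr0 -EFinB; congr _%:E; field.
- by move=> t _; exact: laplace_wave_ge0.
- by apply: continuous_subspaceT; exact: continuous_laplace_wave.
- pose M := (`|z| + 1) / (1 + z ^+ 2) + 1.
  apply: (@squeeze_cvgr _ _ _ _ (fun t => - (M * expR (- t))) (fun t => M * expR (- t))).
  + apply: nearW => t; rewrite -ler_norml normrM ger0_norm ?expR_ge0// mulrC.
    rewrite ler_wpM2r ?expR_ge0//.
    rewrite (le_trans (ler_normB _ _))// normr1 lerD2r normrM.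
    rewrite [`|_^-1|]ger0_norm; last by rewrite invr_ge0 addr_ge0 ?sqr_ge0.
    rewrite ler_wpM2r ?invr_ge0 ?addr_ge0 ?sqr_ge0//.
    rewrite (le_trans (ler_normB _ _))// normrM lerD//.
      by rewrite ler_piMr// ler_norml sin_le1 sin_geN1.
    by rewrite ler_norml cos_le1 cos_geN1.
  + rewrite -[X in _ --> X]oppr0 -(mulr0 M); apply: cvgN; apply: cvgM; first exact: cvg_cst.
    exact: cvgr_expR.
  + rewrite -(mulr0 M); apply: cvgM; first exact: cvg_cst.
    exact: cvgr_expR.
- by move=> t _; exact: ex_derive.
- by apply: cvg_at_right_filter; exact: cF.
- by move=> t _; rewrite derive1E; exact: derive_val.
Qed.

Definition lap t := expR (- `|t|).

Lemma continuous_lap : continuous lap.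
Proof.
move=> t; apply: (@continuous_comp _ _ _ (fun t => - `|t|) expR).
  by apply: cvgN; exact: norm_continuous.
exact: continuous_expR.
Qed.

Lemma integral_lap_wave z :
  (\int[mu]_t (lap t * (1 + cos (z * t)))%:E = (2 + 2 / (1 + z ^+ 2))%:E)%E.
Proof.
rewrite ge0_symfun_integralT.
- rewrite (_ : [set x | _] = `[0%R, +oo[%classic); last first.
    by apply/seteqP; split => x/=; rewrite in_itv/= andbT.
  rewrite (_ : (\int[mu]_(x in _) _)%E = (1 + (1 + z ^+ 2)^-1)%:E).
    by rewrite -EFinM; congr _%:E; rewrite mulrDr mulr1.
  rewrite -integral0y_laplace_wave; apply: eq_integral => t.
  by rewrite inE/= in_itv/= andbT => t0; rewrite /lap /laplace_wave ger0_norm.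
- by move=> t; rewrite mulr_ge0 ?expR_ge0// -lerBlDl sub0r cos_geN1.
- move=> t; apply: cvgM; first exact: continuous_lap.
  apply: cvgD; first exact: cvg_cst.
  apply: (@continuous_comp _ _ _ ( *%R z) cos); last exact: continuous_cos.
  exact: mulrl_continuous.
- by move=> t /=; rewrite /lap normrN mulrN cosN.
Qed.

Lemma measurable_lap : measurable_fun setT lap.
Proof. by apply: continuous_measurable_fun; exact: continuous_lap. Qed.

Lemma lap_ge0 t : 0 <= lap t. Proof. exact: expR_ge0. Qed.

Lemma integral_lap : (\int[mu]_t (lap t)%:E = 2%:E)%E.
Proof.
transitivity (\int[mu]_t ((2^-1)%:E * (lap t * (1 + cos (0 * t)))%:E))%E.
  by apply: eq_integral => t _; rewrite mul0r cos0 -EFinM; congr _%:E; field.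
rewrite ge0_integralZl//.
- by rewrite integral_lap_wave -EFinM; congr _%:E; rewrite expr0n/= addr0 divr1; field.
- apply/measurable_EFinP; under eq_fun do rewrite mul0r cos0.
  by apply: measurable_funM => //; exact: measurable_lap.
- by move=> t _; rewrite lee_fin mul0r cos0 mulr_ge0 ?lap_ge0.
Qed.

Lemma integrable_lap : mu.-integrable setT (fun t => (lap t)%:E).
Proof.
apply/integrableP; split; first by apply/measurable_EFinP; exact: measurable_lap.
under eq_integral => t _ do rewrite /= ger0_norm ?lap_ge0//.
by rewrite integral_lap ltry.
Qed.

Lemma integral_opp (g : R -> \bar R) : measurable_fun setT g ->
  (\int[mu]_t g t = \int[mu]_t g (- t)%R)%E.
Proof.
move=> mg; have mg' : measurable_fun setT (fun x : Rn R 1 => g (x 0 0)).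
  exact: (measurableT_comp mg (@measurable_coord R 1 0)).
have := integral_leb_opp mg'.
rewrite !integral_leb1//.
  by under eq_integral do rewrite mxE; under [in RHS]eq_integral do rewrite !mxE.
exact: (measurableT_comp mg' (@measurable_vecN R 1)).
Qed.

Lemma measurable_mulrl z : measurable_fun setT (fun t : R => z * t).
Proof. by apply: measurable_funM => //; exact: measurable_cst. Qed.

Lemma Cmeas_lap_expi z : Cmeas (fun t => (lap t)%:C * expi (- (t * z))).
Proof.
apply: CmeasM; first by apply: Cmeas_real; exact: measurable_lap.
apply: Cmeas_expi; apply: measurableT_comp => //.
by under eq_fun do rewrite mulrC; exact: measurable_mulrl.
Qed.

Lemma Cintg_lap_expi z : Cintg mu (fun t => (lap t)%:C * expi (- (t * z))).
Proof.
apply: (@Cintg_dom _ _ _ mu _ lap (Cmeas_lap_expi z) _ integrable_lap) => t.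
by rewrite cnormM cnorm_expi mulr1 cnorm_real ger0_norm// lap_ge0.
Qed.

Lemma Cint_lap_expi z :
  Cint mu (fun t => (lap t)%:C * expi (- (t * z))) = (2 / (1 + z ^+ 2))%:C.
Proof.
have [fi gi] := Cintg_lap_expi z; have [mf mg] := Cmeas_lap_expi z.
apply: complex_ext => /=.
  transitivity (fine (\int[mu]_t ((lap t * (1 + cos (z * t)))%:E - (lap t)%:E))%E).
    congr fine; apply: eq_integral => t _; rewrite -EFinB cosN mulrC; congr _%:E.
    by rewrite [t * z]mulrC; ring.
  rewrite integralB//; last exact: integrable_lap.
    rewrite integral_lap_wave integral_lap -EFinB/=; ring.
  apply/integrableP; split.
    apply/measurable_EFinP; apply: measurable_funM; first exact: measurable_lap.
    apply: measurable_funD => //; apply: measurableT_comp (measurable_mulrl z).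
    by apply: continuous_measurable_fun; exact: continuous_cos.
  under eq_integral => t _.
    rewrite /= ger0_norm; last by rewrite mulr_ge0 ?lap_ge0// -lerBlDl sub0r cos_geN1.
    over.
  by rewrite integral_lap_wave ltry.
(* The imaginary part is odd: reflection gives [I = J], oddness gives [J = - I]. *)
have /(congr1 fine) := integral_opp ((measurable_EFinP _ _).2 mg).
set I := fine _; set J := fine _ => IJ; suff : J = - I by move=> JI; lra.
rewrite /I /J -fineN -integralN; last exact: integrable_add_def gi.
congr fine; apply: eq_integral => t _; rewrite -EFinN; congr _%:E.
by rewrite /= /lap normrN mulNr !opprK !sinN !mul0r !addr0 mulrN opprK.
Qed.

Definition poisson z : R := 2 / (1 + z ^+ 2).

Lemma onesqr_gt0 z : 0 < 1 + z ^+ 2. Proof. by rewrite ltr_pwDl// sqr_ge0. Qed.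

Lemma poisson_ge0 z : 0 <= poisson z.
Proof. by rewrite divr_ge0// ltW// onesqr_gt0. Qed.

Lemma continuous_poisson : continuous poisson.
Proof.
move=> z; apply: cvgM; first exact: cvg_cst.
exact: (@continuous_oneDsqrV R z).
Qed.

Lemma integral_poisson : (\int[mu]_z (poisson z)%:E = (2 * pi)%:E)%E.
Proof.
rewrite ge0_symfun_integralT.
- rewrite (_ : [set x | _] = `[0%R, +oo[%classic); last first.
    by apply/seteqP; split => x/=; rewrite in_itv/= andbT.
  under eq_integral do rewrite /poisson EFinM.
  rewrite ge0_integralZl//.
  + rewrite (_ : (fun z => _) = fun z => ((oneDsqr z)^-1)%:E)//.
    by rewrite integral0y_oneDsqr -!EFinM; congr _%:E; field.
  + apply/measurable_EFinP; apply: measurable_funTS.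
    by apply: continuous_measurable_fun; exact: continuous_oneDsqrV.
  + by move=> z _; rewrite lee_fin invr_ge0 ltW// onesqr_gt0.
- exact: poisson_ge0.
- exact: continuous_poisson.
- by move=> z /=; rewrite /poisson sqrrN.
Qed.

Lemma Cintg_poisson : Cintg mu (fun z => (poisson z)%:C).
Proof.
have mp : measurable_fun setT poisson.
  by apply: continuous_measurable_fun; exact: continuous_poisson.
apply: (@Cintg_dom _ _ _ mu _ poisson).
- exact: Cmeas_real.
- by move=> z; rewrite cnorm_real ger0_norm// poisson_ge0.
- apply/integrableP; split; first exact/measurable_EFinP.
  under eq_integral => t _ do rewrite /= ger0_norm ?poisson_ge0//.
  by rewrite integral_poisson ltry.
Qed.

Lemma Cint_poisson : Cint mu (fun z => (poisson z)%:C) = (2 * pi)%:C.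
Proof. by rewrite Cint_real integral_poisson. Qed.

End Poisson1.

(** * Borel measurability of continuous functions *)

Section ContinuousMeasurable.
Variables (R : realType) (n : nat).
Local Notation vec := 'rV[R]_n.+1.

Lemma ballrVP (x y : vec) (e : R) : 0 < e ->
  ball x e y <-> forall i, `|x 0 i - y 0 i| < e.
Proof.
move=> e0; split => [[_ h] i|h]; first exact: (h 0 i).
by split => // i j; rewrite (ord1 i); exact: h.
Qed.

(** A countable family of which every open set is a union: rational centre [p.1], half-side
    [1 / (p.2 + 1)]. *)
Definition ratbox (p : 'rV[rat]_n.+1 * nat) : set vec :=
  box (\row_i (ratr (p.1 0 i) - p.2.+1%:R^-1)) (\row_i (ratr (p.1 0 i) + p.2.+1%:R^-1)).

Lemma open_ratbox (U : set vec) (x : vec) : open U -> U x ->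
  exists p, ratbox p x /\ ratbox p `<=` U.
Proof.
move=> oU Ux; have := oU _ Ux; rewrite -nbhs_ballE => -[e /= e0 xeU].
have /ltr_add_invr[m] : 0 < e / 2 by rewrite divr_gt0.
rewrite add0r => me; set r : R := m.+1%:R^-1 in me.
have r0 : 0 < r by rewrite invr_gt0 ltr0n.
have /choice[q qx] (i : 'I_n.+1) : exists q : rat, ratr q \in `]x 0 i - r, x 0 i + r[.
  have /rat_in_itvoo[q qi] : x 0 i - r < x 0 i + r by lra.
  by exists q.
exists (\row_i q i, m); split => [i|y hy].
  by rewrite !mxE/= -/r; have := qx i; rewrite in_itv/=; lra.
apply: xeU; apply/ballrVP => // i; have := hy i; have := qx i.
rewrite !mxE/= -/r in_itv/= ltr_norml.
by move=> /andP[? ?] /andP[? ?]; apply/andP; split; lra.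
Qed.

Lemma open_measurable_Rn (U : set vec) : open U -> measurable (U : set (Rn R n.+1)).
Proof.
(* Rational boxes are enumerated through [pickle]; an index that decodes to no box inside [U]
   contributes the empty set. *)
move=> oU; pose F k : set (Rn R n.+1) := if unpickle k is Some p then
  if `[< ratbox p `<=` U >] then ratbox p else set0 else set0.
rewrite [X in measurable X](_ : _ = \bigcup_k F k).
  apply: bigcup_measurable => k _; rewrite /F; case: unpickle => // p.
  by case: ifP => // _; exact: measurable_box.
apply/seteqP; split => [x Ux|x [k _]].
  have [p [px pU]] := open_ratbox oU Ux.
  by exists (pickle p) => //; rewrite /F pickleK; case: ifPn => // /asboolP.
by rewrite /F; case: unpickle => // p; case: ifPn => // /asboolP pU /pU.
Qed.

Lemma continuous_measurable_Rn (f : vec -> R) : continuous f ->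
  measurable_fun [set: Rn R n.+1] f.
Proof.
move=> /continuousP cf; apply: (measurability _ (measurable_realfun.RGenOInfty.measurableE R)).
move=> _ [_ [c ->] <-]; rewrite setTI; apply: open_measurable_Rn.
by apply: cf; rewrite set_itvoy; exact: open_gt.
Qed.

Lemma Cmeas_continuous (f : vec -> R[i]) : continuous (fun x => re (f x)) ->
  continuous (fun x => im (f x)) -> @Cmeas _ (Rn R n.+1) _ f.
Proof. by move=> cr ci; split; exact: continuous_measurable_Rn. Qed.

End ContinuousMeasurable.

Section FourierInversion.
Variables (R : realType) (n : nat).
Local Notation N := n.+1.
Local Notation vec := 'rV[R]_N.
Local Notation lebN := (@leb R N).
Local Notation Meas f := (@Cmeas _ (Rn R N) _ f).

Lemma dotpC (x y : vec) : dotp x y = dotp y x.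
Proof. by apply: eq_bigr => i _; rewrite mulrC. Qed.

Lemma dotpDl (x y z : vec) : dotp (x + y) z = dotp x z + dotp y z.
Proof. by rewrite -big_split; apply: eq_bigr => i _; rewrite mxE mulrDl. Qed.

Lemma dotpZl (c : R) (x y : vec) : dotp (c *: x) y = c * dotp x y.
Proof. by rewrite /dotp mulr_sumr; apply: eq_bigr => i _; rewrite mxE mulrA. Qed.

Lemma dotpNl (x y : vec) : dotp (- x) y = - dotp x y.
Proof. by rewrite -scaleN1r dotpZl mulN1r. Qed.

Lemma measurable_dotp2 : measurable_fun setT (fun z : Rn R N * Rn R N => dotp z.1 z.2).
Proof.
apply: measurable_sum => i; apply: measurable_funM.
  exact: (measurableT_comp (@measurable_coord R N i) measurable_fst).
exact: (measurableT_comp (@measurable_coord R N i) measurable_snd).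
Qed.

Lemma measurable_dotp (xi : vec) : measurable_fun setT (fun y : Rn R N => dotp y xi).
Proof.
apply: measurable_sum => i; apply: measurable_funM; first exact: measurable_coord.
exact: measurable_cst.
Qed.

Lemma measurable_dotpr (y : vec) : measurable_fun setT (fun xi : Rn R N => dotp y xi).
Proof.
rewrite (_ : (fun xi => _) = fun xi => dotp xi y); first exact: measurable_dotp.
by apply/funext => xi; exact: dotpC.
Qed.

Lemma Cmeas_wave (xi : vec) : Meas (fun y => expi (- dotp y xi)).
Proof. by apply: Cmeas_expi; apply: measurableT_comp => //; exact: measurable_dotp. Qed.

Lemma Cintg_wave (g : vec -> R[i]) (xi : vec) : Cintg lebN g ->
  Cintg lebN (fun y => g y * expi (- dotp y xi)).
Proof.
move=> gi; apply: (Cintg_bounded (M := 1)) gi; first exact: Cmeas_wave.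
by move=> x; rewrite cnorm_expi.
Qed.

Definition ftc : R := (2 * pi) `^ (- (N%:R / 2)).

Lemma FTE (g : vec -> R[i]) xi :
  FT g xi = ftc%:C * Cint lebN (fun y => g y * expi (- dotp y xi)).
Proof. by []. Qed.

Lemma pi2_gt0 : 0 < 2 * pi :> R. Proof. by rewrite mulr_gt0// pi_gt0. Qed.

Lemma ftc_gt0 : 0 < ftc. Proof. by rewrite powR_gt0// pi2_gt0. Qed.

Lemma ftc_inv : ftc * (2 * pi) `^ (N%:R / 2) = 1.
Proof. by rewrite /ftc powRN mulVf// gt_eqF// powR_gt0// pi2_gt0. Qed.

Lemma ftc_sqr : ftc * ftc * (2 * pi) ^+ N = 1.
Proof.
rewrite -powR_mulrn ?(ltW pi2_gt0)// -!powRD; last 2 first.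
- by apply/implyP => _; rewrite gt_eqF// pi2_gt0.
- by apply/implyP => _; rewrite gt_eqF// pi2_gt0.
by rewrite (_ : - _ + _ + _ = 0) ?powRr0//; field.
Qed.

Lemma Cmeas_FT (g : vec -> R[i]) : Meas g -> Meas (FT g).
Proof.
move=> mg; rewrite (_ : FT g = fun xi => ftc%:C * Cint lebN (fun y => g y * expi (- dotp y xi)))//.
apply: CmeasM; first exact: Cmeas_cst.
have := @Cmeas_Cint _ _ (Rn R N) _ R lebN (fun z : Rn R N * Rn R N => g z.2 * expi (- dotp z.2 z.1)).
apply.
apply: CmeasM; first exact: (Cmeas_transfer measurable_snd mg).
apply: Cmeas_expi; apply: measurableT_comp => //.
by under eq_fun do rewrite dotpC; exact: measurable_dotp2.
Qed.

(** Fubini for the kernel exp(- i <y, xi>), which is symmetric in its two variables and bounded by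
    1. *)
Lemma multiplication_formula (g h : vec -> R[i]) : Cintg lebN g -> Cintg lebN h ->
  Cint lebN (fun xi => FT g xi * h xi) = Cint lebN (fun y => g y * FT h y).
Proof.
move=> gi hi; pose f (z : Rn R N * Rn R N) := g z.2 * (ftc%:C * h z.1) * expi (- dotp z.2 z.1).
have fi : Cintg (lebN \x lebN)%E f.
  have hi' := CintgZ ftc%:C hi.
  apply: (@Cintg_tensor _ _ (Rn R N) (Rn R N) R lebN lebN f
    (fun x => cnorm (ftc%:C * h x)) (fun y => cnorm (g y))).
  - apply: CmeasM; first apply: CmeasM.
    + exact: (Cmeas_transfer measurable_snd (Cintg_meas gi)).
    + exact: (Cmeas_transfer measurable_fst (Cintg_meas hi')).
    + apply: Cmeas_expi; apply: measurableT_comp => //.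
      by under eq_fun do rewrite dotpC; exact: measurable_dotp2.
  - by move=> x; exact: cnorm_ge0.
  - by move=> x; exact: cnorm_ge0.
  - exact: Cintg_cnorm.
  - exact: Cintg_cnorm.
  - by move=> x y; rewrite /f !cnormM cnorm_expi mulr1 mulrC.
have := Cint_fubini_swap fi.
have -> : Cint lebN (fun x => Cint lebN (fun y => f (x, y))) =
    Cint lebN (fun xi => FT g xi * h xi).
  apply: eq_Cint => xi; rewrite FTE mulrAC -CintZ; last exact: Cintg_wave.
  by apply: eq_Cint => y; rewrite /f/=; ring.
move=> ->; apply: eq_Cint => y.
rewrite FTE -!CintZ; [|exact: CintgZ (Cintg_wave _ hi)|exact: Cintg_wave].
by apply: eq_Cint => xi; rewrite /f/= dotpC; ring.
Qed.

(** For [c > 0], the damping factor exp(- c |xi|_1) with the sum norm: it factorises over the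
    coordinates, so its transform reduces to dimension 1. *)
Definition kap (c : R) (xi : vec) : R := \prod_i lap (c * xi 0 i).

Lemma expi_sum m (F : 'I_m -> R) : expi (\sum_i F i) = \prod_i expi (F i).
Proof.
elim/big_ind2 : _ => //; first exact: expi0.
by move=> x z y w <- <-; rewrite expiD.
Qed.

Lemma real_complex_prod m (F : 'I_m -> R) : (\prod_i F i)%:C = \prod_i (F i)%:C.
Proof. exact: rmorph_prod. Qed.

Definition pois (y : vec) : R := \prod_i poisson (y 0 i).

Lemma pois_ge0 y : 0 <= pois y.
Proof. by apply: prodr_ge0 => i _; exact: poisson_ge0. Qed.

Lemma kap_waveE (y xi : vec) : (kap 1 xi)%:C * expi (- dotp xi y) =
  \prod_i ((lap (xi 0 i))%:C * expi (- (xi 0 i * y 0 i))).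
Proof.
rewrite big_split/= -expi_sum -real_complex_prod /kap /dotp sumrN.
by congr (_ %:C * _); apply: eq_bigr => i _; rewrite mul1r.
Qed.

Lemma Cintg_kap1_wave (y : vec) : Cintg lebN (fun xi => (kap 1 xi)%:C * expi (- dotp xi y)).
Proof.
under eq_fun do rewrite kap_waveE.
have [] // := @Cint_coord_prod R n (fun i t => (lap t)%:C * expi (- (t * y 0 i))).
by move=> i; exact: Cintg_lap_expi.
Qed.

Lemma Cint_kap1_wave (y : vec) :
  Cint lebN (fun xi => (kap 1 xi)%:C * expi (- dotp xi y)) = (pois y)%:C.
Proof.
under eq_Cint do rewrite kap_waveE.
have [|_ ->] := @Cint_coord_prod R n (fun i t => (lap t)%:C * expi (- (t * y 0 i))).
  by move=> i; exact: Cintg_lap_expi.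
by rewrite /pois real_complex_prod; apply: eq_bigr => i _; exact: Cint_lap_expi.
Qed.

Lemma Cintg_pois : Cintg lebN (fun y => (pois y)%:C).
Proof.
under eq_fun do rewrite /pois real_complex_prod.
have [] // := @Cint_coord_prod R n (fun i t => (poisson t)%:C).
by move=> i; exact: Cintg_poisson.
Qed.

Lemma Cint_pois : Cint lebN (fun y => (pois y)%:C) = ((2 * pi) ^+ N)%:C.
Proof.
under eq_Cint do rewrite /pois real_complex_prod.
have [|_ ->] := @Cint_coord_prod R n (fun i t => (poisson t)%:C).
  by move=> i; exact: Cintg_poisson.
under eq_bigr do rewrite Cint_poisson.
by rewrite prodr_const card_ord rmorphXn.
Qed.

Lemma integrable_pois : lebN.-integrable setT (fun y => (pois y)%:E).
Proof. by have [] := Cintg_pois. Qed.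

Lemma kap_le1 c xi : 0 <= kap c xi <= 1.
Proof.
apply: (big_ind (fun x => 0 <= x <= 1)) => [|x y /andP[x0 x1] /andP[y0 y1]|i _].
- by rewrite ler01 lexx.
- by rewrite mulr_ge0//= mulr_ile1.
- by rewrite lap_ge0 /lap -expR0 ler_expR oppr_le0 normr_ge0.
Qed.

Lemma kapE c xi : kap c xi = kap 1 (c *: xi).
Proof. by apply: eq_bigr => i _; rewrite mxE mul1r. Qed.

Lemma measurable_kap c : measurable_fun [set: Rn R N] (kap c).
Proof.
apply: measurable_prod => i _; apply: measurableT_comp; first exact: measurable_lap.
by apply: measurable_funM; [exact: measurable_cst|exact: measurable_coord].
Qed.

Lemma Cintg_kap c : 0 < c -> Cintg lebN (fun xi => (kap c xi)%:C).
Proof.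
move=> c0; have := Cintg_kap1_wave 0.
have E x : expi (- dotp x (0 : vec)) = 1.
  rewrite (_ : dotp _ _ = 0) ?oppr0 ?expi0//.
  by rewrite /dotp big1// => i _; rewrite mxE mulr0.
under eq_fun do rewrite E mulr1.
move=> /(Cint_scale c0)[+ _].
by under eq_fun do rewrite -kapE.
Qed.

Lemma FT_kap c y : 0 < c -> FT (fun xi => (kap c xi)%:C) y =
  ((c ^+ N)^-1 * ftc * pois (c^-1 *: y))%:C.
Proof.
move=> c0; have cN : c ^+ N != 0 by rewrite expf_neq0// gt_eqF.
have E x : (kap 1 (c *: x))%:C * expi (- dotp (c *: x) (c^-1 *: y)) =
    (kap c x)%:C * expi (- dotp x y).
  rewrite -kapE; congr (_ * expi (- _)); rewrite dotpZl dotpC dotpZl mulrA mulfV ?gt_eqF//.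
  by rewrite mul1r dotpC.
have := Cint_kap1_wave (c^-1 *: y).
have [_ ->] := Cint_scale c0 (Cintg_kap1_wave (c^-1 *: y)).
under eq_Cint do rewrite E.
move=> h; rewrite FTE -mulrA mulrC rmorphM/= rmorphM/= -h mulrCA mulrA.
rewrite -[in RHS]mulrA [X in _ = _ * X]mulrA -rmorphM/= mulVf// mul1r.
by rewrite mulrC.
Qed.

Definition ccvg (u : nat -> R[i]) (l : R[i]) :=
  (re (u k) @[k --> \oo] --> re l) /\ (im (u k) @[k --> \oo] --> im l).

Lemma ccvg_unique u l l' : ccvg u l -> ccvg u l' -> l = l'.
Proof.
move=> [r1 i1] [r2 i2]; apply: complex_ext.
  exact: (cvg_unique _ r1 r2).
exact: (cvg_unique _ i1 i2).
Qed.

Lemma ccvgM u v l l' : ccvg u l -> ccvg v l' -> ccvg (fun k => u k * v k) (l * l').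
Proof.
move=> [r1 i1] [r2 i2]; split.
  under eq_fun do rewrite reM; rewrite reM.
  by apply: cvgB; apply: cvgM.
under eq_fun do rewrite imM; rewrite imM.
by apply: cvgD; apply: cvgM.
Qed.

Lemma ccvg_cst l : ccvg (fun=> l) l.
Proof. by split; exact: cvg_cst. Qed.

Lemma ccvg_real (u : nat -> R) (l : R) : u @ \oo --> l -> ccvg (fun k => (u k)%:C) l%:C.
Proof. by move=> ul; split => //=; exact: cvg_cst. Qed.

Lemma kap_cvg1 (e : nat -> R) (xi : vec) : e k @[k --> \oo] --> (0 : R) ->
  kap (e k) xi @[k --> \oo] --> (1 : R).
Proof.
move=> e0; have lapi i : lap (e k * xi 0 i) @[k --> \oo] --> (1 : R).
  have h : e k * xi 0 i @[k --> \oo] --> 0 * xi 0 i by apply: cvgM => //; exact: cvg_cst.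
  have := cvg_comp _ _ h (@continuous_lap R _).
  by rewrite {2}/lap mul0r normr0 oppr0 expR0.
rewrite /kap; elim: (index_enum _) => [|i s IH].
  by under eq_fun do rewrite big_nil; exact: cvg_cst.
under eq_fun do rewrite big_cons/=.
have := cvgM (lapi i) IH; rewrite mulr1; apply.
Qed.

Lemma continuous_ray (h : vec -> R) (e : nat -> R) (y : vec) : continuous h ->
  e k @[k --> \oo] --> (0 : R) -> h (e k *: y) @[k --> \oo] --> h 0.
Proof.
move=> ch e0; have l : e k *: y @[k --> \oo] --> (0 : vec).
  by rewrite -[X in _ --> X](scale0r y); exact: cvgZr_tmp.
exact: (cvg_comp _ _ l (ch _)).
Qed.

(** The integral of [FT g] damped by [kap (e k)] equals that of [g] against the transform of the
    damping, a rescaled [pois]. A dilation moves [e k] into the argument of [g]. Both forms converge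
    by domination: the first because [FT g] is integrable, the second because [g] is bounded and
    continuous. *)
Lemma fourier_inversion0 (g : vec -> R[i]) (M : R) :
  Cintg lebN g -> Cintg lebN (FT g) -> (forall x, cnorm (g x) <= M) ->
  continuous (fun x => re (g x)) -> continuous (fun x => im (g x)) ->
  Cint lebN (FT g) = ((2 * pi) `^ (N%:R / 2))%:C * g 0.
Proof.
move=> gi Gi gM cr ci; pose e k : R := k.+1%:R^-1.
have e0 k : 0 < e k by rewrite invr_gt0 ltr0n.
have ecvg : e k @[k --> \oo] --> (0 : R) by exact: cvg_harmonic.
have M0 : 0 <= M by exact: le_trans (cnorm_ge0 (g 0)) (gM 0).
have h1 : ccvg (fun k => Cint lebN (fun xi => FT g xi * (kap (e k) xi)%:C)) (Cint lebN (FT g)).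
  have lim x : ccvg (fun k => FT g x * (kap (e k) x)%:C) (FT g x).
    rewrite -[X in ccvg _ X]mulr1; apply: ccvgM (ccvg_cst _) _.
    exact: (ccvg_real (kap_cvg1 x ecvg)).
  apply: (@Cint_dominated _ _ _ lebN _ _ (fun x => cnorm (FT g x))).
  - move=> k; apply: CmeasM; first exact: Cintg_meas Gi.
    by apply: Cmeas_real; exact: measurable_kap.
  - exact: Cintg_meas Gi.
  - by move=> x; exact: (lim x).1.
  - by move=> x; exact: (lim x).2.
  - exact: Cintg_cnorm Gi.
  - move=> k x; rewrite cnormM cnorm_real ler_piMr ?cnorm_ge0//.
    by have /andP[k0 k1] := kap_le1 (e k) x; rewrite ger0_norm.
have h2 : ccvg (fun k => Cint lebN (fun y => g (e k *: y) * (pois y)%:C))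
    (Cint lebN (fun y => g 0 * (pois y)%:C)).
  have lim x : ccvg (fun k => g (e k *: x) * (pois x)%:C) (g 0 * (pois x)%:C).
    apply: ccvgM (ccvg_cst _); split; first exact: (continuous_ray x cr ecvg).
    exact: (continuous_ray x ci ecvg).
  apply: (@Cint_dominated _ _ _ lebN _ _ (fun x => M * pois x)).
  - move=> k; apply: CmeasM; last exact: Cintg_meas Cintg_pois.
    exact: Cmeas_scale (Cintg_meas gi).
  - by apply: CmeasM; [exact: Cmeas_cst|exact: Cintg_meas Cintg_pois].
  - by move=> x; exact: (lim x).1.
  - by move=> x; exact: (lim x).2.
  - exact: (integrableZl measurableT M integrable_pois).
  - move=> k x; rewrite cnormM cnorm_real ger0_norm ?pois_ge0//.
    by rewrite ler_wpM2r ?pois_ge0.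
have E k : Cint lebN (fun xi => FT g xi * (kap (e k) xi)%:C) =
    ftc%:C * Cint lebN (fun y => g (e k *: y) * (pois y)%:C).
  rewrite multiplication_formula//; last exact: Cintg_kap.
  under eq_Cint do rewrite FT_kap//.
  have ek : (e k ^+ N) != 0 by rewrite expf_neq0// gt_eqF.
  have ei : 0 < (e k)^-1 by rewrite invr_gt0.
  have [pi' _] := Cint_scale ei Cintg_pois.
  have fi : Cintg lebN (fun y => g y * ((e k ^+ N)^-1 * ftc * pois ((e k)^-1 *: y))%:C).
    rewrite (_ : (fun y => _) =
        fun y => ((e k ^+ N)^-1 * ftc)%:C * (pois ((e k)^-1 *: y))%:C * g y).
      apply: (@Cintg_bounded _ _ _ lebN _ _ M) => //; first exact: Cintg_meas gi.
      exact: CintgZ.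
    by apply/funext => y; rewrite mulrC rmorphM.
  have [fi' ->] := Cint_scale (e0 k) fi.
  rewrite -CintZ//.
  have gpi : Cintg lebN (fun y => g (e k *: y) * (pois y)%:C).
    rewrite (_ : (fun y => _) = fun y => (pois y)%:C * g (e k *: y)).
      apply: (@Cintg_bounded _ _ _ lebN _ _ M) => //; last exact: Cintg_pois.
      exact: Cmeas_scale (Cintg_meas gi).
    by apply/funext => y; rewrite mulrC.
  rewrite -CintZ//; apply: eq_Cint => x; rewrite scalerA mulVf ?gt_eqF// scale1r.
  rewrite [LHS]mulrCA [RHS]mulrCA; congr (_ * _); rewrite -!rmorphM/=; congr _%:C.
  by rewrite !mulrA mulfV// mul1r.
have h3 := ccvgM (ccvg_cst ftc%:C) h2.
rewrite (_ : (fun k => _) = fun k => Cint lebN (fun xi => FT g xi * (kap (e k) xi)%:C)) in h3.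
  rewrite (ccvg_unique h1 h3) CintZ ?Cint_pois; last exact: Cintg_pois.
  have <- : ftc * (2 * pi) ^+ N = (2 * pi) `^ (N%:R / 2).
    apply: (@mulfI _ ftc); first by rewrite gt_eqF// ftc_gt0.
    by rewrite mulrA ftc_sqr ftc_inv.
  by rewrite rmorphM/= mulrCA mulrC.
by apply/funext => k; rewrite E.
Qed.

Lemma FT_shift (g : vec -> R[i]) (a xi : vec) : Cintg lebN g ->
  FT (fun x => g (x + a)) xi = expi (dotp a xi) * FT g xi.
Proof.
move=> gi; rewrite !FTE mulrCA; congr (_ * _).
rewrite [in RHS](Cint_shift a (Cintg_meas (Cintg_wave xi gi))).
rewrite -CintZ; last exact: (Cintg_shift a (Cintg_wave xi gi)).
apply: eq_Cint => y; rewrite mulrCA -expiD dotpDl; congr (_ * expi _); ring.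
Qed.

Lemma continuous_shift (f : vec -> R) (y : vec) :
  continuous f -> continuous (fun x : vec => f (x + y)).
Proof.
move=> cf x; apply: (@continuous_comp vec vec R (fun z : vec => z + y) f); last exact: cf.
by apply: (@cvgD R vec vec (nbhs x) _ id (fun=> y) x y); [exact: cvg_id|exact: cvg_cst].
Qed.

(** Translating [g] by [y] multiplies its transform by a character, which reduces the claim to the
    origin. *)
Lemma fourier_inversion (g : vec -> R[i]) (M : R) (y : vec) :
  Cintg lebN g -> Cintg lebN (FT g) -> (forall x, cnorm (g x) <= M) ->
  continuous (fun x => re (g x)) -> continuous (fun x => im (g x)) ->
  ftc%:C * Cint lebN (fun xi => expi (dotp y xi) * FT g xi) = g y.
Proof.
move=> gi Gi gM cr ci; pose h x := g (x + y).
have FThE : FT h = fun xi => expi (dotp y xi) * FT g xi.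
  by apply/funext => xi; rewrite FT_shift.
have := @fourier_inversion0 h M _ _ _ _ _; rewrite FThE => ->.
- by rewrite /h add0r mulrA -rmorphM/= ftc_inv mul1r.
- exact: Cintg_shift.
- under eq_fun do rewrite mulrC.
  apply: (@Cintg_bounded _ _ _ lebN _ _ 1) => //; last by move=> x; rewrite cnorm_expi.
  by apply: Cmeas_expi; exact: measurable_dotpr.
- by move=> x; exact: gM.
- exact: (@continuous_shift (fun x => re (g x))).
- exact: (@continuous_shift (fun x => im (g x))).
Qed.

(** This is the multiplication formula with conj(FT g) as second function, whose transform is
    conj(g) by inversion. *)
Lemma plancherel (g : vec -> R[i]) (M : R) :
  Cintg lebN g -> Cintg lebN (FT g) -> (forall x, cnorm (g x) <= M) ->
  continuous (fun x => re (g x)) -> continuous (fun x => im (g x)) ->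
  Cint lebN (fun xi => FT g xi * conjc (FT g xi)) =
  Cint lebN (fun y => g y * conjc (g y)).
Proof.
move=> gi Gi gM cr ci; rewrite multiplication_formula//; last exact: Cintg_conj.
apply: eq_Cint => y; congr (_ * _).
rewrite -[in RHS](fourier_inversion y gi Gi gM cr ci) conjcM conjC_real FTE.
congr (_ * _); rewrite -Cint_conj.
  by apply: eq_Cint => xi; rewrite [RHS]conjcM conj_expi mulrC dotpC.
under eq_fun do rewrite mulrC.
apply: (@Cintg_bounded _ _ _ lebN _ _ 1) => //; last by move=> x; rewrite cnorm_expi.
by apply: Cmeas_expi; exact: measurable_dotpr.
Qed.

End FourierInversion.

(** * Decay of Fourier transforms *)

Section DerivativeChains.
Variables (R : realType) (n : nat) (i : 'I_n.+1).
Local Notation N := n.+1.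
Local Notation vec := 'rV[R]_N.
Local Notation e_i := (@ei R N i).

Lemma is_derive_diffquot (V : normedModType R) (u : V -> R) (x v : V) (d : R)
    (e : nat -> R) : is_derive x v u d -> (forall k, e k != 0) ->
  e k @[k --> \oo] --> (0 : R) ->
  (e k)^-1 * (u (x + e k *: v) - u x) @[k --> \oo] --> d.
Proof.
move=> [du <-] e0 ecvg.
have h : e k @[k --> \oo] --> (0 : R)^'.
  move=> A [r /= r0 rA]; suff : \forall k \near \oo, A (e k) by [].
  have : \forall k \near \oo, ball (0 : R) r (e k) := ecvg _ (nbhsx_ballx (0 : R) r r0).
  by apply: filterS => k ek; apply: rA; [exact: ek|exact: e0].
have H := cvg_comp _ _ h du.
rewrite (_ : (fun k => _) = (fun t : R => t^-1 *: ((u \o shift x) (t *: v) - u x)) \o e).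
  exact: H.
by apply/funext => k /=; rewrite [e k *: v + x]addrC.
Qed.

Lemma is_derive_line (u : vec -> R) (x v : vec) (t d : R) :
  is_derive (x + t *: v) v u d -> is_derive t 1 (fun r => u (x + r *: v)) d.
Proof.
move=> [du dE].
have E : (fun h : R => h^-1 *: (((fun r => u (x + r *: v)) \o shift t) (h *: 1) - u (x + t *: v)))
    = (fun h : R => h^-1 *: ((u \o shift (x + t *: v)) (h *: v) - u (x + t *: v))).
  apply/funext => h /=; congr (_ *: (u _ - _)).
  by rewrite [h *: 1]mulr1 scalerDl addrCA.
by split; [rewrite /derivable E|rewrite /derive E].
Qed.

Lemma is_derive_shift (u : vec -> R) (x a v : vec) (d : R) :
  is_derive (x + a) v u d -> is_derive x v (fun y => u (y + a)) d.
Proof.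
move=> [du dE].
have E : (fun h : R => h^-1 *: (((fun y => u (y + a)) \o shift x) (h *: v) - u (x + a)))
    = (fun h : R => h^-1 *: ((u \o shift (x + a)) (h *: v) - u (x + a))).
  by apply/funext => h /=; rewrite addrA.
by split; [rewrite /derivable E|rewrite /derive E].
Qed.

Definition cderiv (f f' : vec -> R[i]) := forall x,
  is_derive x e_i (fun y => re (f y)) (re (f' x)) /\
  is_derive x e_i (fun y => im (f y)) (im (f' x)).

Definition ccont (f : vec -> R[i]) :=
  continuous (fun x => re (f x)) /\ continuous (fun x => im (f x)).

Lemma ccontM f g : ccont f -> ccont g -> ccont (fun x => f x * g x).
Proof.
move=> [f1 f2] [g1 g2]; split.
  under eq_fun do rewrite reM.
  by move=> x; exact: (cvgB (cvgM (f1 x) (g1 x)) (cvgM (f2 x) (g2 x))).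
under eq_fun do rewrite imM.
by move=> x; exact: (cvgD (cvgM (f1 x) (g2 x)) (cvgM (f2 x) (g1 x))).
Qed.

Lemma ccontD f g : ccont f -> ccont g -> ccont (fun x => f x + g x).
Proof.
move=> [f1 f2] [g1 g2]; split.
  under eq_fun do rewrite reD.
  by move=> x; exact: (cvgD (f1 x) (g1 x)).
under eq_fun do rewrite imD.
by move=> x; exact: (cvgD (f2 x) (g2 x)).
Qed.

Lemma ccont_conj f : ccont f -> ccont (fun x => conjc (f x)).
Proof.
move=> [f1 f2]; split; first by under eq_fun do rewrite re_conj.
by under eq_fun do rewrite im_conj; move=> x; exact: (cvgN (f2 x)).
Qed.

Lemma ccont_shift f a : ccont f -> ccont (fun x => f (x + a)).
Proof.
move=> [f1 f2]; split; first exact: (@continuous_shift _ _ (fun x => re (f x))).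
exact: (@continuous_shift _ _ (fun x => im (f x))).
Qed.

Lemma ccont_meas f : ccont f -> @Cmeas _ (Rn R N) _ f.
Proof. by move=> [f1 f2]; exact: Cmeas_continuous. Qed.

Lemma cderivM f f' g g' : cderiv f f' -> cderiv g g' ->
  cderiv (fun x => f x * g x) (fun x => f' x * g x + f x * g' x).
Proof.
move=> ff gg x; have [f1 f2] := ff x; have [g1 g2] := gg x; split.
  under eq_fun do rewrite reM; rewrite reD !reM.
  have H := is_deriveB (is_deriveM f1 g1) (is_deriveM f2 g2).
  by apply: (is_derive_eq H); rewrite /GRing.scale/=; ring.
under eq_fun do rewrite imM; rewrite imD !imM.
have H := is_deriveD (is_deriveM f1 g2) (is_deriveM f2 g1).
by apply: (is_derive_eq H); rewrite /GRing.scale/=; ring.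
Qed.

Lemma cderivD f f' g g' : cderiv f f' -> cderiv g g' ->
  cderiv (fun x => f x + g x) (fun x => f' x + g' x).
Proof.
move=> ff gg x; have [f1 f2] := ff x; have [g1 g2] := gg x; split.
  by under eq_fun do rewrite reD; rewrite reD; exact: is_deriveD.
by under eq_fun do rewrite imD; rewrite imD; exact: is_deriveD.
Qed.

Lemma cderiv_conj f f' : cderiv f f' -> cderiv (fun x => conjc (f x)) (fun x => conjc (f' x)).
Proof.
move=> ff x; have [f1 f2] := ff x; split.
  by under eq_fun do rewrite re_conj; rewrite re_conj.
by under eq_fun do rewrite im_conj; rewrite im_conj; exact: is_deriveN.
Qed.

Lemma cderiv_shift f f' a : cderiv f f' -> cderiv (fun x => f (x + a)) (fun x => f' (x + a)).
Proof.
move=> ff x; have [f1 f2] := ff (x + a).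
split; first exact: (@is_derive_shift (fun y => re (f y))).
exact: (@is_derive_shift (fun y => im (f y))).
Qed.

(** [G k] is the k-th derivative of [G 0] in the one fixed direction [e_i]. Sequences are used so
    that products, conjugates and translates keep track of all orders at once. *)
Definition cchain (G : nat -> vec -> R[i]) :=
  forall k, ccont (G k) /\ cderiv (G k) (G k.+1).

Lemma cchain_conj G : cchain G -> cchain (fun k x => conjc (G k x)).
Proof. by move=> cG k; have [c d] := cG k; split; [exact: ccont_conj|exact: cderiv_conj]. Qed.

Lemma cchain_shift G a : cchain G -> cchain (fun k x => G k (x + a)).
Proof. by move=> cG k; have [c d] := cG k; split; [exact: ccont_shift|exact: cderiv_shift]. Qed.

(* The [p]-th derivative of [G m * H l], without binomial sums. *)
Fixpoint leibniz (G H : nat -> vec -> R[i]) (p m l : nat) (x : vec) : R[i] :=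
  if p is q.+1 then leibniz G H q m.+1 l x + leibniz G H q m l.+1 x
  else G m x * H l x.

Lemma leibniz_cderiv G H : cchain G -> cchain H -> forall p m l,
  ccont (leibniz G H p m l) /\ cderiv (leibniz G H p m l) (leibniz G H p.+1 m l).
Proof.
move=> cG cH; elim=> [|p IH] m l.
  have [c1 d1] := cG m; have [c2 d2] := cH l.
  by split; [exact: ccontM|exact: cderivM].
have [c1 d1] := IH m.+1 l; have [c2 d2] := IH m l.+1.
by split; [exact: ccontD|exact: cderivD].
Qed.

Lemma cchain_leibniz G H : cchain G -> cchain H -> cchain (fun p => leibniz G H p 0 0).
Proof. by move=> cG cH k; exact: leibniz_cderiv. Qed.

Lemma cnorm_triangle (z w : R[i]) : cnorm (z + w) <= cnorm z + cnorm w.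
Proof. by rewrite !cnormE; exact: (@le_normcD R z w). Qed.

Lemma fact_mul_le m l : (m`! * l`! <= (m + l)`!)%N.
Proof. by rewrite -(bin_fact (leq_addr l m)) addKn leq_pmull// bin_gt0 leq_addr. Qed.

(** Each step of [leibniz] splits a term into two whose bounds gain a factor [a] or [b], which adds
    up to the power of [a + b]. The total order p + m + l is the same in both branches, and at the
    leaves m! l! <= (m + l)! merges the factorials. *)
Lemma leibniz_bound G H (s a b A C : R) (w : vec -> R) : 0 <= s -> 0 <= a -> 0 <= b ->
  0 <= A -> 0 <= C -> (forall x, 0 <= w x) ->
  (forall k x, cnorm (G k x) <= A * a ^+ k * (k`!%:R `^ s)) ->
  (forall k x, cnorm (H k x) <= C * b ^+ k * (k`!%:R `^ s) * w x) ->
  forall p m l x, cnorm (leibniz G H p m l x) <=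
    A * C * (a + b) ^+ p * a ^+ m * b ^+ l * ((p + m + l)`!%:R `^ s) * w x.
Proof.
move=> s0 a0 b0 A0 C0 w0 GA HC; elim=> [|p IH] m l x /=.
  rewrite cnormM expr0 mulr1 add0n.
  apply: (le_trans (ler_pM (cnorm_ge0 _) (cnorm_ge0 _) (GA m x) (HC l x))).
  rewrite [X in X <= _](_ : _ = A * C * a ^+ m * b ^+ l * (m`!%:R `^ s * l`!%:R `^ s) * w x); last ring.
  rewrite ler_wpM2r// ler_wpM2l ?mulr_ge0 ?exprn_ge0//.
  by rewrite -powRM// -natrM ge0_ler_powR ?nnegrE// ler_nat fact_mul_le.
apply: (le_trans (cnorm_triangle _ _)).
apply: (le_trans (lerD (IH m.+1 l x) (IH m l.+1 x))).
rewrite !addnS addSn !exprS -!addSn.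
by rewrite le_eqVlt; apply/orP; left; apply/eqP; rewrite !addSn; ring.
Qed.

End DerivativeChains.

(** * Derivatives under the Fourier transform *)

Section FourierDecay.
Variables (R : realType) (n : nat).
Local Notation N := n.+1.
Local Notation vec := 'rV[R]_N.
Local Notation lebN := (@leb R N).
Implicit Types (i : 'I_N) (a x y xi : vec).

Lemma poisson_shift (t c : R) : `|c| <= 1 -> poisson (t + c) <= 3 * poisson t.
Proof.
move=> c1; rewrite /poisson mulrCA ler_pM2l// ler_pdivlMr ?onesqr_gt0//.
rewrite mulrC ler_pdivrMr ?onesqr_gt0//.
have : c ^+ 2 <= 1 by rewrite -(real_normK (num_real c)) exprn_ile1.
(* The goal amounts to 2 + 2 t^2 + 6 t c + 3 c^2 >= 0, and the left side is (2 t + 3 c)^2 / 2 + 2 -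
   3 c^2 / 2. *)
have := sqr_ge0 (2 * t + 3 * c); have := sqr_ge0 t; nra.
Qed.

Lemma pois_shift i x (c : R) : `|c| <= 1 -> pois (x + c *: @ei R N i) <= 3 * pois x.
Proof.
move=> c1; rewrite /pois (bigD1 i)//= [X in 3 * X](bigD1 i)//= mulrA.
rewrite !mxE !eqxx mulr1; apply: ler_pM; first exact: poisson_ge0.
- by apply: prodr_ge0 => j _; exact: poisson_ge0.
- exact: poisson_shift.
- rewrite le_eqVlt; apply/orP; left; apply/eqP; apply: eq_bigr => j ji.
  by rewrite !mxE (negbTE ji) andbF mulr0 addr0.
Qed.

(** By the mean value theorem the quotient is a derivative at distance at most 1, where the weight
    has grown by a factor 3 at most. A single integrable function thus dominates all quotients with
    step in ]0, 1]. *)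
Lemma diffquot_bound i (u u' : vec -> R) (A : R) a :
  (forall x, is_derive x (@ei R N i) u (u' x)) ->
  (forall x, `|u' x| <= A * pois (x - a)) ->
  forall x (h : R), 0 < h <= 1 ->
  `|h^-1 * (u (x + h *: @ei R N i) - u x)| <= 3 * A * pois (x - a).
Proof.
move=> du bu x h /andP[h0 h1]; pose v := @ei R N i.
have A0 : 0 <= A.
  have p0 : 0 < pois (x - a) by apply: prodr_gt0 => j _; rewrite divr_gt0// onesqr_gt0.
  by rewrite -(pmulr_lge0 _ p0) (le_trans _ (bu x)).
have dphi (t : R) : is_derive t (1 : R) (fun r : R => u (x + r *: v)) (u' (x + t *: v)).
  exact: is_derive_line.
have cphi : {within `[0, h], continuous (fun r : R => u (x + r *: v))}.
  apply: continuous_subspaceT => t; apply: differentiable_continuous.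
  by apply/derivable1_diffP; have [] := dphi t.
have [c] := @MVT R _ (fun t => u' (x + t *: v)) 0 h h0 (fun t _ => dphi t) cphi.
rewrite in_itv/= => /andP[c0 ch]; rewrite scale0r addr0 subr0 => ->.
rewrite mulrC mulfK ?gt_eqF//; apply: (le_trans (bu _)).
rewrite [3 * A]mulrC -mulrA ler_wpM2l//.
rewrite -addrA [_ *: v - a]addrC addrA; apply: pois_shift.
by rewrite ger0_norm ?(ltW c0)// (le_trans (ltW ch)).
Qed.

Lemma integrable_pois_shift a : lebN.-integrable setT (fun x => (pois (x - a))%:E).
Proof. by have [] := Cintg_shift (- a) (@Cintg_pois R n). Qed.

Lemma integral_pois_shift a :
  fine (\int[lebN]_x (pois (x - a))%:E)%E = (2 * pi) ^+ N.
Proof.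
have := @Cint_pois R n.
rewrite (Cint_shift (- a)); last exact: Cintg_meas (@Cintg_pois R n).
by rewrite Cint_real => /(congr1 (@complex.Re R)).
Qed.

Lemma Cintg_pois_dom (f : vec -> R[i]) (A : R) a : @Cmeas _ (Rn R N) _ f ->
  (forall x, cnorm (f x) <= A * pois (x - a)) -> Cintg lebN f.
Proof.
move=> mf fA; apply: (@Cintg_dom _ _ _ lebN _ (fun x => A * pois (x - a)) mf fA).
exact: (integrableZl measurableT A (integrable_pois_shift a)).
Qed.

Lemma FT_pois_bound (f : vec -> R[i]) (A : R) a xi : @Cmeas _ (Rn R N) _ f ->
  (forall x, cnorm (f x) <= A * pois (x - a)) ->
  cnorm (FT f xi) <= ftc R n * (2 * (2 * pi) ^+ N) * A.
Proof.
move=> mf fA; rewrite FTE cnormM cnorm_real ger0_norm ?(ltW (ftc_gt0 R n))//.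
rewrite -mulrA ler_wpM2l ?(ltW (ftc_gt0 R n))//.
have ip := integrable_pois_shift a.
apply: (le_trans (@cnorm_Cint_le _ _ _ lebN _ (fun x => A * pois (x - a)) _ _ _)).
- by apply: CmeasM => //; exact: Cmeas_wave.
- by move=> x; rewrite cnormM cnorm_expi mulr1.
- exact: (integrableZl measurableT A ip).
under eq_integral do rewrite EFinM.
rewrite integralZl// fineM//; last exact: integrable_fin_num.
by rewrite integral_pois_shift -mulrA ler_pM2l// mulrC.
Qed.

Lemma FTZ (c : R[i]) (f : vec -> R[i]) xi : Cintg lebN f ->
  FT (fun x => c * f x) xi = c * FT f xi.
Proof.
move=> fi; rewrite !FTE mulrCA; congr (_ * _).
rewrite -CintZ; last exact: Cintg_wave.
by apply: eq_Cint => x; rewrite mulrA.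
Qed.

Lemma FTD (f g : vec -> R[i]) xi : Cintg lebN f -> Cintg lebN g ->
  FT (fun x => f x + g x) xi = FT f xi + FT g xi.
Proof.
move=> fi gi; rewrite !FTE -mulrDr -CintD; [|exact: Cintg_wave..].
by congr (_ * _); apply: eq_Cint => x; rewrite mulrDl.
Qed.

Lemma dotp_ei i (c : R) xi : dotp (c *: @ei R N i) xi = c * xi 0 i.
Proof.
rewrite dotpZl; congr (_ * _); rewrite /dotp (bigD1 i)//= mxE !eqxx mul1r big1 ?addr0//.
by move=> j ji; rewrite mxE (negbTE ji) andbF mul0r.
Qed.

Lemma expi_diffquot (e : nat -> R) (w : R) : (forall k, e k != 0) ->
  e k @[k --> \oo] --> (0 : R) ->
  ccvg (fun k => (e k)^-1%:C * (expi (e k * w) + -1)) (Complex 0 w).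
Proof.
move=> e0 ecvg.
have lin : is_derive (0 : R) 1 (fun t : R => t * w) w.
  have := is_deriveM (is_derive_id (0 : R) 1) (is_derive_cst w (0 : R) 1).
  by move=> /is_derive_eq; apply; rewrite /GRing.scale/= mulr0 add0r mulr1.
have dc : is_derive (0 : R) 1 (fun t => cos (t * w)) 0.
  have := @is_derive1_comp R cos (fun t => t * w) 0 _ _ (is_derive_cos (0 * w)) lin.
  by move=> /is_derive_eq; apply; rewrite mul0r sin0 oppr0 /GRing.scale/= mul0r.
have ds : is_derive (0 : R) 1 (fun t => sin (t * w)) w.
  have := @is_derive1_comp R sin (fun t => t * w) 0 _ _ (is_derive_sin (0 * w)) lin.
  by move=> /is_derive_eq; apply; rewrite mul0r cos0 /GRing.scale/= mul1r.
have hc := is_derive_diffquot dc e0 ecvg; have hs := is_derive_diffquot ds e0 ecvg.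
split.
  rewrite (_ : (fun k => _) = fun k => (e k)^-1 * (cos ((0 + e k *: 1) * w) - cos (0 * w))).
    exact: hc.
  by apply/funext => k; rewrite /= mul0r subr0 add0r [_ *: 1]mulr1 mul0r cos0.
rewrite (_ : (fun k => _) = fun k => (e k)^-1 * (sin ((0 + e k *: 1) * w) - sin (0 * w))).
  exact: hs.
by apply/funext => k; rewrite /= mul0r addr0 add0r [_ *: 1]mulr1 mul0r sin0 oppr0.
Qed.

(* Instead of integrating by parts, pass to the limit in the Fourier transform
   of the difference quotients, which is explicit by translation invariance. *)
Lemma FT_cderiv i (f f' : vec -> R[i]) (A : R) a xi : Cintg lebN f -> ccont f -> ccont f' ->
  cderiv i f f' -> (forall x, cnorm (f' x) <= A * pois (x - a)) ->
  FT f' xi = Complex 0 (xi 0 i) * FT f xi.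
Proof.
move=> fi cf cf' df bf; pose e k : R := k.+1%:R^-1; pose v := @ei R N i.
have e0 k : 0 < e k by rewrite invr_gt0 ltr0n.
have e1 k : 0 < e k <= 1 by rewrite e0 invf_le1// ler1n.
have en k : e k != 0 by rewrite gt_eqF.
have ecvg : e k @[k --> \oo] --> (0 : R) by exact: cvg_harmonic.
pose q k y := (e k)^-1%:C * (f (y + e k *: v) + -1 * f y).
have E k : FT (q k) xi = (e k)^-1%:C * (expi (e k * xi 0 i) + -1) * FT f xi.
  rewrite /q FTZ; last by apply: CintgD; [exact: Cintg_shift|exact: CintgZ].
  rewrite FTD; [|exact: Cintg_shift|exact: CintgZ].
  by rewrite FT_shift// FTZ// dotp_ei -mulrDl mulrA.
have h1 := ccvgM (expi_diffquot (xi 0 i) en ecvg) (ccvg_cst (FT f xi)).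
have qf y : ccvg (fun k => q k y) (f' y).
  have [d1 d2] := df y; have q1 := is_derive_diffquot d1 en ecvg.
  have q2 := is_derive_diffquot d2 en ecvg; split.
    rewrite (_ : (fun k => _) = fun k => (e k)^-1 * (re (f (y + e k *: v)) - re (f y))) //.
    apply/funext => k; rewrite /q reM reD reM /=; ring.
  rewrite (_ : (fun k => _) = fun k => (e k)^-1 * (im (f (y + e k *: v)) - im (f y))) //.
  apply/funext => k; rewrite /q imM imD imM /=; ring.
have h2 : ccvg (fun k => FT (q k) xi) (FT f' xi).
  apply: ccvgM (ccvg_cst _) _.
  have lim y : ccvg (fun k => q k y * expi (- dotp y xi)) (f' y * expi (- dotp y xi)).
    by apply: ccvgM (qf y) (ccvg_cst _).
  apply: (@Cint_dominated _ _ _ lebN _ _ (fun x => 3 * A * pois (x - a) + 3 * A * pois (x - a))).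
  - move=> k; apply: CmeasM; last exact: Cmeas_wave.
    apply: CmeasM; first exact: Cmeas_cst.
    apply: CmeasD; first exact: Cmeas_shift (ccont_meas cf).
    by apply: CmeasM; [exact: Cmeas_cst|exact: ccont_meas].
  - by apply: CmeasM; [exact: ccont_meas|exact: Cmeas_wave].
  - by move=> x; exact: (lim x).1.
  - by move=> x; exact: (lim x).2.
  - have ip := integrableZl measurableT (3 * A) (integrable_pois_shift a).
    exact: (integrableD measurableT ip ip).
  - move=> k x; rewrite cnormM cnorm_expi mulr1 (le_trans (cnorm_le _))//.
    apply: lerD.
      have := @diffquot_bound i (fun y => re (f y)) (fun y => re (f' y)) A a
        (fun y => (df y).1) (fun y => le_trans (norm_re_le _) (bf y)) x (e k) (e1 k).
      by apply: le_trans; rewrite le_eqVlt; apply/orP; left; apply/eqP; congr `|_|;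
        rewrite /q reM reD reM /=; ring.
    have := @diffquot_bound i (fun y => im (f y)) (fun y => im (f' y)) A a
      (fun y => (df y).2) (fun y => le_trans (norm_im_le _) (bf y)) x (e k) (e1 k).
    by apply: le_trans; rewrite le_eqVlt; apply/orP; left; apply/eqP; congr `|_|;
      rewrite /q imM imD imM /=; ring.
apply: (ccvg_unique h2); rewrite (_ : (fun k => _) =
  fun k => (e k)^-1%:C * (expi (e k * xi 0 i) + -1) * FT f xi)//.
by apply/funext.
Qed.

Lemma FT_cchain i (G : nat -> vec -> R[i]) (A : nat -> R) a xi : cchain i G ->
  (forall k x, cnorm (G k x) <= A k * pois (x - a)) ->
  forall k, FT (G k) xi = (Complex 0 (xi 0 i)) ^+ k * FT (G 0%N) xi.
Proof.
move=> cG GA; elim=> [|k IH]; first by rewrite expr0 mul1r.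
have [ck dk] := cG k; have [ck' _] := cG k.+1.
rewrite (@FT_cderiv i (G k) (G k.+1) (A k.+1) a)//; first by rewrite IH exprS mulrA.
by apply: (@Cintg_pois_dom _ (A k) a) => //; exact: ccont_meas.
Qed.

Lemma cnorm_exp (z : R[i]) k : cnorm (z ^+ k) = cnorm z ^+ k.
Proof.
elim: k => [|k IH]; first by rewrite !expr0 (cnorm_real 1) normr1.
by rewrite !exprS cnormM IH.
Qed.

(** The k-th derivative has transform (i xi_i)^k FT(G 0), and its bound by [pois] controls that
    transform uniformly in [xi]. *)
Lemma FT_cchain_decay i (G : nat -> vec -> R[i]) (A : nat -> R) a xi : cchain i G ->
  (forall k x, cnorm (G k x) <= A k * pois (x - a)) ->
  forall k, `|xi 0 i| ^+ k * cnorm (FT (G 0%N) xi) <= ftc R n * (2 * (2 * pi) ^+ N) * A k.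
Proof.
move=> cG GA k; have [ck _] := cG k.
rewrite (_ : `|xi 0 i| = cnorm (Complex 0 (xi 0 i))); last first.
  by rewrite /cnorm/= expr0n add0r sqrtr_sqr.
rewrite -cnorm_exp -cnormM -(FT_cchain xi cG GA).
by apply: FT_pois_bound (GA k); exact: ccont_meas.
Qed.

End FourierDecay.

(** * From factorial bounds to exponential decay *)

Section ExponentialDecay.
Variable R : realType.
Implicit Types s H C u v : R.

(** Minimising k!^s (H/u)^k over k suggests decay like exp(- s (u/H)^(1/s)); the factor 1/2 is the
    price of the geometric series used in [factorial_decay]. *)
Definition rate s H := s / 2 * (H^-1 `^ s^-1).

(** With X = (u/H)^(1/s) and q = (v/C)^(1/s), the s-th root of the hypothesis reads q X^k <= k!.
    Dividing by 2^k k! and summing over k gives q exp(X/2) <= 2, and the power s of this is the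
    claim. No optimal k and no Stirling estimate are required. *)
Lemma factorial_decay s H C u v : 0 < s -> 0 < H -> 0 <= u -> 0 <= v ->
  (forall k, u ^+ k * v <= C * H ^+ k * (k`!%:R `^ s)) ->
  v <= C * 2 `^ s * expR (- (rate s H * u `^ s^-1)).
Proof.
move=> s0 H0 u0 v0 bound; have vC : v <= C.
  by have := bound 0%N; rewrite !expr0 mul1r mulr1 fact0 powR1 mulr1.
have C0 : 0 <= C by exact: le_trans vC.
have [->|vn0] := eqVneq v 0.
  by rewrite mulr_ge0 ?expR_ge0// mulr_ge0// powR_ge0.
have vp : 0 < v by rewrite lt_neqAle eq_sym vn0.
have Cp : 0 < C by exact: lt_le_trans vC.
have sn0 : s != 0 by rewrite gt_eqF.
pose X := (u / H) `^ s^-1; pose q := (v / C) `^ s^-1.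
have uH : 0 <= u / H by rewrite divr_ge0// ltW.
have vC0 : 0 <= v / C by rewrite divr_ge0.
have q0 : 0 < q by rewrite powR_gt0// divr_gt0.
have X0 : 0 <= X by exact: powR_ge0.
have qX k : q * X ^+ k <= k`!%:R.
  have : ((u / H) ^+ k * (v / C)) `^ s^-1 <= (k`!%:R `^ s) `^ s^-1.
    rewrite ge0_ler_powR ?nnegrE ?powR_ge0 ?mulr_ge0 ?exprn_ge0 ?invr_ge0 ?(ltW s0)
      ?(ltW H0) ?(ltW Cp)//.
    rewrite (_ : _ * _ = u ^+ k * v / (C * H ^+ k)); last first.
      by rewrite expr_div_n; field; rewrite !gt_eqF ?exprn_gt0.
    rewrite ler_pdivrMr ?mulr_gt0 ?exprn_gt0//.
    by rewrite [leRHS]mulrC; exact: bound.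
  rewrite -powRrM mulfV// powRr1// powRM ?exprn_ge0//.
  by rewrite -powR_mulrn// powRAC powR_mulrn ?powR_ge0// mulrC.
have half k : \sum_(0 <= j < k) (2^-1 : R) ^+ j <= 2.
  have -> : \sum_(0 <= j < k) (2^-1 : R) ^+ j = 2 - 2 * 2^-1 ^+ k.
    elim: k => [|k IH]; first by rewrite big_nil expr0 mulr1 subrr.
    by rewrite big_nat_recr//= IH exprS; field.
  by rewrite gerBl mulr_ge0// exprn_ge0// invr_ge0.
have qe : expR (X / 2) <= 2 / q.
  apply: limr_le; first exact: is_cvg_series_exp_coeff.
  apply: nearW => m; rewrite ler_pdivlMr// mulr_suml.
  apply: le_trans (half m); apply: ler_sum => j _.
  rewrite /exp_coeff/= expr_div_n mulrAC ler_pdivrMr ?ltr0n ?fact_gt0//.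
  by rewrite mulrAC mulrC -exprVn ler_wpM2l ?exprn_ge0 ?invr_ge0// mulrC.
have qle : q <= 2 * expR (- (X / 2)).
  by rewrite expRN ler_pdivlMr ?expR_gt0// mulrC -ler_pdivlMr.
have : q `^ s <= (2 * expR (- (X / 2))) `^ s.
  by rewrite ge0_ler_powR ?nnegrE ?mulr_ge0 ?expR_ge0 ?(ltW s0) ?(ltW q0).
rewrite /q -powRrM mulVf// powRr1// ler_pdivrMr// powRM ?expR_ge0//.
rewrite -expRM => /le_trans; apply.
rewrite mulrC mulrA ler_wpM2l ?mulr_ge0 ?powR_ge0// ler_expR /rate /X.
rewrite powRM ?invr_ge0 ?(ltW H0)//.
by rewrite le_eqVlt; apply/orP; left; apply/eqP; field.
Qed.

End ExponentialDecay.

(** * Domination by [pois] *)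

Section PoissonWeight.
Variables (R : realType) (n : nat).
Local Notation N := n.+1.
Local Notation vec := 'rV[R]_N.

Lemma mxnorm_coord (x : vec) : exists i, `|x| = `|x 0 i|.
Proof.
have [x0|/mx_norm_neq0[[j i] /= E]] := eqVneq (mx_norm x) 0.
  by exists ord0; rewrite (mx_norm_eq0 x0) normr0 mxE normr0.
by exists i; rewrite (ord1 j) in E.
Qed.

Lemma coord_le_mxnorm (x : vec) i : `|x 0 i| <= `|x|.
Proof.
rewrite [leRHS]mx_normrE.
exact: (le_bigmax _ (fun ij : 'I_1 * 'I_N => `|x ij.1 ij.2|) (0, i)).
Qed.

(** Each factor of [pois y] is at least 1 / max(1, |y|^2), so bounds of orders 0 and 2N in |y|
    suffice. *)
Lemma le_pois (v A : R) (y : vec) : 0 <= v -> v <= A -> v * `|y| ^+ (2 * N) <= A ->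
  v <= A * pois y.
Proof.
move=> v0 vA vyA.
have A0 : 0 <= A by exact: le_trans vA.
have p i : (Num.max 1 (`|y| ^+ 2))^-1 <= poisson (y 0 i).
  have y0 := sqr_ge0 `|y|.
  rewrite /poisson ler_pdivlMr ?onesqr_gt0// mulrC ler_pdivrMr ?lt_max ?ltr01//.
  have : y 0 i ^+ 2 <= `|y| ^+ 2.
    by rewrite -(real_normK (num_real (y 0 i))) ler_pXn2r ?nnegrE// coord_le_mxnorm.
  have : 1 <= Num.max 1 (`|y| ^+ 2) by rewrite le_max lexx.
  have : `|y| ^+ 2 <= Num.max 1 (`|y| ^+ 2) by rewrite le_max lexx orbT.
  lra.
have P : (Num.max 1 (`|y| ^+ 2)) ^- N <= pois y.
  rewrite -exprVn -[X in _ ^+ X](card_ord N) -prodr_const.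
  apply: ler_prod => i _; rewrite p andbT invr_ge0.
  by rewrite le_max ler01.
apply: le_trans (ler_wpM2l A0 P).
rewrite ler_pdivlMr ?exprn_gt0 ?lt_max ?ltr01//.
rewrite /Num.max; case: ifP => _; first by rewrite -exprM.
by rewrite expr1n mulr1.
Qed.

Lemma expR_le_pois (d s : R) : 0 < d -> 0 < s ->
  exists A, forall y : vec, expR (- (d * `|y| `^ s^-1)) <= A * pois y.
Proof.
(* [m >= 2 N s] makes u^m at least |y|^(2N) when |y| > 1, and exp(- d u) (d u)^m <= m! provides the
   constant. *)
move=> d0 s0; pose m := (Num.truncn ((2 * N)%:R * s)).+1.
have ms : (2 * N)%:R * s <= m%:R by rewrite ltW// truncnS_gt.
exists (1 + m`!%:R / d ^+ m) => y; have B0 : 0 <= m`!%:R / d ^+ m :> R.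
  by rewrite divr_ge0// exprn_ge0// ltW.
set u := `|y| `^ s^-1; have u0 : 0 <= u by exact: powR_ge0.
have e1 : expR (- (d * u)) <= 1 by rewrite expR_le1 oppr_le0 mulr_ge0// ltW.
have em : expR (- (d * u)) * u ^+ m <= m`!%:R / d ^+ m.
  rewrite expRN mulrC ler_pdivrMr ?expR_gt0// mulrAC ler_pdivlMr ?exprn_gt0//.
  rewrite -exprMn mulrC -ler_pdivrMl ?ltr0n ?fact_gt0// mulrC [u * d]mulrC.
  apply: le_trans (expR_ge1Dxn m.-1 _); last by rewrite mulr_ge0// ltW.
  by rewrite [leLHS]mulrC; apply: ler_wpDl; [exact: ler01|exact: lexx].
apply: le_pois; first exact: expR_ge0.
  by rewrite (le_trans e1)// lerDl.
have [y1|y1] := leP `|y| 1.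
  apply: (@le_trans _ _ 1); last by rewrite lerDl.
  by rewrite mulr_ile1 ?expR_ge0 ?exprn_ge0// exprn_ile1.
apply: (@le_trans _ _ (expR (- (d * u)) * u ^+ m)); last first.
  by rewrite (le_trans em)// lerDr.
rewrite ler_wpM2l ?expR_ge0//.
have u1 : 1 <= u.
  apply: (@le_trans _ _ (1 `^ s^-1)); first by rewrite powR1.
  by rewrite ge0_ler_powR ?nnegrE ?invr_ge0 ?(ltW s0) ?(ltW y1).
rewrite -[leRHS]powR_mulrn//; apply: le_trans (ler_powR u1 ms).
by rewrite /u -powRrM mulrC -mulrA mulfV ?gt_eqF// mulr1 powR_mulrn.
Qed.

End PoissonWeight.

(** * Multi-index bounds along one coordinate *)

Section PurePowers.
Variables (R : realType) (n : nat).
Local Notation N := n.+1.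
Local Notation vec := 'rV[R]_N.
Implicit Types (i : 'I_N) (g : vec -> R[i]).

Definition pure (i : 'I_N) (k : nat) : 'I_N -> nat := fun j => if j == i then k else 0%N.

Lemma mseq_pure i k : mseq (pure i k) = nseq k i.
Proof.
suff aux (s : seq 'I_N) : uniq s ->
    flatten [seq nseq (pure i k j) j | j <- s] = if i \in s then nseq k i else [::].
  by rewrite /mseq aux ?enum_uniq// mem_enum.
elim: s => //= j s IH /andP[js us]; rewrite IH// inE /pure.
by move: js; case: eqVneq => [->|//] js; rewrite (negbTE js) cats0.
Qed.

Lemma mabs_pure i k : mabs (pure i k) = k.
Proof.
rewrite /mabs (bigD1 i)//= /pure eqxx big1 ?addn0// => j ji.
by rewrite (negbTE ji).
Qed.

Lemma mfact_pure i k : mfact (pure i k) = k`!.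
Proof.
rewrite /mfact (bigD1 i)//= /pure eqxx big1 ?muln1// => j ji.
by rewrite (negbTE ji).
Qed.

Lemma mpow_pure (x : vec) i k : mpow x (pure i k) = x 0 i ^+ k.
Proof.
rewrite /mpow (bigD1 i)//= /pure eqxx big1 ?mulr1// => j ji.
by rewrite (negbTE ji) expr0.
Qed.

Definition derivs i g (k : nat) (x : vec) : R[i] :=
  Complex (pd (nseq k i) (fun y => re (g y)) x) (pd (nseq k i) (fun y => im (g y)) x).

Lemma cpd_pure i k g : cpd (pure i k) g = derivs i g k.
Proof. by rewrite /cpd /derivs mseq_pure. Qed.

Lemma derivs0 i g : derivs i g 0 = g.
Proof. by apply/funext => x; rewrite /derivs/=; case: (g x). Qed.

Lemma cchain_derivs i g : smooth g -> cchain i (derivs i g).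
Proof.
move=> [sr si] k; have [cr dr] := sr (nseq k i); have [ci di] := si (nseq k i).
split; first by split.
by move=> x; split; [exact: (derivableP (dr i x))|exact: (derivableP (di i x))].
Qed.

(** The decay bound is used with powers 0 and 2N of the largest coordinate of [y], as [le_pois]
    demands; the constant collects these two cases. *)
Lemma derivs_GS_bound s t h C g : 0 < h -> GS_bound s t h C g ->
  forall i k y, cnorm (derivs i g k y) <=
    C * (1 + h ^+ (2 * N) * ((2 * N)`!%:R `^ t)) * h ^+ k * (k`!%:R `^ s) * pois y.
Proof.
move=> h0 gB i k y.
have B j m : `|y 0 j| ^+ m * cnorm (derivs i g k y) <=
    C * h ^+ (k + m) * (k`!%:R `^ s) * (m`!%:R `^ t).
  have := gB (pure i k) (pure j m) y.
  by rewrite cnormM cnorm_real cpd_pure mpow_pure normrX !mabs_pure !mfact_pure.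
set D := h ^+ (2 * N) * _; have D0 : 0 <= D by rewrite mulr_ge0 ?powR_ge0 ?exprn_ge0 ?ltW.
have v0 := cnorm_ge0 (derivs i g k y).
have vC : cnorm (derivs i g k y) <= C * h ^+ k * (k`!%:R `^ s).
  by have := B ord0 0%N; rewrite expr0 mul1r addn0 fact0 powR1 mulr1.
have E0 : 0 <= C * h ^+ k * (k`!%:R `^ s) by exact: le_trans vC.
rewrite (_ : C * (1 + D) * h ^+ k * (k`!%:R `^ s) =
  C * h ^+ k * (k`!%:R `^ s) * (1 + D)); last ring.
apply: le_pois => //.
  by rewrite (le_trans vC)// ler_peMr// lerDl.
have [j ->] := mxnorm_coord y.
rewrite mulrC; apply: (le_trans (B j (2 * N)%N)).
rewrite exprD mulrDr mulr1 (_ : C * _ * _ * _ = C * h ^+ k * (k`!%:R `^ s) * D).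
  by rewrite lerDr.
by rewrite /D; ring.
Qed.

Lemma pd_periodic (u : vec -> R) (l : vec) : (forall x, u (x + l) = u x) ->
  forall s x, pd s u (x + l) = pd s u x.
Proof.
move=> ul; elim=> [//|j s IH] x /=.
rewrite /derive.
suff -> : (fun h : R => h^-1 *: ((pd s u \o shift (x + l)) (h *: @ei R N j) - pd s u (x + l)))
  = (fun h : R => h^-1 *: ((pd s u \o shift x) (h *: @ei R N j) - pd s u x)) by [].
by apply/funext => h /=; rewrite addrA !IH.
Qed.

End PurePowers.

Section Parallelepiped.
Variables (R : realType) (n : nat).
Local Notation N := n.+1.
Local Notation vec := 'rV[R]_N.
Variable B : 'M[R]_N.

Definition intvec (t : vec) : vec := \row_i (Num.floor (t 0 i))%:~R.

Lemma intvec_intvecs (t : vec) : intvecs (intvec t).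
Proof.
exists (\row_i Num.floor (t 0 i)) => //.
by apply/rowP => i; rewrite !mxE.
Qed.

Lemma para_lattice_decomp (y : vec) : B \in unitmx ->
  exists e l, [/\ para B e, lattice B l & y = e + l].
Proof.
move=> uB; have yE := mulmxKV uB y; move: (y *m invmx B) yE => t yE.
exists ((t - intvec t) *m B), (intvec t *m B); split.
- exists (t - intvec t) => // i; rewrite !mxE subr_ge0 floor_le/= lerBlDr addrC.
  by have /ltW := floorD1_gt (t 0 i); rewrite intrD.
- by exists (intvec t) => //; exact: intvec_intvecs.
- by rewrite -mulmxDl subrK.
Qed.

Lemma mulmx_mxnorm_le : exists2 K : R, 0 < K & forall x : vec, `|x *m B| <= K * `|x|.
Proof.
pose K := \sum_i \sum_j `|B i j|; exists (1 + K).
  by rewrite ltr_pwDl// sumr_ge0// => i _; rewrite sumr_ge0.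
move=> x; have [j ->] := mxnorm_coord (x *m B).
rewrite mxE (le_trans (ler_norm_sum _ _ _))//.
rewrite mulrDl mul1r (@le_trans _ _ (K * `|x|)) ?lerDr// mulr_suml.
apply: ler_sum => i _; rewrite normrM mulrC ler_pM ?coord_le_mxnorm//.
by rewrite (bigD1 j)//= lerDl sumr_ge0.
Qed.

Lemma continuous_mulmxr : continuous (fun x : vec => x *m B).
Proof.
have [K K0 hK] := mulmx_mxnorm_le.
move=> x U /nbhs_ballP[e /= e0 eU].
have r0 : 0 < K^-1 * e by rewrite mulr_gt0 ?invr_gt0.
have /nbhs_ballP := nbhsx_ballx x _ r0.
move=> [r /= r1 rU]; apply/nbhs_ballP; exists r => //= z /rU xz; apply: eU.
move: xz; rewrite -!ball_normE/= => xz.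
by rewrite -mulmxBl (le_lt_trans (hK _))// -ltr_pdivlMl.
Qed.

Lemma para_compact : compact (para B).
Proof.
apply: continuous_compact; first exact/continuous_subspaceT/continuous_mulmxr.
have := @rV_compact R N (fun=> `[0, 1]%classic) (fun=> @segment_compact R 0 1).
by congr compact; apply/seteqP; split => x h i; have := h i; rewrite /= in_itv.
Qed.

(** The Gevrey bound is local, but the derivatives are periodic too, so its constants on the compact
    cell hold everywhere. *)
Lemma derivs_Gev_bound s h C (g : vec -> R[i]) :
  B \in unitmx -> Defs.periodic B g -> Gev_bound s h C (para B) g ->
  forall (i : 'I_N) k y, cnorm (derivs i g k y) <= C * h ^+ k * (k`!%:R `^ s).
Proof.
move=> uB pg gB i k y; have [e [l [pe ll ->]]] := para_lattice_decomp y uB.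
have -> : derivs i g k (e + l) = derivs i g k e.
  by congr Complex; apply: pd_periodic => x; rewrite pg.
by have := gB (pure i k) e pe; rewrite cpd_pure mabs_pure mfact_pure.
Qed.

End Parallelepiped.

Section Decay.
Variables (R : realType) (n : nat).
Local Notation N := n.+1.
Local Notation vec := 'rV[R]_N.

(** The factor (2 pi)^N is the integral of [pois], the factor 2 before it comes from the crude
    modulus bound on complex integrals, and 2^s from [factorial_decay]. *)
Definition decayc (s : R) : R := ftc R n * (2 * (2 * pi) ^+ N) * 2 `^ s.

Lemma FT_exp_decay (s H A : R) (a : vec) (g : vec -> R[i]) : 0 < s -> 0 < H ->
  (forall i, exists G, [/\ cchain i G, G 0%N = g & forall k x,
    cnorm (G k x) <= A * H ^+ k * (k`!%:R `^ s) * pois (x - a)]) ->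
  forall xi, cnorm (FT g xi) <= decayc s * A * expR (- (rate s H * `|xi| `^ s^-1)).
Proof.
(* The direction of differentiation depends on [xi]: it is a coordinate where the sup norm is
   attained. *)
move=> s0 H0 hG xi; have [i ->] := mxnorm_coord xi.
have [G [cG <- GA]] := hG i.
rewrite /decayc -!mulrA [2 `^ s * _]mulrCA [in leRHS]mulrA mulrCA !mulrA.
rewrite (_ : _ * _ * _ * _ = ftc R n * (2 * (2 * pi) ^+ N) * A * 2 `^ s *
  expR (- (rate s H * `|xi 0 i| `^ s^-1))); last by ring.
apply: factorial_decay => //; first exact: cnorm_ge0.
move=> k; have := FT_cchain_decay (A := fun k => A * H ^+ k * (k`!%:R `^ s)) xi cG GA k.
by rewrite !mulrA.
Qed.

(** Uniformity in [x] holds because the window only brings in the translated weight [pois (y - x)],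
    whose integral does not depend on [x]. The Leibniz rule adds the derivative constants [a] and
    [b]. *)
Lemma windowed_decay (s a b A C : R) (psi phi : vec -> R[i]) :
  0 < s -> 0 < a -> 0 < b -> 0 <= A -> 0 <= C -> smooth psi -> smooth phi ->
  (forall i k x, cnorm (derivs i psi k x) <= A * a ^+ k * (k`!%:R `^ s)) ->
  (forall i k x, cnorm (derivs i phi k x) <= C * b ^+ k * (k`!%:R `^ s) * pois x) ->
  forall x xi, cnorm (stft phi psi x xi) <=
    decayc s * (A * C) * expR (- (rate s (a + b) * `|xi| `^ s^-1)).
Proof.
move=> s0 a0 b0 A0 C0 spsi sphi Apsi Cphi x xi.
apply: (@FT_exp_decay s (a + b) (A * C) x) => //; first by rewrite addr_gt0.
move=> i; exists (fun p => leibniz (derivs i psi)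
  (fun k y => conjc (derivs i phi k (y - x))) p 0%N 0%N); split.
- apply: cchain_leibniz; first exact: cchain_derivs.
  exact: (cchain_shift (- x) (cchain_conj (cchain_derivs i sphi))).
- apply/funext => y.
  by rewrite -[LHS]/(derivs i psi 0 y * conjc (derivs i phi 0 (y - x))) !derivs0.
- have Cc k y : cnorm (conjc (derivs i phi k (y - x))) <=
      C * b ^+ k * (k`!%:R `^ s) * pois (y - x) by rewrite cnorm_conj.
  move=> p y; have := leibniz_bound (ltW s0) (ltW a0) (ltW b0) A0 C0
    (fun y => pois_ge0 (y - x)) (Apsi i) Cc p 0 0 y.
  by rewrite !expr0 !mulr1 !addn0.
Qed.

End Decay.

(** * Lattices and periodic functions *)

Section LatticeEnumeration.
Variables (R : realType) (n : nat).
Local Notation N := n.+1.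
Local Notation vec := 'rV[R]_N.
Variable B : 'M[R]_N.
Hypothesis uB : B \in unitmx.

Lemma lattice_enum : exists L : nat -> vec, set_bij [set: nat] (lattice B) L.
Proof.
pose f (z : 'rV[int]_N) : vec := map_mx (fun z : int => z%:~R) z *m B.
have fI : injective f.
  move=> z w /(congr1 (mulmx^~ (invmx B))); rewrite !mulmxK// => /matrixP zw.
  by apply/matrixP => i j; have := zw i j; rewrite !mxE => /intr_inj.
have latE : lattice B = f @` setT.
  apply/seteqP; split => [_ [_ [z _ <-] <-]|_ [z _ <-]]; first by exists z.
  by exists (map_mx (fun z : int => z%:~R) z) => //; exists z.
have h : (lattice B #= [set: nat])%card.
  rewrite latE; apply: eq_card_nat.
    exact: sub_countable (card_image_le _ _) (countableP _).
  move=> fin; have := infinite_nat; apply.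
  (* The multiples of (1, ..., 1) embed the naturals, so the lattice is infinite in positive
     dimension. *)
  have inj2 : injective (fun k : nat => f (const_mx k%:Z)).
    by move=> k l /fI/matrixP/(_ 0 0); rewrite !mxE => -[].
  apply: (@sub_finite_set _ _ ((fun k : nat => f (const_mx k%:Z)) @^-1` (f @` setT))).
    by move=> k _ /=; exists (const_mx k%:Z).
  by apply: finite_preimage => // k l _ _; exact: inj2.
have /card_esym/card_set_bijP[L LP] := h.
by exists L.
Qed.

Lemma lattice_opp (l : vec) : lattice B l -> lattice B (- l).
Proof.
move=> [_ [z _ <-] <-]; exists (map_mx (fun z : int => z%:~R) (- z)).
  by exists (- z).
rewrite (_ : map_mx _ _ = - map_mx (fun z : int => z%:~R) z) ?mulNmx//.
by apply/matrixP => i j; rewrite !mxE rmorphN.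
Qed.

Lemma set_bij_lattice_opp (L : nat -> vec) : set_bij [set: nat] (lattice B) L ->
  set_bij [set: nat] (lattice B) (fun k => - L k).
Proof.
move=> [Lf Li Ls]; split.
- by move=> k _; apply: lattice_opp; exact: Lf.
- by move=> k l k_ l_ /oppr_inj; exact: Li.
- by move=> l /lattice_opp/Ls[k _ kl]; exists k => //; rewrite kl opprK.
Qed.

(** Half-open, so that its lattice translates partition the space exactly, which those of the closed
    [para] do not. *)
Definition cell : set vec := [set y | forall i, 0 <= (y *m invmx B) 0 i < 1].

Lemma cell_uniq (L : nat -> vec) : set_bij [set: nat] (lattice B) L ->
  forall y, exists k0, forall k, cell (y + L k) <-> k = k0.
Proof.
move=> [Lf Li Ls] y; move tE : (y *m invmx B) => t.
have /Ls[k0 _ k0E] : lattice B (- (intvec t *m B)).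
  by apply: lattice_opp; exists (intvec t) => //; exact: intvec_intvecs.
exists k0 => k; split => [yk|->]; last first.
  move=> i; rewrite k0E mulmxBl mulmxK// tE !mxE subr_ge0 floor_le/= ltrBlDr.
  by have := floorD1_gt (t 0 i); rewrite intrD addrC.
apply: Li; rewrite ?inE// k0E; have [_ [z _ <-] zE] := Lf k I.
rewrite -zE -mulNmx; congr (_ *m _); apply/rowP => i.
have := yk i; rewrite -zE mulmxDl mulmxK// tE !mxE => h.
have : Num.floor (t 0 i) = - z 0 i by apply: floor_def; rewrite intrD rmorphN/=; lra.
by move=> ->; rewrite rmorphN opprK.
Qed.

End LatticeEnumeration.

(** * Tiling the space by lattice translates of the cell *)

Section Tiling.
Variables (R : realType) (n : nat).
Local Notation N := n.+1.
Local Notation vec := 'rV[R]_N.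
Local Notation lebN := (@leb R N).
Variable B : 'M[R]_N.
Hypothesis uB : B \in unitmx.
Variable L : nat -> vec.
Hypothesis LB : set_bij [set: nat] (lattice B) L.
Local Notation cell := (cell B : set (Rn R N)).
Local Notation para := (para B : set (Rn R N)).

Lemma measurable_mulmx_coord (M : 'M[R]_N) i :
  measurable_fun [set: Rn R N] (fun y => (y *m M) 0 i).
Proof.
under eq_fun do rewrite mxE.
apply: measurable_sum => j; apply: measurable_funM; first exact: measurable_coord.
exact: measurable_cst.
Qed.

Lemma measurable_coord_itv (M : 'M[R]_N) (I : interval R) :
  measurable ([set y | forall i, (y *m M) 0 i \in I] : set (Rn R N)).
Proof.
rewrite [X in measurable X](_ : _ =
    \bigcap_(i in [set: 'I_N]) ((fun y : Rn R N => (y *m M) 0 i) @^-1` [set` I])).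
  apply: fin_bigcap_measurable => // i _.
  by rewrite -[X in measurable X]setTI; exact: measurable_mulmx_coord.
apply/seteqP; split => y h; first by move=> i _; exact: h.
by move=> i; exact: h.
Qed.

Lemma paraE : para = [set y | forall i, (y *m invmx B) 0 i \in `[0, 1]].
Proof.
apply/seteqP; split => [_ [t h <-] i|y h]; first by rewrite mulmxK// in_itv/=; exact: h.
by exists (y *m invmx B); [move=> i; have := h i; rewrite in_itv|rewrite mulmxKV].
Qed.

Lemma measurable_para : measurable para.
Proof. by rewrite paraE; exact: measurable_coord_itv. Qed.

Lemma cellE : cell = [set y | forall i, (y *m invmx B) 0 i \in `[0, 1[].
Proof. by apply/seteqP; split => y h i; have := h i; rewrite in_itv. Qed.

Lemma measurable_cell : measurable cell.
Proof. by rewrite cellE; exact: measurable_coord_itv. Qed.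

Lemma cell_sub_para : cell `<=` para.
Proof.
rewrite paraE => y h i; have /andP[h0 h1] := h i.
by rewrite in_itv/= h0 ltW.
Qed.

Lemma para_bounded : exists2 K, 0 < K & forall y, para y -> `|y| <= K.
Proof.
have [K K0 hK] := mulmx_mxnorm_le B; exists K => // _ [t h <-].
rewrite (le_trans (hK t))// ger_pMr//; have [i ->] := mxnorm_coord t.
by have /andP[t0 t1] := h i; rewrite ger0_norm.
Qed.

Lemma leb_para_lty : (lebN para < +oo)%E.
Proof.
have [K K0 hK] := para_bounded.
apply: (@le_lt_trans _ _ (boxvol (const_mx (- K) : vec) (const_mx K))%:E); last exact: ltry.
apply: leb_le_box => y /hK yK i; rewrite !mxE -ler_norml.
exact: le_trans (coord_le_mxnorm y i) yK.
Qed.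

Lemma measurable_indic_cell_shift (a : vec) :
  measurable_fun [set: Rn R N] (fun x : Rn R N => \1_cell (x + a) : R).
Proof.
apply: (measurableT_comp (measurable_indic measurable_cell) (measurable_vecD a)).
Qed.

Lemma tile_sum y : (\sum_(k <oo) (\1_cell (y + L k) : R)%:E = 1)%E.
Proof.
have [k0 k0P] := cell_uniq uB LB y.
rewrite nneseries_esumT; last by move=> k; rewrite lee_fin.
rewrite (eq_esum (b := fun k => if k \in [set k0] then 1%E else 0%E)).
  by rewrite -esum_mkcond esum_set1.
move=> k _; rewrite indicE.
have [->|kk0] := eqVneq k k0.
  by rewrite mem_set ?mem_set//; exact/k0P.
rewrite memNset => [|/k0P kE]; last by rewrite kE eqxx in kk0.
by rewrite memNset// => kE; rewrite kE eqxx in kk0.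
Qed.

End Tiling.

Lemma ge0_integralZ d (T : measurableType d) (R : realType)
    (mu : {measure set T -> \bar R}) (k : R) (g : T -> R) :
  0 <= k -> measurable_fun setT g -> (forall x, 0 <= g x) ->
  (\int[mu]_x (k * g x)%:E = k%:E * \int[mu]_x (g x)%:E)%E.
Proof.
move=> k0 mg g0; under eq_integral do rewrite EFinM.
rewrite ge0_integralZl//; first exact/measurable_EFinP.
by move=> x _; rewrite lee_fin.
Qed.

Section TilingIntegral.
Variables (R : realType) (n : nat).
Local Notation N := n.+1.
Local Notation vec := 'rV[R]_N.
Local Notation lebN := (@leb R N).
Variable B : 'M[R]_N.
Hypothesis uB : B \in unitmx.
Variable L : nat -> vec.
Hypothesis LB : set_bij [set: nat] (lattice B) L.
Local Notation cell := (cell B : set (Rn R N)).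
Local Notation para := (para B : set (Rn R N)).
Implicit Type g : Rn R N -> R.

Lemma tile_integral g : measurable_fun setT g -> (forall x, 0 <= g x) ->
  (\int[lebN]_x (g x)%:E = \sum_(k <oo) \int[lebN]_x (\1_cell x * g (x + L k)%R)%:E)%E.
Proof.
(* Tiling by the opposite vectors makes the substitution [x + L k] return the cell to its place and
   put the translation into [g]. *)
move=> mg g0; have LB' := set_bij_lattice_opp LB.
transitivity (\int[lebN]_x (\sum_(k <oo) (\1_cell (x - L k) * g x)%:E))%E.
  apply: eq_integral => x _; rewrite -[LHS]mule1 -(tile_sum uB LB' x).
  rewrite -nneseriesZl; last by move=> k _; rewrite lee_fin.
  by apply: eq_eseriesr => k _; rewrite -EFinM mulrC.
have mk k : measurable_fun setT (fun x : Rn R N => (\1_cell (x - L k) * g x)%:E).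
  apply/measurable_EFinP; apply: measurable_funM => //.
  exact: measurable_indic_cell_shift.
rewrite integral_nneseries//; last by move=> k x _; rewrite lee_fin mulr_ge0.
apply: eq_eseriesr => k _; rewrite (integral_leb_shift (L k) (mk k)).
by apply: eq_integral => x _; rewrite addrK.
Qed.

(** A substitution moves the shift [z] from [g] to the cell. The moved cell is tiled by the original
    one; periodicity removes the lattice vectors from [g], and the remaining indicators sum to 1. *)
Lemma integral_cell_periodic g (z : vec) : measurable_fun setT g -> (forall x, 0 <= g x) ->
  (forall x l, lattice B l -> g (x + l) = g x) ->
  (\int[lebN]_x (\1_cell x * g (x + z)%R)%:E = \int[lebN]_x (\1_cell x * g x)%:E)%E.
Proof.
move=> mg g0 pg.
have mz : measurable_fun setT (fun x : Rn R N => \1_cell (x - z) * g x).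
  by apply: measurable_funM => //; exact: measurable_indic_cell_shift.
have mk k : measurable_fun setT (fun x : Rn R N => (\1_cell x * (\1_cell (x - z + L k) * g x))%:E).
  apply/measurable_EFinP; apply: measurable_funM; first exact: measurable_indic (measurable_cell _).
  apply: measurable_funM => //; rewrite (_ : (fun x => _) = fun x => \1_cell (x + (L k - z))).
    exact: measurable_indic_cell_shift.
  by apply/funext => x; rewrite addrAC addrA.
transitivity (\int[lebN]_x (\1_cell (x - z) * g x)%:E)%E.
  rewrite [RHS](integral_leb_shift z); last exact/measurable_EFinP.
  by apply: eq_integral => x _; rewrite addrK.
rewrite tile_integral//; last by move=> x; rewrite mulr_ge0.
transitivity (\int[lebN]_x \sum_(k <oo) (\1_cell x * (\1_cell (x - z + L k) * g x))%:E)%E.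
  rewrite integral_nneseries//; last by move=> k x _; rewrite lee_fin !mulr_ge0.
  apply: eq_eseriesr => k _; apply: eq_integral => x _.
  have [Lf _ _] := LB; rewrite (pg _ _ (Lf k I)) -addrA [L k - z]addrC addrA.
  by [].
apply: eq_integral => x _.
rewrite (eq_eseriesr (g := fun k => (\1_cell x * g x)%:E * (\1_cell (x - z + L k))%:E)%E).
  rewrite nneseriesZl; last by move=> k _; rewrite lee_fin.
  by rewrite tile_sum// mule1.
by move=> k _; rewrite -EFinM mulrA mulrAC.
Qed.

Lemma integral_leb_setT_gt0 : (\int[lebN]_x (1 : R)%:E != 0)%E.
Proof.
rewrite integral_cst// mul1e; apply/eqP => E.
have : (lebN (box (0%R : vec) (const_mx 1%R)) <= lebN setT)%E by apply: le_leb.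
rewrite E leb_box lee_fin /boxvol big1 ?ler10//.
by move=> i _; rewrite !mxE subr0 (max_idPl _).
Qed.

(** A null cell would make the whole space null by tiling. This replaces a computation of the
    measure by a determinant. *)
Lemma integral_cell_gt0 : (0 < \int[lebN]_x (\1_cell x : R)%:E)%E.
Proof.
rewrite lt0e integral_ge0 ?andbT; last by move=> x _; rewrite lee_fin.
apply/eqP => E; have /eqP := integral_leb_setT_gt0; apply.
rewrite (tile_integral (g := fun=> 1))//.
rewrite eseries0// => k _ _; rewrite -[RHS]E.
by apply: eq_integral => x _; rewrite mulr1.
Qed.

Lemma pois_comparable (M : R) : exists2 C, 0 <= C & forall x y : vec, `|y| <= M ->
  pois x <= C * pois (y + x).
Proof.
(* In each coordinate, 1 + (x + y)^2 <= 1 + 2 x^2 + 2 M^2 <= (2 + 2 M^2)(1 + x^2). *)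
exists ((2 + 2 * M ^+ 2) ^+ N); first by rewrite exprn_ge0// addr_ge0// mulr_ge0// sqr_ge0.
move=> x y yM; rewrite -{1}(card_ord N) -prodr_const -big_split/=.
apply: ler_prod => i _; rewrite poisson_ge0/= !mxE /poisson.
rewrite mulrCA ler_pM2l// ler_pdivlMr ?onesqr_gt0// mulrC ler_pdivrMr ?onesqr_gt0//.
have : y 0 i ^+ 2 <= M ^+ 2.
  rewrite -(real_normK (num_real (y 0 i))) lerXn2r ?nnegrE//.
    by rewrite (le_trans _ yM).
  exact: le_trans (coord_le_mxnorm y i) yM.
have := sqr_ge0 (y 0 i - x 0 i); have := sqr_ge0 (x 0 i); have := sqr_ge0 M.
nra.
Qed.

(** An integral test: on the cell translated by [L k] the weight is comparable with its value at
    [L k], so the sum times the measure of the cell is bounded by a constant times the integral of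
    [pois]. *)
Lemma lattice_pois_summable : (\sum_(k <oo) (pois (L k))%:E < +oo)%E.
Proof.
have [K K0 hK] := para_bounded B; have [C C0 hC] := pois_comparable K.
set I := (\int[lebN]_x (\1_cell x : R)%:E)%E.
have I0 : (0 < I)%E := integral_cell_gt0.
have mi : measurable_fun setT (fun x : Rn R N => (\1_cell x : R)%:E).
  by apply/measurable_EFinP; exact: measurable_indic (measurable_cell _).
have ip : (\int[lebN]_x (pois x)%:E < +oo)%E.
  have := integrable_fin_num measurableT (@integrable_pois R n).
  by rewrite ge0_fin_numE// integral_ge0// => x _; rewrite lee_fin pois_ge0.
have mp : measurable_fun setT (fun x : Rn R N => pois x).
  by have /measurable_int/measurable_EFinP := @integrable_pois R n.
have h : (\sum_(k <oo) (pois (L k))%:E * I <= C%:E * \int[lebN]_x (pois x)%:E)%E.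
  rewrite (tile_integral mp); last by move=> x; exact: pois_ge0.
  rewrite -nneseriesZl; last first.
    by move=> k _; apply: integral_ge0 => x _; rewrite lee_fin mulr_ge0// pois_ge0.
  apply: lee_nneseries => [k _ _|k _]; first by rewrite mule_ge0 ?lee_fin ?pois_ge0// ltW.
  have mc : measurable_fun [set: Rn R N] (\1_cell : Rn R N -> R).
    exact: measurable_indic (measurable_cell _).
  have mcp : measurable_fun [set: Rn R N] (fun x : Rn R N => (\1_cell x : R) * pois (x + L k)).
    by apply: measurable_funM => //; exact: (measurableT_comp mp (measurable_vecD (L k))).
  have cp0 (x : Rn R N) : 0 <= (\1_cell x : R) * pois (x + L k) by rewrite mulr_ge0// pois_ge0.
  rewrite -(ge0_integralZ lebN (pois_ge0 (L k)) mc)//.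
  rewrite -(ge0_integralZ lebN C0 mcp cp0).
  have m1 : measurable_fun [set: Rn R N] (fun x => (pois (L k) * (\1_cell x : R))%:E).
    apply/measurable_EFinP; apply: measurable_funM; first exact: measurable_cst.
    exact: measurable_indic (measurable_cell _).
  have m2 : measurable_fun [set: Rn R N] (fun x : Rn R N => (C * ((\1_cell x : R) * pois (x + L k)))%:E).
    apply/measurable_EFinP; apply: measurable_funM; first exact: measurable_cst.
    apply: measurable_funM; first exact: measurable_indic (measurable_cell _).
    exact: (measurableT_comp mp (measurable_vecD (L k))).
  apply: ge0_le_integral => //.
  - by move=> x _; rewrite lee_fin mulr_ge0// pois_ge0.
  - move=> x _; rewrite lee_fin indicE; case: (boolP (x \in cell)) => xc; last by rewrite mul0r !mulr0.
    rewrite mulr1 mul1r; apply: hC; apply: hK; apply: cell_sub_para => //.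
    by move: xc; rewrite inE.
have Ifin : I \is a fin_num.
  rewrite ge0_fin_numE ?(ltW I0)//; rewrite /I integral_indic ?setIT//; last exact: measurable_cell.
  apply: le_lt_trans (leb_para_lty B); apply: le_leb; exact: cell_sub_para.
rewrite ltey; apply/eqP => E; move: h.
under eq_eseriesr do rewrite muleC -(fineK Ifin).
rewrite nneseriesZl; last by move=> k _; rewrite lee_fin pois_ge0.
rewrite E gt0_muley ?fineK// => h.
have := lt_le_trans (ltry (C * fine (\int[lebN]_x (pois x)%:E)%E)) h.
by rewrite EFinM fineK ?ltxx// ge0_fin_numE// integral_ge0// => x _; rewrite lee_fin pois_ge0.
Qed.

End TilingIntegral.

(** * Closed cell, half-open cell and periodic integrands *)

Section ParaPeriodic.
Variables (R : realType) (n : nat).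
Local Notation N := n.+1.
Local Notation vec := 'rV[R]_N.
Local Notation lebN := (@leb R N).
Variable B : 'M[R]_N.
Hypothesis uB : B \in unitmx.
Local Notation cell := (cell B : set (Rn R N)).
Local Notation para := (para B : set (Rn R N)).
Implicit Type g : Rn R N -> R.

Lemma leb_cell_lty : (lebN cell < +oo)%E.
Proof. by apply: le_lt_trans (leb_para_lty B); apply: le_leb; exact: cell_sub_para. Qed.

(* The closed cell lies in every dilate [r cell], [r > 1]; hence its boundary is null. *)
Lemma leb_para_scale (r : R) : 1 < r -> (lebN para <= (r ^+ N)%:E * lebN cell)%E.
Proof.
move=> r1; have r0 : 0 < r by exact: lt_trans r1.
have mc : measurable_fun [set: Rn R N] (\1_cell : Rn R N -> R).
  exact: measurable_indic (measurable_cell _).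
have mr : measurable_fun [set: Rn R N] (fun x : Rn R N => (\1_cell (r^-1 *: x) : R)%:E).
  by apply/measurable_EFinP; exact: (measurableT_comp mc (@measurable_vecZ R N r^-1)).
have mp := measurable_para uB.
have -> : lebN para = (\int[lebN]_x (\1_para x : R)%:E)%E.
  by rewrite integral_indic// setIT.
have -> : lebN cell = (\int[lebN]_x (\1_cell x : R)%:E)%E.
  by rewrite integral_indic ?setIT//; exact: measurable_cell.
apply: (@le_trans _ _ (\int[lebN]_x (\1_cell (r^-1 *: x) : R)%:E)%E).
  apply: ge0_le_integral => //.
  - by apply/measurable_EFinP; exact: measurable_indic.
  - move=> x _; rewrite lee_fin !indicE; case: (boolP (x \in para)) => // xp.
    rewrite mem_set// => i; move: xp; rewrite inE (paraE uB) => /(_ i).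
    rewrite in_itv/= => /andP[h0 h1].
    rewrite -scalemxAl [X in _ <= X < _]mxE mulr_ge0 ?invr_ge0 ?(ltW r0)//=.
    by rewrite mulrC ltr_pdivrMr// mul1r (le_lt_trans h1).
rewrite (integral_leb_scale r0 mr)//.
by under eq_integral do rewrite scalerA mulVf ?gt_eqF// scale1r.
Qed.

Lemma leb_para_cell : lebN para = lebN cell.
Proof.
apply/eqP; rewrite eq_le; apply/andP; split; last by apply: le_leb; exact: cell_sub_para.
have pf : lebN para \is a fin_num by rewrite ge0_fin_numE ?leb_para_lty// leb_ge0.
have cf : lebN cell \is a fin_num by rewrite ge0_fin_numE ?leb_cell_lty// leb_ge0.
rewrite -(fineK pf) -(fineK cf) lee_fin; set p := fine _; set c := fine _.
(* The dilation factors 1 + 1/(k + 1) decrease to 1. *)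
have h (k : nat) : p <= (1 + k.+1%:R^-1) ^+ N * c.
  have r1 : 1 < 1 + k.+1%:R^-1 :> R by rewrite ltrDl invr_gt0 ltr0n.
  by have := leb_para_scale r1; rewrite -(fineK pf) -(fineK cf) -EFinM lee_fin.
have lim : (1 + (k.+1%:R^-1 : R)) ^+ N * c @[k --> \oo] --> (1 + 0) ^+ N * c.
  apply: cvgM; last exact: cvg_cst.
  have l : 1 + (k.+1%:R^-1 : R) @[k --> \oo] --> (1 + 0 : R).
    by apply: cvgD; [exact: cvg_cst|exact: cvg_harmonic].
  exact: (cvg_comp _ _ l (@exprn_continuous R N _)).
rewrite addr0 expr1n mul1r in lim.
by apply: (cvgr_to_ge lim); apply: nearW => k; exact: h.
Qed.

Lemma leb_para_setD_cell : lebN (para `\` cell) = 0%E.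
Proof.
rewrite measureD//; [|exact: measurable_para|exact: measurable_cell|exact: leb_para_lty].
rewrite (_ : para `&` cell = cell); last by apply/setIidPr; exact: cell_sub_para.
by rewrite [X in (X - _)%E]leb_para_cell subee// ge0_fin_numE ?leb_cell_lty// leb_ge0.
Qed.

Lemma integral_para_cell g : measurable_fun setT g ->
  (\int[lebN]_x (\1_para x * g x)%:E = \int[lebN]_x (\1_cell x * g x)%:E)%E.
Proof.
move=> mg; apply: ae_eq_integral => //.
- apply/measurable_EFinP; apply: measurable_funM => //.
  exact: measurable_indic (measurable_para uB).
- apply/measurable_EFinP; apply: measurable_funM => //.
  exact: measurable_indic (measurable_cell _).
exists (para `\` cell); split.
- by apply: measurableD; [exact: measurable_para|exact: measurable_cell].
- exact: leb_para_setD_cell.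
move=> x /= h; apply: contrapT => nx; apply: h => _.
rewrite !indicE; case: (boolP (x \in cell)) => [|/negP xc].
  by rewrite inE => xc; rewrite mem_set//; exact: cell_sub_para.
rewrite memNset// => xp; apply: nx; split => // xc'; apply: xc; exact: mem_set.
Qed.

Lemma integral_para_periodic g (z : vec) : measurable_fun setT g ->
  (forall x l, lattice B l -> g (x + l) = g x) ->
  (\int[lebN]_x (\1_para x * g (x + z)%R)%:E = \int[lebN]_x (\1_para x * g x)%:E)%E.
Proof.
move=> mg pg; have [L LB] := lattice_enum uB.
have ge0 (h : Rn R N -> R) : measurable_fun setT h -> (forall x, 0 <= h x) ->
    (forall x l, lattice B l -> h (x + l) = h x) ->
    (\int[lebN]_x (\1_para x * h (x + z)%R)%:E = \int[lebN]_x (\1_para x * h x)%:E)%E.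
  move=> mh h0 ph; rewrite !integral_para_cell ?(integral_cell_periodic uB LB)//.
  exact: (measurableT_comp mh (measurable_vecD z)).
have posE (a b : R) : 0 <= a -> maxe (a * b)%:E 0 = (a * Num.max b 0)%:E.
  by move=> a0; rewrite -EFin_max maxr_pMr// mulr0.
rewrite [LHS]integralE [RHS]integralE; congr (_ - _)%E.
  under eq_integral do rewrite funeposE posE//.
  under [RHS]eq_integral do rewrite funeposE posE//.
  apply: (ge0 (fun x => Num.max (g x) 0)).
  - by apply: measurable_maxr.
  - by move=> x; rewrite le_max lexx orbT.
  - by move=> x l lB; rewrite pg.
under eq_integral do rewrite funenegE -EFinN -mulrN posE//.
under [RHS]eq_integral do rewrite funenegE -EFinN -mulrN posE//.
apply: (ge0 (fun x => Num.max (- g x) 0)).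
- by apply: measurable_maxr => //; exact: measurableT_comp.
- by move=> x; rewrite le_max lexx orbT.
- by move=> x l lB; rewrite pg.
Qed.

Definition pind (x : vec) : R := \1_para x.

Lemma pind_ge0 x : 0 <= pind x. Proof. by rewrite /pind. Qed.

Lemma measurable_pind : measurable_fun [set: Rn R N] pind.
Proof. exact: measurable_indic (measurable_para uB). Qed.

Lemma integrable_pind : lebN.-integrable setT (fun x : Rn R N => (pind x)%:E).
Proof.
apply/integrableP; split; first by apply/measurable_EFinP; exact: measurable_pind.
under eq_integral do rewrite /= ger0_norm ?pind_ge0//.
by rewrite integral_indic ?setIT//; [exact: leb_para_lty|exact: measurable_para].
Qed.

Lemma Cint_para_periodic (p : vec -> R[i]) (z : vec) : @Cmeas _ (Rn R N) _ p ->
  Defs.periodic B p ->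
  Cint lebN (fun x => (pind x)%:C * p (x + z)) = Cint lebN (fun x => (pind x)%:C * p x).
Proof.
move=> [mr mi] pp; apply: complex_ext => /=.
  under eq_integral do rewrite reM mul0r subr0.
  under [in RHS]eq_integral do rewrite reM mul0r subr0.
  congr fine; apply: (@integral_para_periodic (fun x => re (p x))) => //.
  by move=> x l lB; rewrite pp.
under eq_integral do rewrite imM mul0r addr0.
under [in RHS]eq_integral do rewrite imM mul0r addr0.
congr fine; apply: (@integral_para_periodic (fun x => im (p x))) => //.
by move=> x l lB; rewrite pp.
Qed.

Lemma cint_para (f : vec -> R[i]) :
  cint (Defs.para B) f = Cint lebN (fun x => (pind x)%:C * f x).
Proof.
apply: complex_ext; rewrite /= /rint integral_mkcond; congr fine; apply: eq_integral => x _;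
  rewrite /pind indicE /patch; case: ifP => _.
- by rewrite reM mul1r mul0r subr0.
- by rewrite reM !mul0r subr0.
- by rewrite imM mul1r mul0r addr0.
- by rewrite imM !mul0r addr0.
Qed.

End ParaPeriodic.

Lemma cintegrable_indic (R : realType) (n : nat) (D : set (Rn R n.+1))
    (f : 'rV[R]_n.+1 -> R[i]) : measurable D ->
  Cintg (@leb R n.+1) (fun x => (\1_D x)%:C * f x) -> cintegrable D f.
Proof.
move=> mD [h1 h2]; split; apply/(integrable_mkcond _ mD).
  apply: eq_integrable h1 => // x _; rewrite /patch reM /= mul0r subr0 indicE.
  by case: ifP => _; rewrite ?mul1r ?mul0r.
apply: eq_integrable h2 => // x _; rewrite /patch imM /= mul0r addr0 indicE.
by case: ifP => _; rewrite ?mul1r ?mul0r.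
Qed.

(** * Characters of the dual lattice *)

Section DualLattice.
Variables (R : realType) (n : nat).
Local Notation N := n.+1.
Local Notation vec := 'rV[R]_N.

Lemma expi_2pi_nat (k : nat) : expi (2 * pi * k%:R : R) = 1.
Proof.
elim: k => [|k IH]; first by rewrite mulr0 expi0.
have -> : 2 * pi * k.+1%:R = 2 * pi * k%:R + 2 * pi :> R by rewrite mulrS; ring.
rewrite expiD IH mul1r.
by rewrite /expi mulr_natl cos2pi sin2pi.
Qed.

Lemma expi_2pi_int (k : int) : expi (2 * pi * k%:~R : R) = 1.
Proof.
case: k => k; first exact: expi_2pi_nat.
by rewrite NegzE rmorphN mulrN -conj_expi expi_2pi_nat conjC_real.
Qed.

Lemma dotp_mulmx (x y : vec) : dotp x y = (x *m y^T) 0 0.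
Proof. by rewrite mxE; apply: eq_bigr => i _; rewrite mxE. Qed.

(** For l = k B and a = 2 pi m B^-T the matrices cancel, and <l, a> is 2 pi times the integer given
    by the sum of the k_i m_i. *)
Lemma expi_dual (B : 'M[R]_N) (l a : vec) : B \in unitmx ->
  lattice B l -> lattice (dualbasis B) a -> expi (dotp l a) = 1.
Proof.
move=> uB [_ [k _ <-] <-] [_ [m _ <-] <-].
rewrite dotp_mulmx trmx_mul /dualbasis linearZ/= trmxK -scalemxAl -!scalemxAr.
rewrite -mulmxA mulKVmx// mxE.
rewrite (_ : (_ *m _) 0 0 = (\sum_i k 0 i * m 0 i)%:~R); first exact: expi_2pi_int.
by rewrite mxE rmorph_sum; apply: eq_bigr => i _; rewrite !mxE rmorphM.
Qed.

Lemma dualbasis_unit (B : 'M[R]_N) : B \in unitmx -> dualbasis B \in unitmx.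
Proof.
move=> uB; rewrite unitmxZ ?unitfE ?gt_eqF ?pi2_gt0//.
by rewrite unitmx_tr unitmx_inv.
Qed.

End DualLattice.

HB.instance Definition _ (R : realType) :=
  @Measure_isSigmaFinite.Build _ nat R (@counting nat R) (sigma_finite_counting R).

(* A named copy of the product measure: inference does not find the sigma-finite
   structure on [leb \x leb] itself. *)
Section LebPair.
Variables (R : realType) (n : nat).
Local Notation lebN := (@leb R n.+1).
Local Notation Rn2 := (Rn R n.+1 * Rn R n.+1)%type.

Definition leb2 (A : set Rn2) : \bar R := (lebN \x lebN)%E A.

HB.instance Definition _ := Measure.copy leb2 (lebN \x lebN)%E.

Lemma sigma_finite_leb2 : sigma_finite setT leb2.
Proof.
have /sigma_finiteP[F [TF ndF Foo]] := sigma_finiteT lebN.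
exists (fun k => F k `*` F k).
  rewrite -setXTT TF; apply/seteqP; split => [[x y]/= [[i _ Fx] [j _ Fy]]|[x y]/= [k _ []]].
    exists (maxn i j) => //; split.
      by move: x Fx; exact/subsetPset/ndF/leq_maxl.
    by move: y Fy; exact/subsetPset/ndF/leq_maxr.
  by split; exists k.
move=> k; have [mF oF] := Foo k; split; first exact: measurableX.
by rewrite /leb2 product_measure1E// lte_mul_pinfty// ge0_fin_numE.
Qed.

HB.instance Definition _ :=
  Measure_isSigmaFinite.Build _ Rn2 R leb2 sigma_finite_leb2.

End LebPair.

(** * Lattice sums as integrals for the counting measure *)

Section CountingSums.
Variables (R : realType) (n : nat).
Local Notation N := n.+1.
Local Notation vec := 'rV[R]_N.

Lemma measurable_nat_prod d (T : measurableType d) (f : nat * T -> R) :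
  (forall k, measurable_fun setT (fun y => f (k, y))) -> measurable_fun setT f.
Proof.
move=> mf _ Y mY; rewrite setTI.
rewrite (_ : f @^-1` Y = \bigcup_k ([set k] `*` ((fun y => f (k, y)) @^-1` Y))).
  apply: bigcupT_measurable => k; apply: measurableX => //.
  by rewrite -[X in measurable X]setTI; exact: mf.
apply/seteqP; split => [[k y] h|[k y] [k' _ [/= -> h]]//].
by exists k.
Qed.

Lemma Cmeas_nat_prod d (T : measurableType d) (f : nat * T -> R[i]) :
  (forall k, Cmeas (fun y => f (k, y))) -> Cmeas f.
Proof.
by move=> mf; split; apply: measurable_nat_prod => k; have [] := mf k.
Qed.

Lemma integrable_counting (w : nat -> R) : (forall k, 0 <= w k) ->
  (\sum_(k <oo) (w k)%:E < +oo)%E -> (@counting nat R).-integrable setT (EFin \o w).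
Proof.
move=> w0 ws; apply/integrableP; split => //.
under eq_integral do rewrite /= ger0_norm//.
by rewrite ge0_integral_count// => k; rewrite lee_fin.
Qed.

(** [rsum] is the decomposition into positive and negative parts that defines the integral.
    Integrability makes both parts finite, so [fine] commutes with their difference. *)
Lemma rsum_counting (S : set vec) (L : nat -> vec) (u : vec -> R) :
  set_bij [set: nat] S L -> (@counting nat R).-integrable setT (fun k => (u (L k))%:E) ->
  rsum S u = fine (\int[@counting nat R]_k (u (L k))%:E)%E.
Proof.
move=> LS iu.
have E (v : vec -> R) : (forall a, 0 <= v a) ->
    esum S (fun a => (v a)%:E) = (\int[@counting nat R]_k (v (L k))%:E)%E.
  move=> v0; rewrite (reindex_esum setT S L)// -nneseries_esumT; last by move=> k; rewrite lee_fin.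
  by rewrite ge0_integral_count// => k; rewrite lee_fin.
have p0 (x : R) : 0 <= Num.max x 0 by rewrite le_max lexx orbT.
rewrite /rsum !E// [X in _ = fine X]integralE.
rewrite [RHS]fineB; last 2 first.
- exact: integrable_pos_fin_num.
- exact: integrable_neg_fin_num.
congr (_ - _); congr fine; apply: eq_integral => k _.
  by rewrite funeposE -EFin_max.
by rewrite funenegE -EFinN -EFin_max.
Qed.

Lemma csum_counting (S : set vec) (L : nat -> vec) (u : vec -> R[i]) :
  set_bij [set: nat] S L -> Cintg (@counting nat R) (fun k => u (L k)) ->
  csum S u = Cint (@counting nat R) (fun k => u (L k)).
Proof.
move=> LS [i1 i2]; apply: complex_ext => /=.
  exact: (rsum_counting (u := fun a => re (u a)) LS).
exact: (rsum_counting (u := fun a => im (u a)) LS).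
Qed.

End CountingSums.

Section Positivity.
Variables (R : realType) (n : nat).
Local Notation N := n.+1.
Local Notation vec := 'rV[R]_N.
Local Notation lebN := (@leb R N).

(** Serves to invert the squared norm of the window. On a small rational box around [x0] the
    function stays above half of [g x0], and that box has positive measure. *)
Lemma integral_continuous_gt0 (g : vec -> R) (x0 : vec) : continuous g ->
  (forall x, 0 <= g x) -> 0 < g x0 -> (0 < \int[lebN]_x (g x)%:E)%E.
Proof.
move=> cg g0 gx0; set e := g x0 / 2; have e0 : 0 < e by rewrite divr_gt0.
have oU : open [set x | e < g x].
  by move/continuousP : cg => /(_ _ (@open_gt R e)).
have [|p [px pU]] := open_ratbox (x := x0) oU; first by rewrite /= ltr_pdivrMr// ltr_pMr// ltr1n.
have mp : measurable (ratbox p : set (Rn R N)) by exact: measurable_box.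
apply: (@lt_le_trans _ _ (\int[lebN]_x (e * \1_(ratbox p : set (Rn R N)) x)%:E)%E).
  rewrite ge0_integralZ ?(ltW e0)//.
  rewrite integral_indic// setIT mule_gt0// ?lte_fin//.
  rewrite [X in (_ < X)%E]leb_box lte_fin; apply: prodr_gt0 => i _; rewrite !mxE lt_max.
  by rewrite subr_gt0 ltrD2l gtrN ?invr_gt0 ?ltr0n.
apply: ge0_le_integral => //.
- by move=> x _; rewrite lee_fin mulr_ge0// ltW.
- apply/measurable_EFinP; apply: measurable_funM => //; exact: measurable_indic.
- by apply/measurable_EFinP; exact: continuous_measurable_Rn.
move=> x _; rewrite lee_fin indicE; case: (boolP (x \in (ratbox p : set (Rn R N)))) => xp.
  by rewrite mulr1; move: xp; rewrite inE => /pU/ltW.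
by rewrite mulr0.
Qed.

End Positivity.

(** * Integration term by term *)

Section LatticeDecay.
Variables (R : realType) (n : nat).
Local Notation N := n.+1.
Local Notation vec := 'rV[R]_N.
Implicit Types x a xi : vec.

Lemma enorm_le x : enorm x <= N%:R * `|x|.
Proof.
rewrite -(@ler_pXn2r _ 2)// ?nnegrE ?sqrtr_ge0 ?mulr_ge0//.
rewrite sqr_sqrtr; last by apply: sumr_ge0 => i _; rewrite -expr2 sqr_ge0.
apply: (@le_trans _ _ (\sum_(i < N) `|x| ^+ 2)).
  apply: ler_sum => i _; rewrite -expr2 -real_normK ?num_real//.
  by rewrite lerXn2r ?nnegrE// coord_le_mxnorm.
rewrite sumr_const card_ord -[leLHS]mulr_natl exprMn ler_wpM2r ?sqr_ge0//.
by rewrite expr2 ler_peMr// ler1n.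
Qed.

(** The exponent [p = 1/s] may lie on either side of 1, so neither convexity nor subadditivity
    applies throughout; bounding u + v by twice the larger term works for all [p > 0]. *)
Lemma powRD_le (p u v : R) : 0 < p -> 0 <= u -> 0 <= v ->
  (u + v) `^ p <= 2 `^ p * (u `^ p + v `^ p).
Proof.
move=> p0; wlog uv : u v / u <= v.
  move=> H u0 v0; have [uv|/ltW vu] := leP u v; first exact: H.
  by rewrite [u + v]addrC [u `^ p + _]addrC; exact: H.
move=> u0 v0; apply: (@le_trans _ _ ((2 * v) `^ p)).
  by apply: ge0_ler_powR; rewrite ?nnegrE ?addr_ge0 ?mulr_ge0 ?(ltW p0)// mulr_natl mulr2n lerD2r.
by rewrite powRM// ler_wpM2l ?powR_ge0// lerDr powR_ge0.
Qed.

(* Since [|a|^p <= 2^p (|xi - a|^p + |xi|^p)], the decay in [xi - a] can be traded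
   for decay in [a] at the cost of a factor growing in [xi], which the decay of
   the short-time Fourier transform in [xi] absorbs. *)
Lemma lattice_coef_decay (p r eps D K cc gg : R) a xi : 0 < p -> 0 < r -> 0 <= eps ->
  eps * ((N%:R * 2) `^ p) <= r / 4 -> 0 <= cc -> 0 <= gg ->
  cc <= D * expR (eps * enorm a `^ p) ->
  gg <= K * expR (- (r * `|xi - a| `^ p)) ->
  cc * gg <= D * K * expR (3 / 4 * r * `|xi| `^ p) *
    expR (- (r / 2 * (2 `^ p)^-1 * `|a| `^ p)).
Proof.
move=> p0 r0 e0 er cc0 gg0 cD gK; set u := `|xi - a| `^ p; set v := `|xi| `^ p.
have u0 : 0 <= u by exact: powR_ge0.
have v0 : 0 <= v by exact: powR_ge0.
have q0 : 0 < 2 `^ p :> R by rewrite powR_gt0.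
have av : `|a| `^ p <= 2 `^ p * (u + v).
  apply: le_trans (powRD_le p0 (normr_ge0 _) (normr_ge0 _)).
  apply: ge0_ler_powR; rewrite ?nnegrE ?addr_ge0 ?(ltW p0)//.
  by rewrite -{1}[a](subKr xi) (le_trans (ler_normB _ _))// addrC.
have ea : eps * enorm a `^ p <= r / 4 * (u + v).
  apply: (@le_trans _ _ (eps * (N%:R `^ p * (2 `^ p * (u + v))))).
    rewrite ler_wpM2l//; apply: (@le_trans _ _ ((N%:R * `|a|) `^ p)).
      by apply: ge0_ler_powR; rewrite ?nnegrE ?sqrtr_ge0 ?mulr_ge0 ?(ltW p0)// enorm_le.
    by rewrite powRM// ler_wpM2l ?powR_ge0.
  by rewrite [_ `^ p * (_ * _)]mulrA [leLHS]mulrA -powRM// ler_wpM2r// addr_ge0.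
have D0 : 0 <= D by move: (le_trans cc0 cD); rewrite pmulr_lge0 ?expR_gt0.
have K0 : 0 <= K by move: (le_trans gg0 gK); rewrite pmulr_lge0 ?expR_gt0.
have H (x y z : R) : x * y <= z -> D * x * (K * y) <= D * K * z.
  by move=> xyz; rewrite mulrACA ler_wpM2l ?mulr_ge0.
have uv : (2 `^ p)^-1 * `|a| `^ p <= u + v by rewrite ler_pdivrMl.
rewrite -[leRHS]mulrA -expRD; apply: (le_trans (ler_pM cc0 gg0 cD gK)).
apply: H; rewrite -expRD ler_expR -[r / 2 * _ * _]mulrA.
(* The budget: z <= r (u + v) / 4 and w <= u + v give z - r u <= r v / 4 - 3 r u / 4, which is at
   most 3 r v / 4 - r w / 2. *)
move: ea uv; move: (_ * `|a| `^ p) (eps * _) => w z ea uv.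
have := ler_wpM2l (ltW r0) uv; have := mulr_ge0 (ltW r0) u0.
by rewrite -/u; move: ea; clear; clearbody u v; lra.
Qed.

End LatticeDecay.

(** * Cell averages of the short-time Fourier transform *)

Section WindowedCoefficients.
Variables (R : realType) (n : nat).
Local Notation N := n.+1.
Local Notation vec := 'rV[R]_N.
Local Notation lebN := (@leb R N).
Local Notation Meas f := (@Cmeas _ (Rn R N) _ f).
Variable B : 'M[R]_N.
Hypothesis uB : B \in unitmx.
Variables (psi phi : vec -> R[i]) (A C : R).
Hypotheses (mpsi : Meas psi) (mphi : Meas phi).
Hypothesis psiA : forall x, cnorm (psi x) <= A.
Hypothesis phiC : forall x, cnorm (phi x) <= C * pois x.
Hypothesis psiB : Defs.periodic B psi.
Local Notation G := (FT (fun y => conjc (phi y))).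

Lemma Cint_pind_stft (a xi : vec) : lattice (dualbasis B) a ->
  Cint lebN (fun x => (pind B x)%:C * expi (dotp x (xi - a)) * stft phi psi x xi) =
  (paravol B)%:C * fcoef B psi a * G (xi - a).
Proof.
move=> aB; have A0 : 0 <= A := le_trans (cnorm_ge0 _) (psiA 0).
pose p y := psi y * expi (- dotp y a).
pose q z := conjc (phi z) * expi (- dotp z (xi - a)).
have mp : Meas p by apply: CmeasM => //; exact: Cmeas_wave.
have mq : Meas q by apply: CmeasM; [exact: Cmeas_conj|exact: Cmeas_wave].
have pA y : cnorm (p y) <= A by rewrite cnormM cnorm_expi mulr1.
have qC z : cnorm (q z) <= C * pois z by rewrite cnormM cnorm_expi mulr1 cnorm_conj.
have iC : lebN.-integrable setT (EFin \o (fun z => C * pois z)).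
  exact: (integrableZl measurableT C (@integrable_pois R n)).
have iq : Cintg lebN q by exact: Cintg_dom mq qC iC.
have pB : Defs.periodic B p.
  move=> x l Bl; rewrite /p psiB// dotpDl opprD expiD -[in X in _ * (_ * X)]conj_expi.
  by rewrite (expi_dual uB)// conjC_real mulr1.
have mD : measurable_fun setT (fun w : Rn R N * Rn R N => w.1 + w.2 : Rn R N).
  apply: measurable_vec => i; under eq_fun do rewrite mxE; apply: measurable_funD.
    exact: (measurableT_comp (@measurable_coord R N i) measurable_fst).
  exact: (measurableT_comp (@measurable_coord R N i) measurable_snd).
pose f (w : Rn R N * Rn R N) := (ftc R n)%:C * ((pind B w.1)%:C * p (w.1 + w.2) * q w.2).
have mf : Cmeas f.
  apply: CmeasM; first exact: Cmeas_cst.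
  apply: CmeasM; first apply: CmeasM.
  - by apply: Cmeas_real; apply: measurableT_comp measurable_fst; exact: measurable_pind.
  - exact: (Cmeas_transfer mD mp).
  - exact: (Cmeas_transfer (@measurable_snd _ _ _ _) mq).
have F0 := ltW (ftc_gt0 R n).
have fi : Cintg (lebN \x lebN)%E f.
  apply: (@Cintg_tensor _ _ _ _ _ lebN lebN f
    (fun x => ftc R n * (pind B x * A)) (fun z => C * pois z)) => //.
  - by move=> x; rewrite !mulr_ge0 ?pind_ge0.
  - by move=> z; rewrite (le_trans (cnorm_ge0 _) (qC z)).
  - exact: (integrableZl measurableT (ftc R n)
      (integrableZr measurableT A (integrable_pind uB))).
  move=> x z; rewrite 3!cnormM !cnorm_real (ger0_norm F0) (ger0_norm (pind_ge0 _ _)).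
  rewrite -!mulrA ler_wpM2l// ler_wpM2l ?pind_ge0//.
  by apply: ler_pM; rewrite ?cnorm_ge0.
(* The substitution y = z + x frees [phi] from [x]; the bound becomes a tensor product, and the
   integrals may be exchanged. *)
transitivity (Cint lebN (fun x => Cint lebN (fun z => f (x, z)))).
  apply: eq_Cint => x; rewrite /stft FTE.
  pose w y := psi y * conjc (phi (y - x)) * expi (- dotp y xi).
  have mw : Meas w.
    apply: CmeasM; last exact: Cmeas_wave.
    by apply: CmeasM => //; apply: Cmeas_conj; exact: Cmeas_shift.
  rewrite -/w (Cint_shift x mw).
  have iw : Cintg lebN (fun z => w (z + x)).
    apply: (@Cintg_dom _ _ _ lebN _ (fun z => A * (C * pois z))).
    - exact: Cmeas_shift.
    - move=> z; rewrite /w addrK !cnormM cnorm_expi mulr1 cnorm_conj.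
      by apply: ler_pM; rewrite ?cnorm_ge0.
    - exact: (integrableZl measurableT A iC).
  rewrite !mulrA -CintZ//; apply: eq_Cint => z; rewrite /f /w /p /q /= addrK.
  rewrite [z + x]addrC.
  (* The phase splits into a part cancelling the wave of the short-time transform, the wave of the
     Fourier coefficient in x + z, and the wave of the transform of conj(phi) in z. *)
  have -> : dotp x (xi - a) = dotp (x + z) xi - dotp (x + z) a - dotp z (xi - a).
    rewrite !dotpDl ![dotp _ (xi - a)]dotpC !dotpDl !dotpNl.
    by rewrite ![dotp xi _]dotpC ![dotp a _]dotpC; ring.
  rewrite !expiD.
  have e1 : expi (dotp (x + z) xi) * expi (- dotp (x + z) xi) = 1.
    by rewrite -expiD subrr expi0.
  move: e1; move: (expi _) (expi (- dotp (x + z) xi)) => e e' ee.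
  rewrite [LHS](_ : _ = (e * e') * ((ftc R n)%:C * ((pind B x)%:C * (psi (x + z) *
    expi (- dotp (x + z) a)) * (conjc (phi z) * expi (- dotp z (xi - a)))))); last ring.
  by rewrite ee mul1r.
rewrite (Cint_fubini_swap fi).
transitivity (Cint lebN (fun z => (ftc R n)%:C * (paravol B)%:C * fcoef B psi a * q z)).
  apply: eq_Cint => z; rewrite /f /=.
  rewrite (_ : (fun x => _) = (fun x => ((ftc R n)%:C * q z) *
    ((pind B x)%:C * p (x + z)))); last by apply/funext => x; ring.
  rewrite CintZ; last first.
    apply: (@Cintg_dom _ _ _ lebN _ (fun x => pind B x * A)).
    - apply: CmeasM; last exact: Cmeas_shift.
      by apply: Cmeas_real; exact: measurable_pind.
    - move=> x; rewrite cnormM cnorm_real ger0_norm ?pind_ge0//.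
      by rewrite ler_wpM2l ?pind_ge0.
    - exact: (integrableZr measurableT A (integrable_pind uB)).
  (* Periodicity removes the shift by [z], which leaves the Fourier coefficient of [psi]. [paravol]
     only undoes its normalisation and is never compared with [leb] of the cell. *)
  rewrite Cint_para_periodic// -cint_para /fcoef -/p.
  have v0 : (paravol B)%:C * ((paravol B)^-1)%:C = 1 :> R[i].
    by rewrite -rmorphM mulfV// normr_eq0 -unitfE -unitmxE.
  by rewrite -[in RHS](mulrA (ftc R n)%:C) [(paravol B)%:C * _]mulrA v0 mul1r; ring.
rewrite CintZ// FTE /=; ring.
Qed.

End WindowedCoefficients.

(** * The identity under abstract dominations *)

Section Moyal.
Variables (R : realType) (n : nat).
Local Notation N := n.+1.
Local Notation vec := 'rV[R]_N.
Local Notation lebN := (@leb R N).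
Local Notation Meas f := (@Cmeas _ (Rn R N) _ f).
Local Notation nu := (lebN \x lebN)%E.
Local Notation cnt := (@counting nat R).
Variable B : 'M[R]_N.
Hypothesis uB : B \in unitmx.
Variables (c psi phi : vec -> R[i]).
Local Notation G := (FT (fun y => conjc (phi y))).
Local Notation V := (stft phi psi).
Local Notation F x xi := (stft_dist B c phi x xi * conjc (V x xi)).
Variable L : nat -> vec.
Hypothesis LB : set_bij [set: nat] (lattice (dualbasis B)) L.
Variables (A C K T : R) (M : vec -> R).
Hypotheses (cpsi : ccont psi) (cphi : ccont phi).
Hypothesis psiA : forall x, cnorm (psi x) <= A.
Hypothesis phiC : forall x, cnorm (phi x) <= C * pois x.
Hypothesis psiB : Defs.periodic B psi.
Hypothesis GK : forall xi, cnorm (G xi) <= K * pois xi.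
(** [M] may grow with [xi]: for the series of V_phi f alone only summability at fixed [xi] is
    required. The factor [V] in the next hypothesis restores integrability in [xi]. *)
Hypothesis cGM : forall k xi, cnorm (c (L k)) * cnorm (G (xi - L k)) <= M xi * pois (L k).
Hypothesis cGVT : forall k x xi,
  cnorm (c (L k)) * cnorm (G (xi - L k)) * cnorm (V x xi) <= T * pois (L k) * pois xi.
Hypothesis T0 : 0 <= T.
Hypothesis phi0 : exists x, phi x <> 0.

Let mpsi : Meas psi := ccont_meas cpsi.
Let mphi : Meas phi := ccont_meas cphi.

Definition dterm (x xi : vec) (k : nat) : R[i] :=
  c (L k) * (expi (- dotp x (xi - L k)) * G (xi - L k)).

Lemma integrable_pois_lattice : cnt.-integrable setT (EFin \o (fun k => pois (L k))).
Proof.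
apply: integrable_counting => [k|]; first exact: pois_ge0.
exact: (lattice_pois_summable (dualbasis_unit uB) LB).
Qed.

Lemma Cintg_phi : Cintg lebN (fun y => conjc (phi y)).
Proof.
apply: (@Cintg_pois_dom R n _ C 0); first exact: Cmeas_conj.
by move=> x; rewrite cnorm_conj subr0.
Qed.

Lemma Cmeas_nat (u : nat -> R[i]) : Cmeas u.
Proof. by split. Qed.

Lemma Cintg_dterm x xi : Cintg cnt (dterm x xi).
Proof.
apply: (@Cintg_dom _ _ _ cnt _ (fun k => M xi * pois (L k))); first exact: Cmeas_nat.
  by move=> k; rewrite /dterm 2!cnormM cnorm_expi mul1r; exact: cGM.
exact: (integrableZl measurableT (M xi) integrable_pois_lattice).
Qed.

Lemma stft_distE x xi : stft_dist B c phi x xi = Cint cnt (dterm x xi).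
Proof.
have e1 : (ftc R n)%:C * ((2 * pi) `^ (N%:R / 2))%:C = 1 :> R[i].
  by rewrite -rmorphM ftc_inv.
rewrite /stft_dist /gpair mulrA [X in X * _]e1 mul1r.
(* The modulation by [xi] moves the frequency from -a to xi - a, and the translation by [x] produces
   the phase. *)
have E a : c a * FT (fun y => conjc (phi (y - x)) * expi (- dotp y xi)) (- a) =
    c a * (expi (- dotp x (xi - a)) * G (xi - a)).
  congr (_ * _); rewrite -dotpNl -FT_shift; last exact: Cintg_phi.
  rewrite !FTE; congr (_ * _); apply: eq_Cint => y; rewrite -mulrA -expiD.
  by congr (_ * expi _); rewrite -opprD dotpC [dotp y (- a)]dotpC -dotpDl dotpC.
rewrite (csum_counting LB); first by apply: eq_Cint => k; rewrite E.
have := Cintg_dterm x xi; congr (Cintg _ _); apply/funext => k; exact/esym/E.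
Qed.

Lemma Cmeas_stft : Cmeas (fun z : Rn R N * Rn R N => V z.1 z.2).
Proof.
have m1 : measurable_fun setT (fun w : (Rn R N * Rn R N) * Rn R N => w.2 - w.1.1 : Rn R N).
  apply: measurable_vec => i; under eq_fun do rewrite !mxE; apply: measurable_funB.
    exact: (measurableT_comp (@measurable_coord R N i) measurable_snd).
  apply: (measurableT_comp (@measurable_coord R N i)).
  exact: (measurableT_comp measurable_fst measurable_fst).
have m2 : measurable_fun setT (fun w : (Rn R N * Rn R N) * Rn R N => dotp w.2 w.1.2).
  have mp := measurable_fun_pair (@measurable_snd _ _ (Rn R N * Rn R N)%type (Rn R N))
    (measurableT_comp (@measurable_snd _ _ (Rn R N) (Rn R N))
      (@measurable_fst _ _ (Rn R N * Rn R N)%type (Rn R N))).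
  exact: (measurableT_comp (@measurable_dotp2 R n) mp).
apply: CmeasM; first exact: Cmeas_cst.
apply: (@Cmeas_Cint _ _ _ _ R lebN
  (fun w : (Rn R N * Rn R N) * Rn R N => psi w.2 * conjc (phi (w.2 - w.1.1)) * expi (- dotp w.2 w.1.2))).
apply: CmeasM; first apply: CmeasM.
- exact: (Cmeas_transfer (@measurable_snd _ _ _ _) mpsi).
- by apply: Cmeas_conj; exact: (Cmeas_transfer m1 mphi).
- by apply: Cmeas_expi; exact: measurableT_comp m2.
Qed.

Definition mterm (w : nat * (Rn R N * Rn R N)) : R[i] :=
  dterm w.2.1 w.2.2 w.1 * conjc (V w.2.1 w.2.2).

Lemma Cmeas_mterm : Cmeas mterm.
Proof.
apply: Cmeas_nat_prod => k.
have md : measurable_fun setT (fun z : Rn R N * Rn R N => z.2 - L k : Rn R N).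
  exact: (measurableT_comp (measurable_vecD (- L k)) measurable_snd).
have mp := measurable_fun_pair (@measurable_fst _ _ (Rn R N) (Rn R N)) md.
have me : Cmeas (fun z : Rn R N * Rn R N => expi (- dotp z.1 (z.2 - L k))).
  apply: Cmeas_expi; apply: measurableT_comp => //.
  exact: (measurableT_comp (@measurable_dotp2 R n) mp).
have mG : Meas G by apply: Cmeas_FT; exact: Cmeas_conj.
exact: (CmeasM (CmeasM (Cmeas_cst _ (c (L k))) (CmeasM me (Cmeas_transfer md mG)))
  (Cmeas_conj Cmeas_stft)).
Qed.

Lemma mterm_le k x xi : cnorm (mterm (k, (x, xi))) <= pois (L k) * (T * pois xi).
Proof.
rewrite -[mterm _]/(dterm x xi k * conjc (V x xi)) /dterm cnormM cnorm_conj.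
rewrite (cnormM (c (L k))) (cnormM (expi _)) cnorm_expi mul1r; apply: (le_trans (cGVT k x xi)).
by rewrite mulrCA !mulrA.
Qed.

Lemma Cintg_mterm x xi : Cintg cnt (fun k => mterm (k, (x, xi))).
Proof.
apply: (@Cintg_dom _ _ _ cnt _ (fun k => pois (L k) * (T * pois xi))); first exact: Cmeas_nat.
  by move=> k; exact: mterm_le.
exact: (integrableZr measurableT _ integrable_pois_lattice).
Qed.

Let S := fine (\int[cnt]_k (pois (L k))%:E)%E.

Lemma moyal_integrandE x xi : F x xi = Cint cnt (fun k => mterm (k, (x, xi))).
Proof.
rewrite stft_distE mulrC -CintZ; last exact: Cintg_dterm.
by apply: eq_Cint => k; rewrite mulrC.
Qed.

Lemma moyal_integrand_le x xi : cnorm (F x xi) <= 2 * (S * T) * pois xi.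
Proof.
rewrite moyal_integrandE.
have i1 := integrableZr measurableT (T * pois xi) integrable_pois_lattice.
apply: (le_trans (@cnorm_Cint_le _ _ _ cnt _ (fun k => pois (L k) * (T * pois xi)) _ _ _)).
- exact: Cmeas_nat.
- by move=> k; exact: mterm_le.
- exact: i1.
rewrite -mulrA ler_wpM2l//; under eq_integral do rewrite EFinM.
rewrite integralZr//; last exact: integrable_pois_lattice.
have fS := integrable_fin_num measurableT integrable_pois_lattice.
by rewrite fineM// /S mulrA.
Qed.

Lemma Cmeas_moyal : Cmeas (fun z : Rn R N * Rn R N => F z.1 z.2).
Proof.
have := @Cmeas_Cint _ _ _ nat R cnt (fun w => mterm (w.2, w.1)) (Cmeas_swap Cmeas_mterm).
by congr (Cmeas _); apply/funext => -[x xi]; rewrite moyal_integrandE.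
Qed.

Lemma integrable_pind_pois : nu.-integrable setT (EFin \o (fun z => pind B z.1 * pois z.2)).
Proof.
apply: (@integrable_tensor _ _ _ _ R lebN lebN (pind B) (@pois R n)).
- exact: pind_ge0.
- exact: pois_ge0.
- exact: integrable_pind.
- exact: integrable_pois.
Qed.

Lemma Cintg_moyal : Cintg nu (fun z => (pind B z.1)%:C * F z.1 z.2).
Proof.
have mpi : Cmeas (fun z : Rn R N * Rn R N => (pind B z.1)%:C : R[i]).
  apply: Cmeas_real; apply: measurableT_comp measurable_fst; exact: measurable_pind.
apply: (@Cintg_dom _ _ _ nu _ (fun z => 2 * (S * T) * (pind B z.1 * pois z.2))).
- exact: CmeasM mpi Cmeas_moyal.
- move=> [x xi]; rewrite [cnorm _]cnormM cnorm_real ger0_norm ?pind_ge0//.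
  by rewrite mulrCA ler_wpM2l ?pind_ge0//; exact: moyal_integrand_le.
- exact: (integrableZl measurableT _ integrable_pind_pois).
Qed.

Lemma cintegrable_moyal : cintegrable [set z : 'rV[R]_(N + N) | Defs.para B (lsubmx z)]
  (fun z => F (lsubmx z) (rsubmx z)).
Proof.
have ml : measurable_fun setT (fun z : Rn R (N + N) => lsubmx z : Rn R N).
  apply: measurable_vec => i; under eq_fun do rewrite mxE; exact: measurable_coord.
have mr : measurable_fun setT (fun z : Rn R (N + N) => rsubmx z : Rn R N).
  apply: measurable_vec => i; under eq_fun do rewrite mxE; exact: measurable_coord.
have mD : measurable ([set z | Defs.para B (lsubmx z)] : set (Rn R (N + N))).
  have := ml measurableT _ (measurable_para uB); by rewrite setTI.
apply: (@cintegrable_indic R (n + N) _ _ mD).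
have mF := CmeasM (Cmeas_real (measurableT_comp (measurable_pind uB) ml))
  (Cmeas_transfer (measurable_fun_pair ml mr) Cmeas_moyal).
(* The domain lies in dimension N + N, whereas the estimates are on pairs; concatenation of rows
   identifies [leb] with the product measure. *)
have [H _] := Cintg_transfer (nu := nu) (@measurable_row_mx R N N) (@integral_leb_row_mx R n n) mF.
apply: H; have := Cintg_moyal; congr (Cintg _ _); apply/funext => -[x xi].
by rewrite /comp row_mxKl row_mxKr.
Qed.

Lemma Cmeas_pind_fst : Cmeas (fun z : Rn R N * Rn R N => (pind B z.1)%:C : R[i]).
Proof.
by apply: Cmeas_real; apply: measurableT_comp measurable_fst; exact: measurable_pind.
Qed.

Lemma pind_mterm_le k z : cnorm ((pind B z.1)%:C * mterm (k, z)) <=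
  pois (L k) * (T * (pind B z.1 * pois z.2)).
Proof.
case: z => x xi; rewrite [cnorm _]cnormM cnorm_real ger0_norm ?pind_ge0//=.
apply: (@le_trans _ _ (pind B x * (pois (L k) * (T * pois xi)))).
  by rewrite ler_wpM2l ?pind_ge0//; exact: mterm_le.
by rewrite le_eqVlt; apply/orP; left; apply/eqP; ring.
Qed.

Lemma moyal_rhs : cint (Defs.para B) (fun x => cint setT (fun xi => F x xi)) =
  Cint cnt (fun k => Cint nu (fun z => (pind B z.1)%:C * mterm (k, z))).
Proof.
rewrite cint_para.
transitivity (Cint nu (fun z => (pind B z.1)%:C * F z.1 z.2)).
  rewrite Cint_fubini; last exact: Cintg_moyal.
  apply: eq_Cint => x.
  rewrite (@CintZ _ _ _ lebN (pind B x)%:C (fun xi => F x xi))//.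
  apply: (@Cintg_dom _ _ _ lebN _ (fun xi => 2 * (S * T) * pois xi)).
  - exact: (Cmeas_transfer (measurable_pair1 x) Cmeas_moyal).
  - exact: moyal_integrand_le.
  - exact: (integrableZl measurableT _ (@integrable_pois R n)).
have mpi : Cmeas (fun w : nat * (Rn R N * Rn R N) => (pind B w.2.1)%:C : R[i]).
  exact: (Cmeas_transfer (@measurable_snd _ _ nat _) Cmeas_pind_fst).
(* A second use of Fubini, for the sum over [k] against the pair (x, xi) taken as one variable; the
   bound is a tensor of [pois (L k)] with an integrable function of the pair. *)
have E := @Cint_fubini_swap _ _ nat (Rn R N * Rn R N)%type R cnt (@leb2 R n)
  (fun w => (pind B w.2.1)%:C * mterm w).
apply: etrans _ (esym (E _)).
  apply: eq_Cint => -[x xi]; rewrite moyal_integrandE.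
  by rewrite (@CintZ _ _ _ cnt (pind B x)%:C (fun k => mterm (k, (x, xi))))//; exact: Cintg_mterm.
apply: (@Cintg_tensor _ _ nat (Rn R N * Rn R N)%type R cnt (@leb2 R n) _
  (fun k => pois (L k)) (fun z => T * (pind B z.1 * pois z.2))).
- exact: CmeasM mpi Cmeas_mterm.
- by move=> k; exact: pois_ge0.
- by move=> z; rewrite !mulr_ge0 ?pind_ge0 ?pois_ge0.
- exact: integrable_pois_lattice.
- exact: (integrableZl measurableT _ integrable_pind_pois).
- exact: pind_mterm_le.
Qed.

Let Cintg_pind_mterm k : Cintg nu (fun z => (pind B z.1)%:C * mterm (k, z)).
Proof.
apply: (@Cintg_dom _ _ _ nu _ (fun z => pois (L k) * (T * (pind B z.1 * pois z.2)))).
- exact: CmeasM Cmeas_pind_fst (Cmeas_transfer (measurable_pair1 k) Cmeas_mterm).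
- exact: pind_mterm_le.
- exact: (integrableZl measurableT _ (integrableZl measurableT _ integrable_pind_pois)).
Qed.

Let Cintg_G : Cintg lebN G.
Proof.
apply: (@Cintg_pois_dom R n _ K 0); first by apply: Cmeas_FT; exact: Cmeas_conj.
by move=> xi; rewrite subr0.
Qed.

Lemma pois_le y : @pois R n y <= 2 ^+ N.
Proof.
apply: (@le_trans _ _ (\prod_(i < N) (2 : R))); last by rewrite prodr_const card_ord.
apply: ler_prod => i _; rewrite poisson_ge0 /poisson.
by rewrite ler_pdivrMr ?onesqr_gt0// ler_peMr// lerDl sqr_ge0.
Qed.

Let C_ge0 : 0 <= C.
Proof.
rewrite leNgt; apply/negP => Cn; have := phi0 => -[x]; apply.
apply: cnorm_eq0; apply/eqP; rewrite eq_le cnorm_ge0 andbT.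
apply: (le_trans (phiC x)); exact: (mulr_le0_ge0 (ltW Cn) (pois_ge0 x)).
Qed.

Let conj_phi_le y : cnorm (conjc (phi y)) <= C * 2 ^+ N.
Proof. by rewrite cnorm_conj (le_trans (phiC y))// ler_wpM2l// pois_le. Qed.

Let Cintg_phi_sqr : Cintg lebN (fun x => conjc (phi x) * conjc (conjc (phi x))).
Proof.
apply: (Cintg_bounded (M := C * 2 ^+ N)); last exact: Cintg_phi.
  by apply: Cmeas_conj; exact: Cmeas_conj.
by move=> x; rewrite cnorm_conj.
Qed.

Lemma Cint_phi_sqr :
  Cint lebN (fun x => conjc (phi x) * conjc (conjc (phi x))) = (L2norm2 phi)%:C.
Proof.
rewrite -[RHS](@Cint_real _ _ _ lebN (fun x => cnorm (phi x) ^+ 2)).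
by apply: eq_Cint => x; rewrite mulc_conj cnorm_conj.
Qed.

Lemma L2norm2_gt0 : 0 < L2norm2 phi.
Proof.
have [x0 px0] := phi0; have [c1 c2] := cphi.
apply: fine_gt0; apply/andP; split.
  apply: (integral_continuous_gt0 (x0 := x0)).
  - have [h _] := ccontM (ccont_conj cphi) (ccont_conj (ccont_conj cphi)).
    rewrite (_ : (fun x => _) = (fun x => re (conjc (phi x) * conjc (conjc (phi x))))).
      exact: h.
    by apply/funext => x; rewrite mulc_conj cnorm_conj.
  - by move=> x; rewrite sqr_ge0.
  - rewrite exprn_gt0// lt_neqAle cnorm_ge0 andbT eq_sym.
    by apply/negP => /eqP/cnorm_eq0.
have [i1 _] := Cintg_phi_sqr.
rewrite (_ : (fun x => _) = (fun x => (re (conjc (phi x) * conjc (conjc (phi x))))%:E)).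
  by rewrite ltey_eq integrable_fin_num.
by apply/funext => x; rewrite mulc_conj cnorm_conj.
Qed.

Lemma moyal_term k : Cint nu (fun z => (pind B z.1)%:C * mterm (k, z)) =
  (L2norm2 phi * paravol B)%:C * (c (L k) * conjc (fcoef B psi (L k))).
Proof.
set a := L k; have Ha : lattice (dualbasis B) a by have [Lf _ _] := LB; exact: Lf.
rewrite (Cint_fubini (Cintg_pind_mterm k)) (Cint_fubini_swap (Cintg_pind_mterm k)).
pose GG xi := G xi * conjc (G xi).
transitivity (Cint lebN (fun xi => (c a * conjc ((paravol B)%:C * fcoef B psi a)) * GG (xi - a))).
  apply: eq_Cint => xi.
  (* Up to the factor c(a) G(xi - a), the integrand in [x] is the conjugate of [w], whose integral
     is known from [Cint_pind_stft]. *)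
  pose w x := (pind B x)%:C * expi (dotp x (xi - a)) * V x xi.
  have iw : Cintg lebN w.
    pose Q := ftc R n * (2 * (2 * pi) ^+ N) * (A * C).
    apply: (@Cintg_dom _ _ _ lebN _ (fun x => pind B x * Q)).
    - apply: CmeasM; last exact: (Cmeas_transfer (measurable_pair2 xi) Cmeas_stft).
      apply: CmeasM; first by apply: Cmeas_real; exact: measurable_pind.
      by apply: Cmeas_expi; exact: measurable_dotp.
    - move=> x; rewrite [cnorm _]cnormM [cnorm (_%:C * _)]cnormM cnorm_expi mulr1.
      rewrite cnorm_real ger0_norm ?pind_ge0// ler_wpM2l ?pind_ge0//.
      apply: (FT_pois_bound (a := x)).
        by apply: CmeasM => //; apply: Cmeas_conj; exact: Cmeas_shift.
      by move=> y; rewrite cnormM cnorm_conj -mulrA ler_pM ?cnorm_ge0.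
    - exact: (integrableZr measurableT Q (integrable_pind uB)).
  rewrite (_ : (fun x => _) = (fun x => c a * G (xi - a) * conjc (w x))).
    rewrite CintZ; last exact: Cintg_conj.
    rewrite Cint_conj// (@Cint_pind_stft R n B uB psi phi A C)// /GG.
    by move: (G _) (fcoef _ _ _) => g b; rewrite !conjcM; ring.
  apply/funext => x; rewrite /w -[mterm _]/(dterm x xi k * conjc (V x xi)) /dterm -/a.
  rewrite -[(pind B (x, xi).1)%:C]/((pind B x)%:C).

  by move: (G _) (V _ _) => g v; rewrite !conjcM conj_expi conjC_real; ring.
have GM xi : cnorm (conjc (G xi)) <= ftc R n * (2 * (2 * pi) ^+ N) * C.
  rewrite cnorm_conj; apply: (FT_pois_bound (a := 0)); first exact: Cmeas_conj.
  by move=> y; rewrite cnorm_conj subr0.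
have mcG : Meas (fun xi => conjc (G xi)) by apply: Cmeas_conj; exact: Cintg_meas Cintg_G.
have iGG : Cintg lebN GG by exact: (Cintg_bounded mcG GM Cintg_G).
rewrite CintZ; last exact: (Cintg_shift (- a) iGG).
(* Translation invariance in [xi] removes the shift by [a], so every term carries the same integral
   of |G|^2. *)
rewrite -(Cint_shift (- a) (Cintg_meas iGG)).
have [cc1 cc2] := ccont_conj cphi.
rewrite /GG (plancherel (M := C * 2 ^+ N) Cintg_phi Cintg_G)// Cint_phi_sqr.
by rewrite conjcM conjC_real rmorphM /=; ring.
Qed.

Lemma moyal_gt0 : 0 < L2norm2 phi * paravol B.
Proof. by rewrite mulr_gt0 ?L2norm2_gt0// normr_gt0 -unitfE -unitmxE. Qed.

(** The decay of the Fourier coefficients of [psi] is never estimated by itself: by [moyal_term]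
    each term of the pairing is a fixed multiple of an integral already dominated by
    [pois (L k)]. *)
Lemma Cintg_pairE : Cintg cnt (fun k => c (L k) * conjc (fcoef B psi (L k))).
Proof.
have k0 := moyal_gt0; set kk := _ * paravol B in k0.
pose q := fine (\int[nu]_z (pind B z.1 * pois z.2)%:E)%E.
have fq : (\int[nu]_z (pind B z.1 * pois z.2)%:E)%E \is a fin_num.
  exact: (integrable_fin_num measurableT integrable_pind_pois).
apply: (@Cintg_dom _ _ _ cnt _ (fun k => kk^-1 * (2 * (T * q)) * pois (L k))).
- exact: Cmeas_nat.
- move=> k; rewrite -mulrA ler_pdivlMl// -[X in X * _]gtr0_norm// -cnorm_real -cnormM.
  rewrite -moyal_term; have [mz bz] := (Cintg_meas (Cintg_pind_mterm k), pind_mterm_le k).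
  apply: (le_trans (cnorm_Cint_le mz bz (integrableZl measurableT _
    (integrableZl measurableT _ integrable_pind_pois)))).
  rewrite -mulrA ler_wpM2l//; under eq_integral do rewrite EFinM [X in (_ * X)%E]EFinM.
  rewrite integralZl//; last exact: (integrableZl measurableT _ integrable_pind_pois).
  rewrite integralZl//; last exact: integrable_pind_pois.
  by rewrite -(fineK fq) -!EFinM -/q /= mulrC.
- exact: (integrableZl measurableT _ integrable_pois_lattice).
Qed.

Theorem moyal : moyal_conclusion B c psi phi.
Proof.
split; first exact: cintegrable_moyal.
rewrite /pairE (csum_counting LB Cintg_pairE) moyal_rhs.
rewrite (_ : (fun k => Cint nu _) = (fun k => (L2norm2 phi * paravol B)%:C *
  (c (L k) * conjc (fcoef B psi (L k))))); last by apply/funext => k; exact: moyal_term.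
rewrite (CintZ _ Cintg_pairE) mulrA -rmorphM mulVf ?mul1r//.
by rewrite gt_eqF ?moyal_gt0.
Qed.

End Moyal.

(** * Choice of rates and constants *)

Section MoyalParameters.
Variables (R : realType) (n : nat).
Local Notation N := n.+1.
Local Notation vec := 'rV[R]_N.

(** Recovers the signs of the constants that [expR_le_pois] delivers without one. *)
Lemma factor_ge0 (x k y : R) : 0 < x -> 0 <= y -> x <= k * y -> 0 <= k.
Proof.
move=> x0 y0 xk; rewrite leNgt; apply/negP => k0.
by have := mulr_le0_ge0 (ltW k0) y0; rewrite leNgt (lt_le_trans x0 xk).
Qed.

Lemma moyal_decay (B : 'M[R]_N) (c psi phi : vec -> R[i]) (s A a C b D eps : R) :
  B \in unitmx -> 0 < s -> 0 < a -> 0 < b -> 0 <= C -> 0 <= eps ->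
  smooth psi -> smooth phi -> Defs.periodic B psi -> phi <> (fun _ => 0) ->
  (forall i k x, cnorm (derivs i psi k x) <= A * a ^+ k * (k`!%:R `^ s)) ->
  (forall i k x, cnorm (derivs i phi k x) <= C * b ^+ k * (k`!%:R `^ s) * pois x) ->
  (forall l, lattice (dualbasis B) l -> cnorm (c l) <= D * expR (eps * (enorm l `^ s^-1))) ->
  eps * ((N%:R * 2) `^ s^-1) <= rate s (a + b) / 4 ->
  moyal_conclusion B c psi phi.
Proof.
move=> uB s0 a0 b0 C0 e0 spsi sphi psiB phi0 Apsi Cphi cD er.
set p := s^-1 in cD er *; set r := rate s (a + b) in er *.
have p0 : 0 < p by rewrite invr_gt0.
have r0 : 0 < r by rewrite mulr_gt0 ?divr_gt0 ?powR_gt0 ?invr_gt0 ?addr_gt0.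
have psiA x : cnorm (psi x) <= A.
  by have := Apsi ord0 0%N x; rewrite derivs0 expr0 fact0 powR1 !mulr1.
have phiC x : cnorm (phi x) <= C * pois x.
  by have := Cphi ord0 0%N x; rewrite derivs0 expr0 fact0 powR1 !mulr1.
have A0 : 0 <= A := le_trans (cnorm_ge0 _) (psiA 0).
have [L LB] := lattice_enum (dualbasis_unit uB).
have LP k : lattice (dualbasis B) (L k) by have [Lf _ _] := LB; exact: Lf.
have D0 : 0 <= D.
  by have := le_trans (cnorm_ge0 _) (cD _ (LP 0%N)); rewrite pmulr_lge0 ?expR_gt0.
pose K1 := decayc n s * C; pose K2 := decayc n s * (A * C).
have dc0 : 0 <= decayc n s.
  by rewrite /decayc !mulr_ge0 ?exprn_ge0 ?powR_ge0 ?(ltW (ftc_gt0 _ _)) ?(ltW (pi2_gt0 _)).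
have K10 : 0 <= K1 := mulr_ge0 dc0 C0.
have K20 : 0 <= K2 := mulr_ge0 dc0 (mulr_ge0 A0 C0).
have GE xi : cnorm (FT (fun y => conjc (phi y)) xi) <= K1 * expR (- (r * `|xi| `^ p)).
  apply: (@FT_exp_decay R n s (a + b) C 0); rewrite ?addr_gt0// => i.
  exists (fun k y => conjc (derivs i phi k y)); split.
  - exact: cchain_conj (cchain_derivs i sphi).
  - by rewrite derivs0.
  (* Enlarging [b] to [a + b] gives the transform of the window the same rate [r] as the short-time
     transform. *)
  move=> k x; rewrite cnorm_conj subr0; apply: (le_trans (Cphi i k x)).
  rewrite ler_wpM2r ?pois_ge0// ler_wpM2r ?powR_ge0// ler_wpM2l//.
  by rewrite lerXn2r ?nnegrE ?addr_ge0 ?(ltW a0) ?(ltW b0)// lerDr ltW.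
have VE x xi : cnorm (stft phi psi x xi) <= K2 * expR (- (r * `|xi| `^ p)).
  exact: windowed_decay.
clearbody K1 K2.
have d0 : 0 < r / 2 * (2 `^ p)^-1 by rewrite mulr_gt0 ?divr_gt0// invr_gt0 powR_gt0.
have r4 : 0 < r / 4 by rewrite divr_gt0.
(* [A1] is for the sum over the lattice, [A2] for the rate r/4 left over in [xi], and [A3] for the
   integrability of the transform of conj(phi). *)
have [A1 HA1] := @expR_le_pois R n (r / 2 * (2 `^ p)^-1) s
  d0 s0.
have [A2 HA2] := @expR_le_pois R n (r / 4) s r4 s0.
have [A3 HA3] := @expR_le_pois R n r s r0 s0.
have A10 := factor_ge0 (expR_gt0 _) (pois_ge0 _) (HA1 0).
have A20 := factor_ge0 (expR_gt0 _) (pois_ge0 _) (HA2 0).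
have cG k xi : cnorm (c (L k)) * cnorm (FT (fun y => conjc (phi y)) (xi - L k)) <=
    D * K1 * expR (3 / 4 * r * `|xi| `^ p) * A1 * pois (L k).
  apply: le_trans (lattice_coef_decay p0 r0 e0 er (cnorm_ge0 _) (cnorm_ge0 _)
    (cD _ (LP k)) (GE _)) _.
  by rewrite -[leRHS]mulrA ler_wpM2l ?HA1// !mulr_ge0 ?expR_ge0.
apply: (@moyal R n B uB c psi phi L LB A C (K1 * A3) (D * K1 * A1 * (K2 * A2))
  (fun xi => D * K1 * expR (3 / 4 * r * `|xi| `^ p) * A1)) => //.
- by have [] := cchain_derivs ord0 spsi 0; rewrite derivs0.
- by have [] := cchain_derivs ord0 sphi 0; rewrite derivs0.
- by move=> xi; apply: (le_trans (GE xi)); rewrite -mulrA ler_wpM2l ?HA3.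
- move=> k x xi; apply: (le_trans (ler_pM _ (cnorm_ge0 _) (cG k xi) (VE x xi))).
    by rewrite mulr_ge0 ?cnorm_ge0.
  (* The growth with exponent 3r/4 in [xi] is absorbed by the rate [r] of the short-time transform,
     leaving r/4. *)
  have := HA2 xi; set e2 := expR (- (r / 4 * _)) => He2.
  have -> : D * K1 * expR (3 / 4 * r * `|xi| `^ p) * A1 * pois (L k) *
      (K2 * expR (- (r * `|xi| `^ p))) = D * K1 * A1 * K2 * pois (L k) * e2.
    rewrite (_ : e2 = expR (3 / 4 * r * `|xi| `^ p) * expR (- (r * `|xi| `^ p))).
      by move: (expR _) (expR (- (r * _))) => u v; ring.
    by rewrite /e2 -expRD; congr expR; field.
  apply: (@le_trans _ _ (D * K1 * A1 * K2 * pois (L k) * (A2 * pois xi))).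
    by rewrite ler_wpM2l// !mulr_ge0 ?pois_ge0.
  by rewrite le_eqVlt; apply/orP; left; apply/eqP; ring.
- by rewrite !mulr_ge0.
- apply: contrapT => H; apply: phi0; apply/funext => x; apply: contrapT => px.
  by apply: H; exists x.
Qed.

Lemma GS_bound_ge0 (s t h C : R) (phi : vec -> R[i]) : GS_bound s t h C phi -> 0 <= C.
Proof.
move=> /(_ (pure ord0 0) (pure ord0 0) 0)/(le_trans (cnorm_ge0 _)).
by rewrite mabs_pure mfact_pure expr0 fact0 !powR1 !mulr1.
Qed.

(** Common form of both cases: the quantifiers over [h] and [eps] are gone and only the last
    inequality relates the constants. *)
Lemma moyal_gelfand_shilov (B : 'M[R]_N) (c psi phi : vec -> R[i]) (s t h h' C A D eps : R) :
  B \in unitmx -> 0 < s -> 0 < h -> 0 < h' -> 0 <= eps ->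
  smooth psi -> smooth phi -> Defs.periodic B psi -> phi <> (fun _ => 0) ->
  Gev_bound s h' A (Defs.para B) psi -> GS_bound s t h C phi ->
  (forall l, lattice (dualbasis B) l -> cnorm (c l) <= D * expR (eps * (enorm l `^ s^-1))) ->
  eps * ((N%:R * 2) `^ s^-1) <= rate s (h' + h) / 4 ->
  moyal_conclusion B c psi phi.
Proof.
move=> uB s0 h0 h'0 e0 spsi sphi psiB phi0 psih phih cD er.
apply: (@moyal_decay B c psi phi s A h' (C * (1 + h ^+ (2 * N) * ((2 * N)`!%:R `^ t))) h D eps) => //.
- by rewrite mulr_ge0 ?(GS_bound_ge0 phih)// addr_ge0// mulr_ge0 ?powR_ge0// exprn_ge0// ltW.
- exact: (derivs_Gev_bound uB psiB psih).
- exact: (derivs_GS_bound h0 phih).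
Qed.

Lemma rate_gt0 (s h : R) : 0 < s -> 0 < h -> 0 < rate s h.
Proof. by move=> s0 h0; rewrite mulr_gt0 ?divr_gt0 ?powR_gt0 ?invr_gt0. Qed.

(** Small derivative constants give arbitrarily large rates, as needed when the growth of the
    coefficients is prescribed; [h] solves (s/2) h^(-1/s) = q. *)
Lemma rate_surj (s q : R) : 0 < s -> 0 < q -> exists2 h, 0 < h & rate s h = q.
Proof.
move=> s0 q0; have q20 : 0 < 2 * q / s by rewrite divr_gt0// mulr_gt0.
exists ((2 * q / s) `^ (- s)); first exact: powR_gt0.
rewrite /rate powRN invrK -powRrM mulfV ?gt_eqF// powRr1 ?ltW//.
by field; rewrite gt_eqF.
Qed.

End MoyalParameters.

Theorem theorem3p2 (R : realType) (d : nat) : (0 < d)%N ->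
  (forall (B : 'M[R]_d) (s t : R) (c psi phi : 'rV[R]_d -> R[i]),
     B \in unitmx -> 0 < s -> 0 < t -> 1 <= s + t ->
     dual_Es s B c -> Es s B psi -> GS_S s t phi -> phi <> (fun _ => 0) ->
     moyal_conclusion B c psi phi) /\
  (forall (B : 'M[R]_d) (s t : R) (c psi phi : 'rV[R]_d -> R[i]),
     B \in unitmx -> 0 < s -> 0 < t -> 1 <= s + t ->
     dual_E0s s B c -> E0s s B psi -> GS_Sigma s t phi -> phi <> (fun _ => 0) ->
     moyal_conclusion B c psi phi).
Proof.
case: d => // n _.
split=> B s t c psi phi uB s0 t0 _.
- move=> cD [[spsi psiG] psiB] [sphi [h [h0 [C phih]]]] phi0.
  have [h' [h'0 [A psih]]] := psiG _ (@para_compact R n B).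
  have q0 : 0 < (n.+1%:R * 2) `^ s^-1 :> R by rewrite powR_gt0// mulr_gt0.
  have r0 : 0 < rate s (h' + h) / 4 by rewrite divr_gt0// rate_gt0// addr_gt0.
  (* The rate is fixed by [h'] and [h]; the growth exponent is chosen to turn the required
     inequality into an equality. *)
  have [D HD] := cD _ (divr_gt0 r0 q0).
  apply: (moyal_gelfand_shilov uB s0 h0 h'0 _ spsi sphi psiB phi0 psih phih HD).
    by rewrite ltW// divr_gt0.
  by rewrite divfK// gt_eqF.
move=> [eps [e0 [D HD]]] [[spsi psiG] psiB] [sphi phiG] phi0.
have q0 : 0 < (n.+1%:R * 2) `^ s^-1 :> R by rewrite powR_gt0// mulr_gt0.
(* Here [eps] is prescribed: the rate is set to 4 eps (2N)^(1/s), and its [h] is shared equally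
   between [psi] and [phi], whose constants add up. *)
have [h h0 rh] := rate_surj s0 (mulr_gt0 (mulr_gt0 e0 q0) (ltr0Sn R 3)).
have h20 : 0 < h / 2 by rewrite divr_gt0.
have [A psih] := psiG _ (@para_compact R n B) _ h20.
have [C phih] := phiG _ h20.
apply: (moyal_gelfand_shilov uB s0 h20 h20 (ltW e0) spsi sphi psiB phi0 psih phih HD).
by rewrite -splitr rh mulfK.
Qed.
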